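(* The bounded fully positive characters on $(\mathcal{U},+)$ are exactly the functions $\rho:\mathcal{U}\to\mathbb{R}$ satisfying, for every $n$ and every labeled graph $F$ with node set $[n]$ and no isolated nodes, \[\rho([F])=\int_{[0,1]^n}\prod_{\{i,j\}\in E(F)}W(u_i,u_j)\,\mathrm{d}u\] for some measurable symmetric function $W:[0,1]^2\to[0,1]$. The function $W$ is unique up to measure-preserving transformations of the unit interval.
   Context: All graphs are simple. $\mathcal{U}$ is the set of isomorphism classes $[F]$ of finite simple graphs (including the empty graph $\emptyset$), an Abelian semigroup under node-disjoint union $+$ with neutral element $\emptyset$. A character is a function $\rho:\mathcal{U}\to\mathbb{R}$ with $\rho(s+t)=\rho(s)\rho(t)$ and $\rho(\emptyset)=1$. $E(B)$ denotes the edge set of a labeled graph $B$; for labeled graphs on the same node set, $G\subseteq B$ means $E(G)\subseteq E(B)$, and $K_n$ is the complete graph on $[n]$. A bounded character $\rho$ is fully positive if for every $n\in\mathbb{N}$ and every labeled graph $G$ with node set $[n]$, $\sum_{B:\,G\subseteq B\subseteq K_n}(-1)^{|E(B)\setminus E(G)|}\rho([B])\ge 0$ (sum over labeled graphs $B$ with node set $[n]$); equivalently, $F\mapsto\rho([F])$ is the Möbius parameter $F\mapsto P(F\subseteq G)$ of the distribution of some random graph $G$ on node set $\mathbb{N}$.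
   Formalization: The formula leaves ρ free on graphs with isolated nodes, so ''exactly'' is read on graphs without isolated nodes: every bounded fully positive character satisfies the formula for some W, and every W satisfies it for some bounded fully positive character. *)

(* Defs.v *)
From HB Require Import structures.
From mathcomp Require Import all_boot all_order all_algebra.
From mathcomp Require Import all_classical all_reals all_analysis.
Set Implicit Arguments. Unset Strict Implicit. Unset Printing Implicit Defensive.
Import Order.TTheory GRing.Theory Num.Theory.
Import numFieldNormedType.Exports.
Local Open Scope ring_scope.

Definition is_sgraph (n : nat) (E : {set {set 'I_n}}) : bool :=
  [forall e in E, #|e| == 2].

Definition sgraph (n : nat) := {E : {set {set 'I_n}} | is_sgraph E}.

Definition no_isolated (n : nat) (F : sgraph n) : bool :=
  [forall i : 'I_n, [exists e in val F, i \in e]].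

(** Functions on the semigroup U of isomorphism classes are represented by
    isomorphism-invariant functions on labeled graphs. *)
Definition graph_fun (R : Type) := forall n : nat, sgraph n -> R.

Definition iso_invariant (R : Type) (rho : graph_fun R) : Prop :=
  forall (n m : nat) (G : sgraph n) (H : sgraph m) (f : 'I_n -> 'I_m),
    bijective f -> val H = [set f @: (e : {set 'I_n}) | e in val G] -> rho n G = rho m H.

Definition dunion_edges (n m : nat) (G : sgraph n) (H : sgraph m)
  : {set {set 'I_(n + m)}} :=
  [set (@lshift n m) @: (e : {set 'I_n}) | e in val G] :|: [set (@rshift n m) @: (e : {set 'I_m}) | e in val H].

Definition character (R : realType) (rho : graph_fun R) : Prop :=
  (forall G : sgraph 0, rho 0 G = 1) /\
  (forall (n m : nat) (G : sgraph n) (H : sgraph m) (K : sgraph (n + m)),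
      val K = dunion_edges G H -> rho (n + m) K = rho n G * rho m H).

Definition bounded_gfun (R : realType) (rho : graph_fun R) : Prop :=
  exists C : R, forall (n : nat) (G : sgraph n), `|rho n G| <= C.

Definition fully_positive (R : realType) (rho : graph_fun R) : Prop :=
  forall (n : nat) (G : sgraph n),
    0 <= \sum_(B : sgraph n | val G \subset val B)
           (-1) ^+ #|val B :\: val G| * rho n B.

Definition bfp_character (R : realType) (rho : graph_fun R) : Prop :=
  [/\ iso_invariant rho, character rho, bounded_gfun rho & fully_positive rho].

Local Open Scope classical_set_scope.

Definition I01 (R : realType) : set R := `[0%R, 1%R].
Arguments I01 R : clear implicits.


(** W : [0,1]^2 -> [0,1] measurable and symmetric (values outside [0,1]^2
    are irrelevant). *)
Definition graphon (R : realType) (W : R -> R -> R) : Prop :=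
  [/\ measurable_fun ((I01 R) `*` (I01 R)) (fun p : R * R => W p.1 p.2),
      (forall x y, x \in (I01 R) -> y \in (I01 R) -> W x y = W y x) &
      (forall x y, x \in (I01 R) -> y \in (I01 R) -> 0 <= W x y <= 1)].

(** Iterated Lebesgue integral over [0,1]^k of the coordinates 0..k-1:
    iint k f u = \int_{[0,1]} ... \int_{[0,1]} f(u with u_0..u_{k-1} replaced). *)
Fixpoint iint (R : realType) (k : nat) (f : (nat -> R) -> R) (u : nat -> R) : R :=
  match k with
  | 0 => f u
  | k'.+1 => Rintegral (@lebesgue_measure R) (I01 R)
               (fun x : R => iint k' f (fun j => if j == k' then x else u j))
  end.

Definition hom_dens (R : realType) (W : R -> R -> R) (n : nat) (F : sgraph n) : R :=
  iint n (fun u : nat -> R =>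
            \prod_(i : 'I_n) \prod_(j : 'I_n | (i < j)%N && ([set i; j]%SET \in val F))
               W (u i) (u j))
       (fun _ => 0).

Definition represents (R : realType) (rho : graph_fun R) (W : R -> R -> R) : Prop :=
  forall (n : nat) (F : sgraph n), no_isolated F -> rho n F = hom_dens W F.

Definition mp_map (R : realType) (phi : R -> R) : Prop :=
  [/\ measurable_fun (I01 R) phi,
      (forall x, x \in (I01 R) -> phi x \in (I01 R)) &
      (forall A : set R, measurable A -> A `<=` (I01 R) ->
         @lebesgue_measure R ((I01 R) `&` phi @^-1` A) = @lebesgue_measure R A)].

Definition weakly_iso (R : realType) (W1 W2 : R -> R -> R) : Prop :=
  exists phi psi : R -> R, [/\ mp_map phi, mp_map psi &
    ((@lebesgue_measure R) \x (@lebesgue_measure R))%E.-negligible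
      [set p : R * R | p \in (I01 R) `*` (I01 R) /\
         W1 (phi p.1) (phi p.2) <> W2 (psi p.1) (psi p.2)]].

(* Main.v *)
Require Import Defs.
From HB Require Import structures.
From mathcomp Require Import all_boot all_order all_algebra zify ring lra.
Set Implicit Arguments. Unset Strict Implicit. Unset Printing Implicit Defensive.
Import Order.TTheory GRing.Theory Num.Theory.
Local Open Scope ring_scope.

(* Full positivity says that the Möbius inverse of rho on [n] is a probability
   distribution on labeled graphs. Sampling a graph from it and taking its
   adjacency matrix as a kernel gives, by multiplicativity and a second moment
   estimate, finite kernels whose subgraph densities converge to rho (up to a
   factor c per vertex, c being the value of rho on the one-vertex graph, which
   is absorbed by diluting the kernel with isolated vertices). Each finite
   kernel is partitioned by a greedy energy-increment refinement, so that its
   vertices are coded by bit strings; along an ultrafilter the code masses and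
   block densities converge, the masses define nested subintervals of [0,1] and
   the block densities a function on [0,1]^2 that converges in L1 to a graphon W.
   Energy increments and the counting lemma show that W has the densities rho.
   Conversely, the densities of a graphon are approximated in L1 by those of
   dyadic step kernels, for which all axioms are finite computations.

   For uniqueness, let W1 and W2 have equal densities. Then their W-random graphs
   on [n] have the same law, and with positive probability one such graph is
   close in cut norm to step approximations of both W1 and W2; this couples the
   dyadic blocks of W1 and W2. In an ultralimit the couplings give a probability
   on pairs of infinite bit strings, with uniform marginals, under which W1 of
   the first strings equals W2 of the second almost surely. Parametrising this
   probability by [0,1], the two strings are the binary digits of the required
   measure-preserving maps. *)

(** * Expectation over independent samples from a finite probability space *)

(** The obstacle is that a random graph is in general not close to its kernel in L1, only in cut
    norm, while a limit kernel needs L1 convergence. For existence, each kernel is replaced by its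
    block averages. Nested averages obey Pythagoras, so their L2 distance is an energy difference: a
    finite identity that survives ultralimits and stands in for martingale convergence. Splitting
    always by an exactly worst pair of sets removes any regularity parameter: the cut error of a
    partition is at most the square root of the next energy gain. For uniqueness, the sampled graph
    cancels between two cut-norm estimates, and what is left compares step kernels of a fixed
    resolution. There the L1 norm is at most the number of pairs of cells times the cut norm, so the
    resolution is frozen first and the sampling error sent to zero afterwards. An ultrafilter gives
    all the limits at once, and the multiplicativity of its limits carries over products of
    densities. *)

Section FiniteExpectation.
Variables (R : realFieldType) (I V : finType) (a : V -> R).

Definition fexp (K : {ffun I -> V} -> R) : R :=
  \sum_(phi : {ffun I -> V}) (\prod_i a (phi i)) * K phi.

Definition upd (phi : {ffun I -> V}) (i : I) (x : V) : {ffun I -> V} :=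
  [ffun j => if j == i then x else phi j].

Lemma updE phi i x j : upd phi i x j = if j == i then x else phi j.
Proof. by rewrite ffunE. Qed.

Lemma upd_upd phi i x y : upd (upd phi i x) i y = upd phi i y.
Proof. by apply/ffunP => j; rewrite !updE; case: eqP. Qed.

Lemma upd_id phi i : upd phi i (phi i) = phi.
Proof. by apply/ffunP => j; rewrite !updE; case: eqP => // ->. Qed.

Lemma eq_fexp K K' : K =1 K' -> fexp K = fexp K'.
Proof. by move=> KK'; apply: eq_bigr => phi _; rewrite KK'. Qed.

Lemma fexpD K K' : fexp (fun phi => K phi + K' phi) = fexp K + fexp K'.
Proof. by rewrite -big_split; apply: eq_bigr => phi _; rewrite mulrDr. Qed.

Lemma fexpB K K' : fexp (fun phi => K phi - K' phi) = fexp K - fexp K'.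
Proof. by rewrite -sumrB; apply: eq_bigr => phi _; rewrite mulrBr. Qed.

Lemma fexpZ c K : fexp (fun phi => c * K phi) = c * fexp K.
Proof. by rewrite mulr_sumr; apply: eq_bigr => phi _; rewrite mulrCA. Qed.

Lemma fexp_sum (J : Type) (s : seq J) (P : pred J) (K : J -> {ffun I -> V} -> R) :
  fexp (fun phi => \sum_(j <- s | P j) K j phi) = \sum_(j <- s | P j) fexp (K j).
Proof.
by rewrite exchange_big; apply: eq_bigr => phi _; rewrite mulr_sumr.
Qed.

Hypothesis a_ge0 : forall v, 0 <= a v.

Lemma fexp_wt_ge0 (phi : {ffun I -> V}) : 0 <= \prod_i a (phi i).
Proof. exact: prodr_ge0. Qed.

Lemma ler_fexp K K' : (forall phi, K phi <= K' phi) -> fexp K <= fexp K'.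
Proof. by move=> KK'; apply: ler_sum => phi _; rewrite ler_wpM2l ?fexp_wt_ge0. Qed.

Lemma fexp_ge0 K : (forall phi, 0 <= K phi) -> 0 <= fexp K.
Proof. by move=> K0; apply: sumr_ge0 => phi _; rewrite mulr_ge0 ?fexp_wt_ge0. Qed.

Lemma ler_norm_fexp K : `|fexp K| <= fexp (fun phi => `|K phi|).
Proof.
rewrite (le_trans (ler_norm_sum _ _ _))//; apply: ler_sum => phi _.
by rewrite normrM (ger0_norm (fexp_wt_ge0 _)).
Qed.

Hypothesis a_sum1 : \sum_v a v = 1.

Lemma fexp_cst c : fexp (fun=> c) = c.
Proof.
rewrite /fexp -mulr_suml.
rewrite -(bigA_distr_bigA (fun (_ : I) v => a v)) big1 ?mul1r// => i _.
Qed.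

(* (phi, x) |-> (upd phi i x, phi i) is a weight-preserving involution *)
Lemma fexp_resample i K : fexp K = fexp (fun phi => \sum_x a x * K (upd phi i x)).
Proof.
transitivity (\sum_(q : {ffun I -> V} * V) (\prod_j a (q.1 j)) * a q.2 * K q.1).
  rewrite -(pair_bigA _ (fun (phi : {ffun I -> V}) x => (\prod_j a (phi j)) * a x * K phi)) /=.
  apply: eq_bigr => phi _; rewrite -[LHS]mulr1 -a_sum1 mulr_sumr.
  by apply: eq_bigr => x _; ring.
pose h (q : {ffun I -> V} * V) := (upd q.1 i q.2, q.1 i).
have hK : involutive h.
  move=> [phi x]; rewrite /h /= upd_upd upd_id; congr (_, _).
  by rewrite updE eqxx.
rewrite (reindex h) /=; last by exists h => q _; exact: hK.
rewrite /fexp.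
transitivity (\sum_(q : {ffun I -> V} * V) (\prod_j a (q.1 j)) * a q.2 * K (upd q.1 i q.2)).
  apply: eq_bigr => -[phi x] _ /=; congr (_ * _).
  rewrite (bigD1 i) //= [in RHS](bigD1 i) //= updE eqxx.
  rewrite (eq_bigr (fun j => a (phi j))); first by ring.
  by move=> j /negbTE ji; rewrite updE ji.
rewrite -(pair_bigA _ (fun (phi : {ffun I -> V}) x => (\prod_j a (phi j)) * a x * K (upd phi i x))) /=.
by apply: eq_bigr => phi _; rewrite mulr_sumr; apply: eq_bigr => x _; ring.
Qed.

Lemma fexp1 i (g : V -> R) : fexp (fun phi => g (phi i)) = \sum_x a x * g x.
Proof.
rewrite (fexp_resample i) -[RHS]fexp_cst; apply: eq_fexp => phi.
by apply: eq_bigr => x _; rewrite updE eqxx.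
Qed.

Lemma fexp2 i j (g : V -> V -> R) : i != j ->
  fexp (fun phi => g (phi i) (phi j)) = \sum_x \sum_y a x * a y * g x y.
Proof.
move=> ij; rewrite (fexp_resample i) (fexp_resample j) -[RHS]fexp_cst.
apply: eq_fexp => phi; rewrite exchange_big /=; apply: eq_bigr => y _.
rewrite mulr_sumr; apply: eq_bigr => x _.
by rewrite !updE !eqxx (eq_sym j) (negbTE ij); ring.
Qed.

End FiniteExpectation.

Section Jensen.
Variables (R : realFieldType) (V : finType) (a : V -> R).
Hypothesis a_ge0 : forall v, 0 <= a v.
Hypothesis a_sum1 : \sum_v a v = 1.

(** The difference of the two sides is the variance of [x] under the weights [a]. *)
Lemma sqr_wsum_le (x : V -> R) : (\sum_v a v * x v) ^+ 2 <= \sum_v a v * x v ^+ 2.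
Proof.
set m := \sum_v a v * x v.
rewrite -subr_ge0.
have -> : \sum_v a v * x v ^+ 2 - m ^+ 2 = \sum_v a v * (x v - m) ^+ 2.
  transitivity (\sum_v (a v * x v ^+ 2 - 2 * m * (a v * x v) + m ^+ 2 * a v)).
    by rewrite big_split sumrB /= -!mulr_sumr -/m a_sum1; ring.
  by apply: eq_bigr => v _; ring.
by apply: sumr_ge0 => v _; rewrite mulr_ge0 ?sqr_ge0.
Qed.

Lemma sqr_wsum_mask_le (x b : V -> R) : (forall v, 0 <= b v <= 1) ->
  (\sum_v a v * (b v * x v)) ^+ 2 <= \sum_v a v * x v ^+ 2.
Proof.
move=> b01; rewrite (le_trans (sqr_wsum_le _))//; apply: ler_sum => v _.
rewrite ler_wpM2l// exprMn -[leRHS]mul1r ler_wpM2r ?sqr_ge0//.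
by have /andP[b0 b1] := b01 v; rewrite expr_le1.
Qed.

End Jensen.

(* A bilinear form is maximised over [0,1]-valued arguments at indicators *)
Section CutBound.
Variables (R : realFieldType) (V : finType) (u : V -> V -> R) (D : R).
Hypothesis cut : forall S T : {set V}, `|\sum_(x in S) \sum_(y in T) u x y| <= D.

Lemma ler_norm_lin_indicator (L g : V -> R) (C : R) : (forall x, 0 <= g x <= 1) ->
  (forall S : {set V}, `|\sum_(x in S) L x| <= C) -> `|\sum_x g x * L x| <= C.
Proof.
move=> g01 LC; rewrite ler_norml; apply/andP; split.
  have := LC [set x | L x < 0]; rewrite ler_norml => /andP[+ _].
  move=> /le_trans; apply; rewrite big_mkcond /=; apply: ler_sum => x _.
  rewrite inE; have /andP[g0 g1] := g01 x; case: ltP => Lx; nra.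
have := LC [set x | 0 < L x]; rewrite ler_norml => /andP[_].
apply: le_trans; rewrite [leRHS]big_mkcond /=; apply: ler_sum => x _.
rewrite inE; have /andP[g0 g1] := g01 x; case: ltP => Lx; nra.
Qed.

Lemma cut_bilin (g h : V -> R) :
  (forall x, 0 <= g x <= 1) -> (forall x, 0 <= h x <= 1) ->
  `|\sum_x \sum_y g x * h y * u x y| <= D.
Proof.
move=> g01 h01.
rewrite (eq_bigr (fun x => g x * \sum_y h y * u x y)); last first.
  by move=> x _; rewrite mulr_sumr; apply: eq_bigr => y _; rewrite mulrA.
apply: ler_norm_lin_indicator => // S; rewrite exchange_big /=.
rewrite (eq_bigr (fun y => h y * \sum_(x in S) u x y)); last first.
  by move=> y _; rewrite mulr_sumr.
by apply: ler_norm_lin_indicator => // T; rewrite exchange_big.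
Qed.

End CutBound.

(** * Densities in finite kernels *)

(** Inclusion-exclusion: if the elements of [A] occur independently with probabilities [x e], the
    right side is the probability that exactly [E] occurs. *)
Lemma moebius_prod (R : comNzRingType) (T : finType) (A E : {set T}) (x : T -> R) :
  E \subset A ->
  \sum_(B : {set T} | (E \subset B) && (B \subset A))
     (-1) ^+ #|B :\: E| * \prod_(e in B) x e =
  \prod_(e in E) x e * \prod_(e in A :\: E) (1 - x e).
Proof.
move=> EA.
(* Expanding the product of the [F e + G e] gives a sum over all sets [B], with [F] on [B] and [G]
   off it. The zeros of [G] on [E] and of [F] outside [A] leave only [E \subset B \subset A]. *)
pose F e := if e \in E then x e else if e \in A then - x e else 0.
pose G e : R := if e \in E then 0 else 1.
have -> : \prod_(e in E) x e * \prod_(e in A :\: E) (1 - x e) = \prod_e (F e + G e).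
  rewrite big_mkcond /= [X in _ * X]big_mkcond -big_split /=.
  apply: eq_bigr => e _; rewrite /F /G !inE; case: (e \in E) => /=.
    by rewrite addr0 mulr1.
  by case: (e \in A); rewrite mul1r ?add0r// addrC.
rewrite bigA_distr big_mkcond /=; apply: eq_bigr => B _.
have [/andP[EB BA]|] := boolP ((E \subset B) && (B \subset A)); last first.
  rewrite negb_and => /orP[] /subsetPn[e].
    by move=> eE eB; rewrite (bigD1 e) //= (negbTE eB) /G eE mul0r.
  move=> eB eA; rewrite (bigD1 e) //= eB /F (negbTE eA).
  by rewrite (_ : e \in E = false) ?mul0r//; apply: contraNF eA => /(subsetP EA).
have -> : (-1) ^+ #|B :\: E| = \prod_(e in B :\: E) (-1) :> R.
  by rewrite prodr_const.
rewrite [X in X * _]big_mkcond [X in _ * X]big_mkcond -big_split /=.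
apply: eq_bigr => e _; rewrite /F /G !inE.
have [eE|eE] /= := boolP (e \in E).
  by rewrite (subsetP EB) // mul1r.
have [eB|eB] /= := boolP (e \in B); last by rewrite mul1r.
by rewrite (subsetP BA) // mulN1r.
Qed.

(** After exchanging the sums, the coefficient of [r B] is an alternating sum over the sets between
    [F] and [B]. Up to the sign of [B :\: F] it is [moebius_prod] at [x = 1], hence zero unless
    [B = F]. *)
Lemma moebius_inversion (R : comNzRingType) (T : finType) (A F : {set T}) (r : {set T} -> R) :
  F \subset A ->
  \sum_(E : {set T} | (F \subset E) && (E \subset A))
    \sum_(B : {set T} | (E \subset B) && (B \subset A)) (-1) ^+ #|B :\: E| * r B = r F.
Proof.
move=> FA.
rewrite (exchange_big_dep (fun B : {set T} => (F \subset B) && (B \subset A))) /=; last first.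
  by move=> E B /andP[FE EA] /andP[EB ->]; rewrite (subset_trans FE EB).
have key (B : {set T}) : F \subset B ->
    \sum_(E : {set T} | (F \subset E) && (E \subset B)) (-1) ^+ #|B :\: E| = (F == B)%:R :> R.
  move=> FB.
  have := moebius_prod (fun=> 1 : R) FB.
  rewrite (eq_bigr (fun E : {set T} => (-1) ^+ #|B :\: F| * (-1) ^+ #|B :\: E|)).
    rewrite -mulr_sumr big1_eq mul1r => h.
    have : (-1) ^+ #|B :\: F| * ((-1) ^+ #|B :\: F| *
      \sum_(E : {set T} | (F \subset E) && (E \subset B)) (-1) ^+ #|B :\: E|) =
      (-1) ^+ #|B :\: F| * \prod_(e in B :\: F) (1 - 1) :> R by rewrite h.
    rewrite mulrA -exprD addnn -signr_odd odd_double expr0 mul1r => ->.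
    rewrite subrr prodr_const expr0n cards_eq0 setD_eq0.
    rewrite eqEsubset FB /=; case: (boolP (B \subset F)) => [BF|]; last by rewrite mulr0.
    by move: BF; rewrite -setD_eq0 => /eqP ->; rewrite cards0 expr0 mulr1.
  move=> E /andP[FE EB]; rewrite big1_eq mulr1 -exprD.
  rewrite -[LHS]signr_odd -[RHS]signr_odd; congr (_ ^+ _).
  rewrite oddD -(cardsID E (B :\: F)) oddD.
  have -> : (B :\: F) :&: E = E :\: F.
    by rewrite setIC setIDA (setIidPl EB).
  have -> : B :\: F :\: E = B :\: E.
    by rewrite setDDl (setUidPr FE).
  by rewrite addbK.
rewrite (eq_bigr (fun B : {set T} => (F == B)%:R * r B)).
  rewrite (bigD1 F) ?subxx //= eqxx mul1r big1 ?addr0// => B /andP[_ BF].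
  by rewrite eq_sym (negbTE BF) mul0r.
move=> B /andP[FB BA]; rewrite -key// mulr_suml; apply: eq_bigl => E.
rewrite BA andbT; case FE: (F \subset E) => //=.
by case EB: (E \subset B); rewrite ?andbT ?andbF// (subset_trans EB BA).
Qed.

Definition pairs (n : nat) : {set {set 'I_n}} := [set e : {set 'I_n} | #|e| == 2].

Section EdgeWeight.
Variables (R : comNzRingType) (n : nat) (x : 'I_n -> 'I_n -> R).

(** At most one factor: [x] read at the increasing enumeration of a two-element set, and 1 on any
    other set. This turns products over ordered pairs into products over edges. *)
Definition eweight (e : {set 'I_n}) : R :=
  \prod_(p : 'I_n * 'I_n | (p.1 < p.2)%N && (e == [set p.1; p.2])) x p.1 p.2.

Lemma prod_eweight (E : {set {set 'I_n}}) :
  \prod_(i : 'I_n) \prod_(j : 'I_n | (i < j)%N && ([set i; j] \in E)) x i j = \prod_(e in E) eweight e.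
Proof.
rewrite pair_big_dep /= (partition_big (fun p => [set p.1; p.2]) (fun e => e \in E)) /=.
  apply: eq_bigr => e eE; apply: eq_bigl => p; rewrite (eq_sym e).
  by case: eqP => [->|]; rewrite ?andbF// eE !andbT.
by move=> p /andP[].
Qed.


Lemma set2_ord_inj (i j k l : 'I_n) : (i < j)%N -> (k < l)%N ->
  [set i; j] = [set k; l] -> i = k /\ j = l.
Proof.
move=> ij kl eq2.
have : i \in [set k; l] by rewrite -eq2 set21.
have : j \in [set k; l] by rewrite -eq2 set22.
have : k \in [set i; j] by rewrite eq2 set21.
rewrite !inE => /orP[]/eqP/(congr1 val)/= kk /orP[]/eqP/(congr1 val)/= jj
  /orP[]/eqP/(congr1 val)/= ii; split; apply: val_inj => /=; lia.
Qed.

Lemma eweight_set2_lt (i j : 'I_n) : (i < j)%N -> eweight [set i; j] = x i j.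
Proof.
move=> ij; rewrite /eweight (big_pred1 (i, j))// => -[k l] /=.
apply/andP/eqP => [[kl /eqP /set2_ord_inj]|[-> ->]//].
by move=> /(_ ij kl)[-> ->].
Qed.

Hypothesis xC : forall i j, x i j = x j i.

Lemma eweight_set2 (i j : 'I_n) : i != j -> eweight [set i; j] = x i j.
Proof.
rewrite neq_ltn => /orP[ij|ji]; first exact: eweight_set2_lt.
by rewrite setUC eweight_set2_lt// xC.
Qed.

End EdgeWeight.

Lemma eweight_ind (R : realFieldType) (n : nat) (x : 'I_n -> 'I_n -> R) e :
  (forall i j, 0 <= x i j <= 1) -> 0 <= eweight x e <= 1.
Proof.
move=> x01; apply/andP; split.
  by apply: prodr_ge0 => p _; case/andP: (x01 p.1 p.2).
by apply: prodr_ile1 => p _; exact: x01.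
Qed.

Section Density.
Variables (R : realFieldType) (V : finType) (a : V -> R) (w : V -> V -> R).

(** Homomorphism density of the graph [E] in the graph with vertex masses [a] and edge weights
    [w]. *)
Definition tfin (n : nat) (E : {set {set 'I_n}}) : R :=
  fexp a (fun phi : {ffun 'I_n -> V} =>
    \prod_(e in E) eweight (fun i j => w (phi i) (phi j)) e).

Hypothesis a_ge0 : forall v, 0 <= a v.
Hypothesis a_sum1 : \sum_v a v = 1.
Hypothesis w01 : forall u v, 0 <= w u v <= 1.

Lemma tfin_ge0 n (E : {set {set 'I_n}}) : 0 <= tfin E.
Proof.
apply: fexp_ge0 => // phi; apply: prodr_ge0 => e _.
by case/andP: (@eweight_ind R n (fun i j => w (phi i) (phi j)) e (fun i j => w01 _ _)).
Qed.

Lemma tfin_le1 n (E : {set {set 'I_n}}) : tfin E <= 1.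
Proof.
rewrite -[leRHS](fexp_cst 'I_n a_sum1); apply: ler_fexp => // phi.
by apply: prodr_ile1 => e _; exact: eweight_ind.
Qed.

(** Conditional probability, given the sampled vertices [phi], that the [w]-random graph on them has
    edge set exactly [E]. *)
Definition gprob n (phi : {ffun 'I_n -> V}) (E : {set {set 'I_n}}) : R :=
  \prod_(e in E) eweight (fun i j => w (phi i) (phi j)) e *
  \prod_(e in pairs n :\: E) (1 - eweight (fun i j => w (phi i) (phi j)) e).

Lemma gprob_ge0 n (phi : {ffun 'I_n -> V}) E : 0 <= gprob phi E.
Proof.
by apply: mulr_ge0; apply: prodr_ge0 => e _;
  case/andP: (@eweight_ind R n (fun i j => w (phi i) (phi j)) e (fun i j => w01 _ _)) => *;
  rewrite ?subr_ge0.
Qed.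

Lemma gprob_sum n (phi : {ffun 'I_n -> V}) :
  \sum_(E : {set {set 'I_n}} | E \subset pairs n) gprob phi E = 1.
Proof.
have := moebius_inversion (fun B : {set {set 'I_n}} =>
  \prod_(e in B) eweight (fun i j => w (phi i) (phi j)) e) (sub0set (pairs n)).
rewrite big_set0 => <-; apply: eq_big => [E|E EA]; first by rewrite sub0set.
by rewrite moebius_prod.
Qed.

Lemma tfin_moebius n (E : {set {set 'I_n}}) : E \subset pairs n ->
  \sum_(B : {set {set 'I_n}} | (E \subset B) && (B \subset pairs n))
     (-1) ^+ #|B :\: E| * tfin B = fexp a (fun phi => gprob phi E).
Proof.
move=> EA.
rewrite (eq_bigr (fun B : {set {set 'I_n}} => fexp a (fun phi : {ffun 'I_n -> V} =>
   (-1) ^+ #|B :\: E| * \prod_(e in B) eweight (fun i j => w (phi i) (phi j)) e))); last first.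
  by move=> B _; rewrite fexpZ.
by rewrite -fexp_sum; apply: eq_fexp => phi; rewrite moebius_prod.
Qed.

Hypothesis wC : forall u v, w u v = w v u.

Lemma eweight_imset n m (f : 'I_n -> 'I_m) (psi : {ffun 'I_m -> V}) (e : {set 'I_n}) :
  injective f -> e \in pairs n ->
  eweight (fun i j => w (psi i) (psi j)) (f @: e) =
  eweight (fun i j => w (psi (f i)) (psi (f j))) e.
Proof.
move=> finj; rewrite inE => /cards2P[i [j [ij ->]]].
have -> : [set f x | x in [set i; j]] = [set f i; f j].
  by rewrite imsetU !imset_set1.
rewrite (eweight_set2 (fun i j => wC _ _)) ?(inj_eq finj)//.
by rewrite (eweight_set2 (fun i j => wC _ _)).
Qed.

Lemma tfin_iso n m (f : 'I_n -> 'I_m) (E : {set {set 'I_n}}) :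
  bijective f -> E \subset pairs n ->
  tfin [set f @: (e : {set 'I_n}) | e in E] = tfin E.
Proof.
move=> fbij EA; have finj := bij_inj fbij; case: (fbij) => g fK gK.
have Finj : injective (fun e : {set 'I_n} => f @: e) by exact: imset_inj.
rewrite /tfin /fexp.
rewrite (reindex (fun phi : {ffun 'I_n -> V} => [ffun j => phi (g j)])) /=; last first.
  exists (fun psi : {ffun 'I_m -> V} => [ffun i => psi (f i)]) => psi _;
    by apply/ffunP => i; rewrite !ffunE ?fK ?gK.
apply: eq_bigr => phi _; congr (_ * _).
  rewrite (reindex f) /=; last by exists g => i _; rewrite ?fK ?gK.
  by apply: eq_bigr => i _; rewrite ffunE fK.
rewrite big_imset /=; last by move=> e e' _ _; exact: Finj.
apply: eq_bigr => e eE; rewrite eweight_imset ?(subsetP EA)//.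
by apply: eq_bigr => p _; rewrite !ffunE !fK.
Qed.

Lemma tfin_dunion n m (E : {set {set 'I_n}}) (F : {set {set 'I_m}}) :
  E \subset pairs n -> F \subset pairs m ->
  tfin ([set (@lshift n m) @: (e : {set 'I_n}) | e in E] :|:
        [set (@rshift n m) @: (e : {set 'I_m}) | e in F]) = tfin E * tfin F.
Proof.
move=> EA FA.
have linj := @lshift_inj n m; have rinj := @rshift_inj n m.
have dis : [disjoint [set (@lshift n m) @: (e : {set 'I_n}) | e in E] &
        [set (@rshift n m) @: (e : {set 'I_m}) | e in F]].
  apply/pred0P => s /=; apply/negP => /andP[/imsetP[e eE ->] /imsetP[e' _]].
  move/(subsetP EA): eE; rewrite inE => /cards2P[i [j [_ ->]]] /setP /(_ (lshift m i)).
  rewrite mem_imset// set21 => /esym/imsetP[k _ /eqP].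
  by rewrite eq_lrshift.
rewrite /tfin /fexp big_distrlr /= pair_bigA /=.
pose h (q : {ffun 'I_n -> V} * {ffun 'I_m -> V}) : {ffun 'I_(n + m) -> V} :=
  [ffun k => match split k with inl i => q.1 i | inr j => q.2 j end].
have hl q i : h q (lshift m i) = q.1 i.
  by rewrite ffunE -[lshift m i]/(unsplit (inl i)) unsplitK.
have hr q i : h q (rshift n i) = q.2 i.
  by rewrite ffunE -[rshift n i]/(unsplit (inr i)) unsplitK.
rewrite (reindex h) /=; last first.
  exists (fun psi => ([ffun i => psi (lshift m i)], [ffun j => psi (rshift n j)])).
    by move=> [p q] _; congr (_, _); apply/ffunP => i; rewrite ffunE ?hl ?hr.
  move=> psi _; apply/ffunP => k; rewrite -(splitK k); case: (split k) => i /=.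
    by rewrite hl ffunE.
  by rewrite hr ffunE.
apply: eq_bigr => q _.
have prodU : \prod_(e in [set (@lshift n m) @: (e : {set 'I_n}) | e in E] :|:
   [set (@rshift n m) @: (e : {set 'I_m}) | e in F]) eweight (fun i j => w (h q i) (h q j)) e =
   \prod_(e in E) eweight (fun i j => w (q.1 i) (q.1 j)) e *
   \prod_(e in F) eweight (fun i j => w (q.2 i) (q.2 j)) e.
  rewrite (eq_bigl [predU [set (@lshift n m) @: (e : {set 'I_n}) | e in E] &
    [set (@rshift n m) @: (e : {set 'I_m}) | e in F]]); last by move=> e; rewrite !inE.
  rewrite bigU //= !big_imset /=.
  - congr (_ * _); apply: eq_bigr => e eE.
      rewrite eweight_imset ?(subsetP EA)//.
      by apply: eq_bigr => p _; rewrite !hl.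
    rewrite eweight_imset ?(subsetP FA)//.
    by apply: eq_bigr => p _; rewrite !hr.
  - by move=> e e' _ _; exact: imset_inj.
  - by move=> e e' _ _; exact: imset_inj.
rewrite prodU big_split_ord /=.
under eq_bigr do rewrite hl.
under [X in _ * X * _ = _]eq_bigr do rewrite hr.
by ring.
Qed.

End Density.

(** * Counting lemma and energy increments *)

Lemma eq_eweight (R : comNzRingType) n (x y : 'I_n -> 'I_n -> R) (e : {set 'I_n}) :
  {in e &, forall i j, x i j = y i j} -> eweight x e = eweight y e.
Proof.
move=> xy; apply: eq_bigr => p /andP[_ /eqP ep].
by apply: xy; rewrite ep ?set21 ?set22.
Qed.

Section Counting.
Variables (R : realFieldType) (V : finType) (a : V -> R) (w w' : V -> V -> R) (D : R).
Hypothesis a_ge0 : forall v, 0 <= a v.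
Hypothesis a_sum1 : \sum_v a v = 1.
Hypothesis w01 : forall u v, 0 <= w u v <= 1.
Hypothesis w'01 : forall u v, 0 <= w' u v <= 1.
Hypothesis cut : forall S T : {set V},
  `|\sum_(x in S) \sum_(y in T) a x * a y * (w x y - w' x y)| <= D.

(** Freeze all coordinates but [i] and [j]. No other edge contains both, so the remaining product
    splits into a function of one vertex times a function of the other, and the cut bound
    applies. *)
Lemma counting_edge n (E : {set {set 'I_n}}) (i j : 'I_n)
    (h : {ffun 'I_n -> V} -> {set 'I_n} -> R) : (i < j)%N -> E \subset pairs n ->
  (forall phi e, 0 <= h phi e <= 1) ->
  (forall (phi psi : {ffun 'I_n -> V}) (e : {set 'I_n}), {in e, phi =1 psi} -> h phi e = h psi e) ->
  `|fexp a (fun phi => (w (phi i) (phi j) - w' (phi i) (phi j)) *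
      \prod_(e in E | e != [set i; j]) h phi e)| <= D.
Proof.
move=> ij EA h01 hloc.
have nij : i != j by rewrite neq_ltn ij.
rewrite (fexp_resample a_sum1 i) (fexp_resample a_sum1 j).
rewrite (le_trans (ler_norm_fexp a_ge0 _))// -[leRHS](fexp_cst 'I_n a_sum1).
apply: ler_fexp => // phi.
have prod01 (P : pred {set 'I_n}) psi : 0 <= \prod_(e in E | P e) h psi e <= 1.
  rewrite prodr_ge0 => [|e _]; last by case/andP: (h01 psi e).
  by apply: prodr_ile1 => e _; exact: h01.
(* Edges avoiding [j] see only the vertex placed at [i]; edges through [j] avoid [i]. *)
pose g x := \prod_(e in E | (e != [set i; j]) && (j \notin e)) h (upd phi i x) e.
pose k y := \prod_(e in E | (e != [set i; j]) && (j \in e)) h (upd phi j y) e.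
rewrite (_ : \sum_x _ = \sum_x \sum_y g x * k y * (a x * a y * (w x y - w' x y))).
  by apply: (cut_bilin cut) => x; rewrite prod01.
rewrite exchange_big /=; apply: eq_bigr => y _; rewrite mulr_sumr.
apply: eq_bigr => x _.
rewrite !updE !eqxx (eq_sym j) (negbTE nij).
set Q := \prod_(e in E | _) _.
suff -> : Q = k y * g x by ring.
rewrite /Q (bigID (fun e : {set 'I_n} => j \in e)) /=; congr (_ * _).
  apply: eq_big => [e|e /andP[/andP[eE eij] je]]; first by rewrite andbA.
  apply: hloc => l le; rewrite !updE; case: eqP => // li; subst l.
  have := subsetP EA _ eE; rewrite inE => /cards2P[u [v [uv eq_e]]].
  move: le je eij nij; rewrite eq_e !inE => /orP[]/eqP -> /orP[]/eqP ->;
    by rewrite ?eqxx// setUC eqxx.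
apply: eq_big => [e|e /andP[/andP[eE eij] je]]; first by rewrite andbA.
apply: hloc => l le; rewrite !updE; case: eqP => // li.
by case: eqP => // lj; rewrite -lj le in je.
Qed.

(** Replace [w] by [w'] one edge at a time; by [counting_edge] each replacement costs at most
    [D]. *)
Lemma counting_lemma n (E : {set {set 'I_n}}) : E \subset pairs n ->
  `|tfin a w E - tfin a w' E| <= #|E|%:R * D.
Proof.
move=> EA.
(* The hybrid in which the edges of [S] have already been switched to [w']. *)
pose h (S : {set {set 'I_n}}) (phi : {ffun 'I_n -> V}) (e : {set 'I_n}) :=
  if e \in S then eweight (fun i j => w' (phi i) (phi j)) e
  else eweight (fun i j => w (phi i) (phi j)) e.
have h01 S phi e : 0 <= h S phi e <= 1.
  by rewrite /h; case: ifP => _; apply: eweight_ind.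
have hloc S (phi psi : {ffun 'I_n -> V}) (e : {set 'I_n}) : {in e, phi =1 psi} -> h S phi e = h S psi e.
  move=> pp; rewrite /h; case: ifP => _; apply: eq_eweight => i j ie je;
  by rewrite !pp.
pose T S := fexp a (fun phi => \prod_(e in E) h S phi e).
have T0 : tfin a w E = T set0.
  by apply: eq_fexp => phi; apply: eq_bigr => e _; rewrite /h inE.
have T1 : tfin a w' E = T E.
  by apply: eq_fexp => phi; apply: eq_bigr => e eE; rewrite /h eE.
have step (S : {set {set 'I_n}}) (e : {set 'I_n}) : e \in E -> e \notin S -> `|T S - T (e |: S)| <= D.
  move=> eE eS; have := subsetP EA _ eE; rewrite inE => /cards2P[u [v [uv eq_e]]].
  have [i [j [ij eq_e']]] : exists i j : 'I_n, (i < j)%N /\ e = [set i; j].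
    move: uv; rewrite neq_ltn => /orP[]; first by exists u, v.
    by exists v, u; rewrite setUC.
  rewrite /T -fexpB.
  rewrite (_ : fexp _ _ = fexp a (fun phi => (w (phi i) (phi j) - w' (phi i) (phi j)) *
      \prod_(e in E | e != [set i; j]) h S phi e)); first by apply: (counting_edge (h := h S)) => //; exact: hloc.
  apply: eq_fexp => phi; rewrite !(bigD1 e eE) /= {1 3}/h (negbTE eS) !inE eqxx /=.
  rewrite eq_e' !eweight_set2_lt// mulrBl; congr (_ - _ * _).
  by apply: eq_bigr => d /andP[_ /negbTE de]; rewrite /h !inE de.
rewrite T0 T1.
have main (s : seq {set 'I_n}) : uniq s -> {subset s <= E} ->
    `|T set0 - T [set e in s]| <= (size s)%:R * D.
  elim: s => [_ _|e s IH /= /andP[es us] sE].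
    by rewrite (_ : [set e in [::]] = set0) ?subrr ?normr0 ?mul0r//; apply/setP => e; rewrite !inE.
  have IH' := IH us (fun x xs => sE x (mem_behead (s := e :: s) xs)).
  have st := step [set e in s] e (sE e (mem_head _ _)).
  rewrite !inE in st; move/(_ es): st => st.
  rewrite (_ : [set d in e :: s] = e |: [set d in s]); last first.
    by apply/setP => d; rewrite !inE.
  rewrite (_ : _ - _ = (T set0 - T [set e in s]) + (T [set e in s] - T (e |: [set e in s]))); last by ring.
  rewrite (le_trans (ler_normD _ _))// -natr1 mulrDl mul1r; exact: lerD.
have := main (enum E) (enum_uniq _); rewrite -cardE set_enum; apply.
by move=> e; rewrite mem_enum.
Qed.

End Counting.

(** * Conditional averages and their energy *)

Section Averaging.
Variables (R : realFieldType) (Z : finType) (b w : Z -> R).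
Hypothesis b_ge0 : forall z, 0 <= b z.

(** Conditional average of [w] on a fibre of [f]; on a fibre of mass 0 it is 0 by the convention for
    division. *)
Definition dens (T : eqType) (f : Z -> T) (t : T) : R :=
  (\sum_(z | f z == t) b z * w z) / (\sum_(z | f z == t) b z).

Lemma mass0 (T : eqType) (f : Z -> T) z : \sum_(z' | f z' == f z) b z' = 0 -> b z = 0.
Proof.
move=> /psumr_eq0P; apply => //; by rewrite eqxx.
Qed.

Lemma dens01 (T : eqType) (f : Z -> T) t : (forall z, 0 <= w z <= 1) -> 0 <= dens f t <= 1.
Proof.
move=> w01; have s0 : 0 <= \sum_(z | f z == t) b z by exact: sumr_ge0.
rewrite /dens divr_ge0//=; last first.
  by apply: sumr_ge0 => z _; rewrite mulr_ge0//; case/andP: (w01 z).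
have [->|sn0] := eqVneq (\sum_(z | f z == t) b z) 0; first by rewrite invr0 mulr0.
rewrite ler_pdivrMr ?lt_neqAle ?s0 1?eq_sym ?sn0// mul1r.
apply: ler_sum => z _; rewrite ler_piMr//; by case/andP: (w01 z).
Qed.

(** In L2 of the weights [b], averaging over the fibres is the orthogonal projection onto functions
    of [f]. On a null fibre every weight is zero, so the junk value of [dens] does no harm. *)
Lemma dens_proj (T : eqType) (f : Z -> T) (h : T -> R) :
  \sum_z b z * (w z * h (f z)) = \sum_z b z * (dens f (f z) * h (f z)).
Proof.
pose m z := \sum_(z' | f z' == f z) b z'.
transitivity (\sum_z \sum_(z' | f z' == f z) b z * (b z' * w z' / m z * h (f z))).
  rewrite (exchange_big_dep xpredT) //=; apply: eq_bigr => z' _.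
  rewrite (eq_bigr (fun z => b z * (b z' * w z' / m z' * h (f z')))); last first.
    by move=> z /eqP e; rewrite /m e.
  rewrite -mulr_suml (eq_bigl (fun z => f z == f z')); last by move=> z; rewrite eq_sym.
  rewrite -/(m z'); have [m0|m0] := eqVneq (m z') 0.
    by rewrite m0 (mass0 m0) !mul0r.
  by field.
apply: eq_bigr => z _; rewrite -mulr_sumr -mulr_suml; congr (_ * (_ * _)).
by rewrite /dens mulr_suml.
Qed.

Definition energy (T : eqType) (f : Z -> T) : R := \sum_z b z * dens f (f z) ^+ 2.

(** As [f] factors through [f'], the two projections are nested, and the cross term equals
    [energy f]. *)
Lemma dens_pythagoras (T T' : eqType) (f : Z -> T) (f' : Z -> T') (g : T' -> T) :
  (forall z, f z = g (f' z)) ->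
  \sum_z b z * (dens f' (f' z) - dens f (f z)) ^+ 2 = energy f' - energy f.
Proof.
move=> fg.
have cross : \sum_z b z * (dens f' (f' z) * dens f (f z)) = energy f.
  transitivity (\sum_z b z * (w z * dens f (f z))).
    rewrite (eq_bigr (fun z => b z * (dens f' (f' z) * (dens f \o g) (f' z)))).
      by rewrite -dens_proj; apply: eq_bigr => z _; rewrite /= -fg.
    by move=> z _; rewrite /= -fg.
  by rewrite dens_proj; apply: eq_bigr => z _; rewrite expr2.
transitivity (energy f' - 2 * energy f + energy f); last by ring.
rewrite -{1}cross /energy mulr_sumr -sumrB -big_split /=.
by apply: eq_bigr => z _; ring.
Qed.

Hypothesis b_sum1 : \sum_z b z = 1.

(* Refining by the sets where the discrepancy is attained gains its square in energy *)
Lemma energy_increment (T T' : eqType) (f : Z -> T) (f' : Z -> T') (g : T' -> T) (k : T' -> R) :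
  (forall z, f z = g (f' z)) -> (forall t, 0 <= k t <= 1) ->
  (\sum_z b z * ((w z - dens f (f z)) * k (f' z))) ^+ 2 <= energy f' - energy f.
Proof.
move=> fg k01; rewrite -(dens_pythagoras fg).
have -> : \sum_z b z * ((w z - dens f (f z)) * k (f' z)) =
    \sum_z b z * (k (f' z) * (dens f' (f' z) - dens f (f z))).
  transitivity (\sum_z b z * (w z * k (f' z)) - \sum_z b z * (dens f (f z) * k (f' z))).
    by rewrite -sumrB; apply: eq_bigr => z _; ring.
  by rewrite dens_proj -sumrB; apply: eq_bigr => z _; ring.
by apply: (sqr_wsum_mask_le b_ge0 b_sum1 _ (fun z => k01 (f' z))).
Qed.

Lemma energy_le1 (T : eqType) (f : Z -> T) : (forall z, 0 <= w z <= 1) -> energy f <= 1.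
Proof.
move=> w01; rewrite -b_sum1; apply: ler_sum => z _; rewrite ler_piMr//.
by have /andP[? ?] := dens01 f (f z) w01; rewrite expr_le1.
Qed.

Lemma energy_ge0 (T : eqType) (f : Z -> T) : 0 <= energy f.
Proof. by apply: sumr_ge0 => z _; rewrite mulr_ge0 ?sqr_ge0. Qed.

End Averaging.

(** * Greedy partitions refined by worst cuts *)

Section Greedy.
Variables (R : realFieldType) (V : finType) (a : V -> R) (w : V -> V -> R).
Hypothesis a_ge0 : forall v, 0 <= a v.
Hypothesis a_sum1 : \sum_v a v = 1.

Definition sqw (q : V * V) : R := a q.1 * a q.2.
Definition unc (q : V * V) : R := w q.1 q.2.
Definition sqf (T : Type) (f : V -> T) (q : V * V) : T * T := (f q.1, f q.2).

Lemma sqw_ge0 q : 0 <= sqw q. Proof. exact: mulr_ge0. Qed.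

Lemma sqw_sum1 : \sum_q sqw q = 1.
Proof.
rewrite -(pair_bigA _ (fun u v => a u * a v)) /=.
by rewrite -[RHS]a_sum1; apply: eq_bigr => u _; rewrite -mulr_sumr a_sum1 mulr1.
Qed.

Definition bavg (T : eqType) (f : V -> T) (x y : T) : R := dens sqw unc (sqf f) (x, y).

Definition disc (f : V -> seq bool) (st : {set V} * {set V}) : R :=
  `|\sum_(x in st.1) \sum_(y in st.2) a x * a y * (w x y - bavg f (f x) (f y))|.

(** An exact maximiser over the finitely many pairs of sets, so that one refinement step dominates
    the discrepancies of all cuts at once. *)
Definition best (f : V -> seq bool) : {set V} * {set V} :=
  [arg max_(st > (set0, set0)) disc f st]%O.

Lemma disc_best f st : disc f st <= disc f (best f).
Proof. by rewrite /best; case: Order.TotalTheory.arg_maxP => // i _; exact. Qed.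

Definition greedy (f : V -> seq bool) (v : V) : seq bool :=
  (v \in (best f).1) :: (v \in (best f).2) :: f v.

Definition gpart (i : nat) : V -> seq bool := iter i greedy (fun=> [::]).

(** The [k] oldest of the [2k] bits of [gpart k]. Codes thus exist at every length and each is a
    truncation of the next; the even lengths are the completed greedy steps, see [gcode_double]. *)
Definition gcode (k : nat) (v : V) : seq bool := drop k (gpart k v).

Definition genergy (k : nat) : R := energy sqw unc (sqf (gcode k)).

Lemma size_gpart i v : size (gpart i v) = i.*2.
Proof. by elim: i => //= i ->. Qed.

Lemma size_gcode k v : size (gcode k v) = k.
Proof. by rewrite size_drop size_gpart -addnn addnK. Qed.

Lemma behead_gcode k v : behead (gcode k.+1 v) = gcode k v.
Proof. by rewrite -drop1 /gcode drop_drop add1n /=. Qed.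

Lemma gcode_double i : gcode i.*2 =1 gpart i.
Proof.
suff h j v : drop j.*2 (gpart (j + i) v) = gpart i v by move=> v; rewrite /gcode -{2}addnn h.
elim: j => [|j IH]; first by rewrite drop0.
by rewrite addSn doubleS /= IH.
Qed.

(** The discrepancy of any cut is at most that of the worst one, whose two indicators are bits of
    the next code; [energy_increment] then bounds its square by the energy gained. *)
Lemma gcode_regular i (S T : {set V}) :
  (\sum_(x in S) \sum_(y in T) a x * a y *
     (w x y - bavg (gcode i.*2) (gcode i.*2 x) (gcode i.*2 y))) ^+ 2 <=
  genergy i.+1.*2 - genergy i.*2.
Proof.
have dE (f f' : V -> seq bool) : f =1 f' -> bavg f =2 bavg f'.
  by move=> ff x y; rewrite /bavg /dens; congr (_ / _); apply: eq_bigl => q; rewrite /sqf !ff.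
have eE (f f' : V -> seq bool) : f =1 f' -> energy sqw unc (sqf f) = energy sqw unc (sqf f').
  move=> ff; apply: eq_bigr => q _; congr (_ * _ ^+ 2).
  by rewrite -[LHS]/(bavg f (f q.1) (f q.2)) (dE _ _ ff) !ff.
rewrite /genergy (eE _ _ (@gcode_double i)) (eE _ _ (@gcode_double i.+1)).
rewrite (eq_bigr (fun x => \sum_(y in T) a x * a y * (w x y - bavg (gpart i) (gpart i x) (gpart i y)))); last first.
  by move=> x _; apply: eq_bigr => y _; rewrite (dE _ _ (@gcode_double i)) !gcode_double.
rewrite -real_normK ?num_real//.
apply: (@le_trans _ _ (disc (gpart i) (best (gpart i)) ^+ 2)).
  by rewrite lerXn2r ?nnegrE ?normr_ge0//; exact: (disc_best (gpart i) (S, T)).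
set B := best (gpart i).
pose g (t : seq bool * seq bool) := (drop 2 t.1, drop 2 t.2).
(* The newest bit of the first vertex records membership in the first set of [B], the second newest
   bit of the second vertex membership in the second set. *)
pose k (t : seq bool * seq bool) : R := (nth false t.1 0)%:R * (nth false t.2 1)%:R.
have fg q : sqf (gpart i) q = g (sqf (gpart i.+1) q) by rewrite /sqf /g /= !drop0.
have k01 t : 0 <= k t <= 1 by rewrite /k; do 2 case: nth; rewrite /= ?mulr0 ?mulr1 ?lexx ?ler01.
have := energy_increment unc sqw_ge0 sqw_sum1 fg k01.
rewrite real_normK ?num_real//; congr (_ ^+ 2 <= _).
rewrite -(pair_bigA _ (fun x y => sqw (x, y) * ((unc (x, y) - dens sqw unc (sqf (gpart i)) (sqf (gpart i) (x, y))) * k (sqf (gpart i.+1) (x, y))))) /=.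
rewrite [RHS]big_mkcond /=; apply: eq_bigr => x _.
rewrite [in RHS]big_mkcond /=; case: ifPn => xS.
  apply: eq_bigr => y _; case: ifPn => yT.
    by rewrite /k /= xS yT /sqw /unc /bavg /sqf /= !mulr1.
  by rewrite /k /= (negbTE yT) !mulr0.
by apply: big1 => y _; rewrite /k /= (negbTE xS) mul0r !mulr0.
Qed.

End Greedy.

(** * Sampling from a finite kernel *)

Lemma sqr_norm_le (R : realFieldType) (x e : R) : 0 <= e -> x ^+ 2 <= e ^+ 2 -> `|x| <= e.
Proof.
by move=> e0; rewrite -[x ^+ 2]real_normK ?num_real// ler_pXn2r ?nnegrE.
Qed.

(** Edges are independent, so given all the others the centred indicator of [e] has mean zero, and
    [Y] does not depend on [e]. The proof pairs each set with its toggle at [e]. *)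
Lemma toggle_sum0 (R : comNzRingType) (T : finType) (A : {set T}) (x : T -> R)
    (Y : {set T} -> R) (e : T) : e \in A -> (forall E, Y (e |: E) = Y (E :\ e)) ->
  \sum_(E : {set T} | E \subset A) (\prod_(d in E) x d * \prod_(d in A :\: E) (1 - x d)) *
     (((e \in E)%:R - x e) * Y E) = 0.
Proof.
move=> eA Ytog.
rewrite (bigID (fun E : {set T} => e \in E)) /=.
rewrite (reindex_onto (fun E : {set T} => e |: E) (fun E : {set T} => E :\ e)) /=; last first.
  by move=> E /andP[_ eE]; rewrite setD1K.
rewrite (eq_bigl (fun E : {set T} => (E \subset A) && (e \notin E))); last first.
  move=> E; rewrite setU11 andbT subUset sub1set eA /=.
  case: (E \subset A) => //=; apply/eqP/idP => [<-|eE]; first by rewrite !inE eqxx.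
  by rewrite setU1K.
rewrite -big_split big1 //= => E /andP[EA eE].
rewrite big_setU1 //= setU11 (negbTE eE) Ytog.
have -> : E :\ e = E by apply/setDidPl; rewrite disjoint_sym disjoints1.
have -> : \prod_(d in A :\: E) (1 - x d) = (1 - x e) * \prod_(d in A :\: (e |: E)) (1 - x d).
  rewrite (bigD1 e) /=; last by rewrite !inE eE.
  congr (_ * _); apply: eq_bigl => d.
  by rewrite !inE negb_or; case: (d == e); case: (d \in A); case: (d \in E).
rewrite mulr1n mulr0n; ring.
Qed.

(** Cauchy-Schwarz twice, first over rows and then over pairs of columns, removes [S] and [T] and
    leaves the signed density of four-cycles. *)
Lemma cut_le_C4 (R : realFieldType) n (De : 'I_n -> 'I_n -> R) (S T : {set 'I_n}) : (0 < n)%N ->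
  (\sum_(i in S) \sum_(j in T) n%:R^-1 ^+ 2 * De i j) ^+ 4 <=
  \sum_j \sum_l \sum_i \sum_k n%:R^-1 ^+ 4 * (De i j * De i l * De k j * De k l).
Proof.
move=> n0; set c : R := n%:R^-1.
have c0 : 0 <= c by rewrite invr_ge0.
have cn : \sum_(i < n) c = 1.
  by rewrite sumr_const card_ord -[LHS]mulr_natr mulVf// pnatr_eq0 -lt0n.
pose ind (B : {set 'I_n}) i : R := (i \in B)%:R.
have ind01 B i : 0 <= ind B i <= 1 by rewrite /ind; case: (i \in B); rewrite ?lexx ler01.
pose z i := \sum_j c * (ind T j * De i j).
pose M (q : 'I_n * 'I_n) := \sum_i c * (De i q.1 * De i q.2).
have -> : \sum_(i in S) \sum_(j in T) c ^+ 2 * De i j = \sum_i c * (ind S i * z i).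
  rewrite big_mkcond /=; apply: eq_bigr => i _; rewrite /ind /z.
  case: (i \in S); last by rewrite mul0r mulr0.
  rewrite mul1r mulr_sumr big_mkcond; apply: eq_bigr => j _ /=.
  by rewrite /ind; case: (j \in T); rewrite ?mulr1n ?mulr0n; ring.
rewrite (exprM _ 2 2).
apply: (@le_trans _ _ ((\sum_i c * z i ^+ 2) ^+ 2)).
  rewrite lerXn2r ?nnegrE ?sqr_ge0//; last by apply: sqr_wsum_mask_le => // i; exact: ind01.
  by apply: sumr_ge0 => i _; rewrite mulr_ge0 ?sqr_ge0.
have -> : \sum_i c * z i ^+ 2 = \sum_q (c ^+ 2) * (ind T q.1 * ind T q.2 * M q).
  transitivity (\sum_i \sum_(q : 'I_n * 'I_n) c * (c ^+ 2 * (ind T q.1 * ind T q.2 * (De i q.1 * De i q.2)))).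
    apply: eq_bigr => i _; rewrite -mulr_sumr; congr (_ * _).
    rewrite expr2 /z big_distrlr /= pair_bigA /=; apply: eq_bigr => q _; ring.
  rewrite exchange_big /=; apply: eq_bigr => q _; rewrite /M !mulr_sumr.
  by apply: eq_bigr => i _; ring.
apply: (@le_trans _ _ (\sum_q c ^+ 2 * M q ^+ 2)).
  apply: (@sqr_wsum_mask_le _ _ (fun=> c ^+ 2)) => [q||q]; first exact: sqr_ge0.
    rewrite -(pair_bigA _ (fun _ _ => c ^+ 2)) /=.
    by rewrite -[RHS]cn; apply: eq_bigr => i _; rewrite expr2 -mulr_sumr cn mulr1.
  have /andP[? ?] := ind01 T q.1; have /andP[? ?] := ind01 T q.2.
  by rewrite mulr_ge0//= mulr_ile1.
rewrite -(pair_bigA _ (fun j l => c ^+ 2 * M (j, l) ^+ 2)) /=.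
apply: ler_sum => j _; apply: ler_sum => l _.
rewrite [M _ ^+ 2]expr2 /M /= big_distrlr /= mulr_sumr; apply: ler_sum => i _.
rewrite mulr_sumr; apply: ler_sum => k _.
by rewrite le_eqVlt; apply/orP; left; apply/eqP; ring.
Qed.

Section Sampling.
Variables (R : realFieldType) (V D : finType) (a : V -> R) (w : V -> V -> R).
Variables (pi : V -> D) (wb : D -> D -> R) (n : nat).
Hypothesis a_ge0 : forall v, 0 <= a v.
Hypothesis a_sum1 : \sum_v a v = 1.
Hypothesis w01 : forall u v, 0 <= w u v <= 1.
Hypothesis wC : forall u v, w u v = w v u.
Hypothesis n_gt0 : (0 < n)%N.

Let c : R := n%:R^-1.

Let c_ge0 : 0 <= c. Proof. by rewrite invr_ge0. Qed.

Let cn : c * n%:R = 1. Proof. by rewrite mulVf// pnatr_eq0 -lt0n. Qed.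

Definition push (d : D) : R := \sum_(v | pi v == d) a v.

Definition freq (s : 'I_n -> D) (d : D) : R := \sum_i c * (s i == d)%:R.

Let dfreq (phi : {ffun 'I_n -> V}) : R := \sum_d (freq (pi \o phi) d - push d) ^+ 2.

Let dl1 (phi : {ffun 'I_n -> V}) : R :=
  \sum_i \sum_j c ^+ 2 * ((i != j)%:R * `|w (phi i) (phi j) - wb (pi (phi i)) (pi (phi j))|).

(** The edge noise: adjacency minus its conditional mean. The diagonal is removed, since a graph has
    no loops. *)
Let De (phi : {ffun 'I_n -> V}) (E : {set {set 'I_n}}) (i j : 'I_n) : R :=
  (i != j)%:R * (([set i; j] \in E)%:R - w (phi i) (phi j)).

Let dC4 (phi : {ffun 'I_n -> V}) (E : {set {set 'I_n}}) : R :=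
  \sum_j \sum_l \sum_i \sum_k c ^+ 4 * (De phi E i j * De phi E i l * De phi E k j * De phi E k l).

Let pushE d : \sum_x a x * (pi x == d)%:R = push d.
Proof.
rewrite /push [RHS]big_mkcond; apply: eq_bigr => x _ /=.
by case: (pi x == d); rewrite ?mulr1 ?mulr0.
Qed.

Lemma push_ge0 d : 0 <= push d. Proof. exact: sumr_ge0. Qed.

Lemma push_sum1 : \sum_d push d = 1.
Proof. by rewrite -a_sum1 /push; rewrite [RHS](partition_big pi xpredT). Qed.

(** Each frequency is the mean of [n] independent indicators of probability [p], of variance
    [c * p - c * p ^+ 2], which is at most [c]. *)
Let dfreq_mean : fexp a dfreq <= #|D|%:R * c.
Proof.
rewrite /dfreq fexp_sum mulr_natl -sumr_const; apply: ler_sum => d _.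
set p := push d.
have p0 : 0 <= p by exact: push_ge0.
have -> : fexp a (fun phi : {ffun 'I_n -> V} => (freq (pi \o phi) d - p) ^+ 2) = c * p - c * p ^+ 2.
  transitivity (fexp a (fun phi : {ffun 'I_n -> V} =>
     \sum_i \sum_j c ^+ 2 * ((pi (phi i) == d)%:R * (pi (phi j) == d)%:R)
     - 2 * p * (\sum_i c * (pi (phi i) == d)%:R) + p ^+ 2)).
    apply: eq_fexp => phi; rewrite /freq sqrrB; congr (_ - _ + _); last by rewrite mulr_natl; ring.
    rewrite expr2 big_distrlr /=; apply: eq_bigr => i _; apply: eq_bigr => j _; ring.
  rewrite fexpD fexpB fexpZ !fexp_sum fexp_cst//.
  have -> : \sum_(i < n) fexp a (fun phi : {ffun 'I_n -> V} => c * (pi (phi i) == d)%:R) = p.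
    rewrite (eq_bigr (fun=> c * p)) => [|i _]; last first.
      by rewrite fexpZ (fexp1 a_sum1 i (fun x => (pi x == d)%:R)) pushE.
    by rewrite sumr_const card_ord -mulr_natr mulrAC cn mul1r.
  have -> : \sum_(i < n) fexp a (fun phi : {ffun 'I_n -> V} => \sum_(j < n) c ^+ 2 *
      ((pi (phi i) == d)%:R * (pi (phi j) == d)%:R)) = n%:R * (c ^+ 2 * p + (n%:R - 1) * (c ^+ 2 * p ^+ 2)).
    rewrite (eq_bigr (fun=> c ^+ 2 * p + (n%:R - 1) * (c ^+ 2 * p ^+ 2))); last first.
      move=> i _; rewrite fexp_sum (bigD1 i) //=; congr (_ + _).
        rewrite fexpZ; congr (_ * _); rewrite -[RHS]pushE -(fexp1 a_sum1 i).
        by apply: eq_fexp => phi; case: eqP; rewrite ?mulr1 ?mulr0.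
      rewrite (eq_bigr (fun=> c ^+ 2 * p ^+ 2)).
        rewrite sumr_const -[LHS]mulr_natl; congr (_ * _).
        have -> : #|[pred j | j != i]| = n.-1.
          by have := cardC1 i; rewrite card_ord => <-; apply: eq_card => j; rewrite !inE.
        by rewrite -subn1 natrB.
      move=> j ji; rewrite fexpZ; congr (_ * _).
      rewrite (fexp2 a_sum1 (fun x y => (pi x == d)%:R * (pi y == d)%:R)) 1?eq_sym//.
      rewrite expr2 /p -!pushE big_distrlr /=; apply: eq_bigr => x _; apply: eq_bigr => y _; ring.
    by rewrite sumr_const card_ord mulr_natl.
  have cn' := cn.
  have -> : n%:R * (c ^+ 2 * p + (n%:R - 1) * (c ^+ 2 * p ^+ 2)) =
     c * (c * n%:R) * p + (c * n%:R) * (c * n%:R) * p ^+ 2 - c * (c * n%:R) * p ^+ 2 by ring.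
  by rewrite cn; ring.
have p1 : p <= 1.
  by rewrite -push_sum1 (bigD1 d) //= -[leLHS]addr0 lerD2l; apply: sumr_ge0 => d' _; exact: push_ge0.
by have := c_ge0; nra.
Qed.


Let dl1_mean : fexp a dl1 <= \sum_x \sum_y a x * a y * `|w x y - wb (pi x) (pi y)|.
Proof.
set L := \sum_x \sum_y _.
have L0 : 0 <= L by apply: sumr_ge0 => x _; apply: sumr_ge0 => y _; rewrite !mulr_ge0.
rewrite /dl1 fexp_sum; apply: (@le_trans _ _ (\sum_(i < n) \sum_(j < n) c ^+ 2 * L)).
  apply: ler_sum => i _; rewrite fexp_sum; apply: ler_sum => j _.
  rewrite fexpZ ler_wpM2l ?sqr_ge0//; have [->|ij] := eqVneq i j.
    rewrite (_ : fexp _ _ = 0) // -[RHS](fexp_cst 'I_n a_sum1); apply: eq_fexp => phi.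
    by rewrite mul0r.
  rewrite le_eqVlt; apply/orP; left; apply/eqP.
  rewrite -[RHS](fexp2 a_sum1 (fun x y => `|w x y - wb (pi x) (pi y)|) ij).
  by apply: eq_fexp => phi; rewrite mul1r.
rewrite !sumr_const !card_ord -mulrnA -[leLHS]mulr_natr natrM.
have -> : c ^+ 2 * L * (n%:R * n%:R) = (c * n%:R) * (c * n%:R) * L by ring.
by rewrite cn !mul1r.
Qed.

Let De1 phi E i j : `|De phi E i j| <= 1.
Proof.
rewrite /De; have /andP[w0 w1] := w01 (phi i) (phi j).
case: (i != j); last by rewrite mul0r normr0 ler01.
by rewrite mul1r; case: (_ \in E); rewrite ler_norml ?mulr1n ?mulr0n; apply/andP; split; lra.
Qed.

(** When [i != k] and [j != l], either the noise vanishes on a loop or the edge [{i, j}] differs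
    from the other three edges of the cycle, and its centred indicator averages to zero. *)
Let C4_zero phi i j k l : i != k -> j != l ->
  \sum_(E : {set {set 'I_n}} | E \subset pairs n) gprob w phi E *
    (De phi E i j * De phi E i l * De phi E k j * De phi E k l) = 0.
Proof.
move=> ik jl.
have [ij|ij] := eqVneq i j.
  by apply: big1 => E _; rewrite {1}/De ij eqxx !mul0r mulr0.
have [il|il] := eqVneq i l.
  by apply: big1 => E _; rewrite {2}/De il eqxx !mul0r mulr0 !mul0r mulr0.
have [kj|kj] := eqVneq k j.
  by apply: big1 => E _; rewrite {3}/De kj eqxx !mul0r mulr0 !mul0r mulr0.
have eA : [set i; j] \in pairs n by rewrite inE cards2 ij.
rewrite -[RHS](toggle_sum0 (eweight (fun i j => w (phi i) (phi j)))
  (Y := fun E => De phi E i l * De phi E k j * De phi E k l) eA); last first.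
  move=> E; rewrite /De !(in_setU1, in_setD1).
  have n1 : [set i; l] != [set i; j].
    apply/eqP => /setP /(_ l); rewrite !inE eqxx orbT => /esym/orP[]/eqP e.
      by rewrite e eqxx in il.
    by rewrite e eqxx in jl.
  have n2 : [set k; j] != [set i; j].
    apply/eqP => /setP /(_ k); rewrite !inE eqxx => /esym/orP[]/eqP e.
      by rewrite e eqxx in ik.
    by rewrite e eqxx in kj.
  have n3 : [set k; l] != [set i; j].
    apply/eqP => /setP /(_ k); rewrite !inE eqxx => /esym/orP[]/eqP e.
      by rewrite e eqxx in ik.
    by rewrite e eqxx in kj.
  by rewrite n1 n2 n3 (negbTE n1) (negbTE n2) (negbTE n3).
apply: eq_bigr => E _; rewrite /gprob (eweight_set2 (fun i j => wC _ _) ij).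
by rewrite {1}/De ij mul1r; ring.
Qed.

(** Only quadruples with [i = k] or [j = l] contribute, at most [2 * n ^ 3] out of [n ^ 4], each at
    most 1 in absolute value. *)
Let dC4_mean phi : \sum_(E : {set {set 'I_n}} | E \subset pairs n) gprob w phi E * dC4 phi E
  <= 2 * c.
Proof.
pose I4 (i j k l : 'I_n) : R := (i == k)%:R + (j == l)%:R.
apply: (@le_trans _ _ (\sum_j \sum_l \sum_i \sum_k c ^+ 4 * I4 i j k l)).
  rewrite (eq_bigr (fun E => \sum_j \sum_l \sum_i \sum_k c ^+ 4 *
    (gprob w phi E * (De phi E i j * De phi E i l * De phi E k j * De phi E k l)))); last first.
    move=> E _; rewrite /dC4; do 4 (rewrite mulr_sumr; apply: eq_bigr => ? _); by ring.
  rewrite exchange_big; apply: ler_sum => j _ /=.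
  rewrite exchange_big; apply: ler_sum => l _ /=.
  rewrite exchange_big; apply: ler_sum => i _ /=.
  rewrite exchange_big; apply: ler_sum => k _ /=.
  rewrite -mulr_sumr ler_wpM2l ?exprn_ge0//.
  have [ijkl|] := boolP ((i == k) || (j == l)); last first.
    by rewrite negb_or => /andP[ik jl]; rewrite C4_zero// /I4 (negbTE ik) (negbTE jl) addr0.
  apply: (@le_trans _ _ 1); last first.
    by rewrite /I4; case/orP: ijkl => ->; rewrite mulr1n ?lerDl ?lerDr.
  rewrite -(gprob_sum w phi); apply: ler_sum => E _; rewrite ler_piMr ?gprob_ge0//.
  move: (De phi E i j) (De phi E i l) (De phi E k j) (De phi E k l)
    (De1 phi E i j) (De1 phi E i l) (De1 phi E k j) (De1 phi E k l) => x1 x2 x3 x4 h1 h2 h3 h4.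
  rewrite (le_trans (ler_norm _))// !normrM.
  by do 3 (apply: mulr_ile1; rewrite ?mulr_ge0 ?normr_ge0//).
have s1 (i : 'I_n) : \sum_(k < n) (i == k)%:R = 1 :> R.
  rewrite (bigD1 i) //= eqxx big1 ?addr0// => k /negbTE; by rewrite eq_sym => ->.
rewrite (eq_bigr (fun j => \sum_l (c ^+ 4 * n%:R + c ^+ 4 * n%:R ^+ 2 * (j == l)%:R))); last first.
  move=> j _; apply: eq_bigr => l _.
  rewrite (eq_bigr (fun i => c ^+ 4 + c ^+ 4 * n%:R * (j == l)%:R)); last first.
    move=> i _; rewrite -mulr_sumr /I4 big_split /= s1 sumr_const card_ord -[X in 1 + X]mulr_natl; ring.
  rewrite sumr_const card_ord -[LHS]mulr_natl; ring.
rewrite (eq_bigr (fun j => c ^+ 4 * n%:R ^+ 2 + c ^+ 4 * n%:R ^+ 2)); last first.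
  move=> j _; rewrite big_split /= -[X in _ + X]mulr_sumr s1 sumr_const card_ord -[X in X + _]mulr_natl; ring.
rewrite sumr_const card_ord -[leLHS]mulr_natl.
set lhs := (X in X <= _).
have -> : lhs = 2 * c * (c * n%:R) * (c * n%:R) * (c * n%:R) by rewrite /lhs; ring.
by rewrite cn !mulr1.
Qed.

Let dC4_ge0 phi E : 0 <= dC4 phi E.
Proof.
apply: le_trans (cut_le_C4 (De phi E) set0 set0 n_gt0).
by rewrite big_set0 expr0n.
Qed.

Let dfreq_ge0 phi : 0 <= dfreq phi.
Proof. by apply: sumr_ge0 => d _; exact: sqr_ge0. Qed.

Let dl1_ge0 phi : 0 <= dl1 phi.
Proof.
by apply: sumr_ge0 => i _; apply: sumr_ge0 => j _; rewrite !mulr_ge0 ?sqr_ge0.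
Qed.

(* Markov's inequality for the block frequencies, for the L1 error of the block
   kernel and for the C4-density of the edge noise, which controls its cut norm. *)
Lemma sampling (eta ka : R) : 0 < eta -> 0 < ka ->
  exists good : pred {set {set 'I_n}},
    (forall E, good E -> exists s : {ffun 'I_n -> D},
      (forall d, `|freq s d - push d| <= eta) /\
      (forall S T : {set 'I_n}, `|\sum_(i in S) \sum_(j in T) n%:R^-1 ^+ 2 *
         ((i != j)%:R * (([set i; j] \in E)%:R - wb (s i) (s j)))| <= ka + eta)) /\
    \sum_(E : {set {set 'I_n}} | (E \subset pairs n) && ~~ good E)
       fexp a (fun phi => gprob w phi E) <=
    #|D|%:R * n%:R^-1 / eta ^+ 2 +
    (\sum_x \sum_y a x * a y * `|w x y - wb (pi x) (pi y)|) / ka + 2 * n%:R^-1 / eta ^+ 4.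
Proof.
move=> eta0 ka0.
pose good E := [exists phi : {ffun 'I_n -> V},
  [&& dfreq phi <= eta ^+ 2, dl1 phi <= ka & dC4 phi E <= eta ^+ 4]].
exists good; split.
  move=> E /existsP[phi /and3P[g1 g2 g3]]; exists [ffun i => pi (phi i)]; split.
    move=> d; apply: sqr_norm_le; first exact: ltW.
    apply: le_trans g1; rewrite /dfreq (bigD1 d) //=.
    rewrite (_ : freq [ffun _ => _] d = freq (pi \o phi) d); last first.
      by apply: eq_bigr => i _; rewrite ffunE.
    by rewrite lerDl; apply: sumr_ge0 => ? _; exact: sqr_ge0.
  move=> S T.
  have cut : `|\sum_(i in S) \sum_(j in T) n%:R^-1 ^+ 2 * De phi E i j| <= eta.
    have := le_trans (cut_le_C4 _ S T n_gt0) g3; rewrite !(exprM _ 2 2) => h.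
    apply: sqr_norm_le; first exact: ltW.
    by rewrite -[leLHS]ger0_norm ?sqr_ge0// sqr_norm_le ?sqr_ge0.
  rewrite addrC; apply: le_trans (lerD cut g2).
  pose r i j := n%:R^-1 ^+ 2 * ((i != j)%:R * (w (phi i) (phi j) - wb (pi (phi i)) (pi (phi j)))).
  rewrite (eq_bigr (fun i => \sum_(j in T) n%:R^-1 ^+ 2 * De phi E i j + \sum_(j in T) r i j)); last first.
    by move=> i _; rewrite -big_split; apply: eq_bigr => j _ /=; rewrite /r /De !ffunE; ring.
  rewrite big_split /= (le_trans (ler_normD _ _))// lerD2l.
  rewrite (le_trans (ler_norm_sum _ _ _))// big_mkcond; apply: ler_sum => i _ /=.
  case: ifP => _; last first.
    by apply: sumr_ge0 => j _; rewrite !mulr_ge0 ?sqr_ge0.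
  rewrite (le_trans (ler_norm_sum _ _ _))// big_mkcond; apply: ler_sum => j _ /=.
  case: ifP => _; last by rewrite !mulr_ge0 ?sqr_ge0.
  rewrite /r !normrM ger0_norm ?invr_ge0// normr_nat.
  by case: (i != j).
(* For a graph that is not good, every [phi] violates one of the three bounds, so [bad] is at least
   1 there; its mean bounds the probability. *)
pose bad (phi : {ffun 'I_n -> V}) E := dfreq phi / eta ^+ 2 + dl1 phi / ka + dC4 phi E / eta ^+ 4.
have dv (x y : R) : 0 < y -> y < x -> 1 <= x / y.
  by move=> y0 yx; rewrite ler_pdivlMr// mul1r ltW.
have n1 phi : 0 <= dfreq phi / eta ^+ 2 by rewrite divr_ge0 ?exprn_ge0// ltW.
have n2 phi : 0 <= dl1 phi / ka by rewrite divr_ge0// ltW.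
have n3 phi E : 0 <= dC4 phi E / eta ^+ 4 by rewrite divr_ge0 ?exprn_ge0// ltW.
have bad_ge0 phi E : 0 <= bad phi E.
  by rewrite /bad !addr_ge0.
apply: (@le_trans _ _ (\sum_(E : {set {set 'I_n}} | E \subset pairs n)
   fexp a (fun phi => gprob w phi E * bad phi E))).
  rewrite big_mkcondr /=; apply: ler_sum => E _; case: ifPn => gE; last first.
    by apply: fexp_ge0 => // phi; rewrite mulr_ge0 ?gprob_ge0.
  apply: ler_fexp => // phi; rewrite ler_peMr ?gprob_ge0//.
  move/existsPn: gE => /(_ phi); rewrite !negb_and -!ltNge /bad => /or3P[] h.
  - by have := dv _ _ (exprn_gt0 2 eta0) h; have := n2 phi; have := n3 phi E; lra.
  - by have := dv _ _ ka0 h; have := n1 phi; have := n3 phi E; lra.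
  - by have := dv _ _ (exprn_gt0 4 eta0) h; have := n2 phi; have := n1 phi; lra.
rewrite -fexp_sum.
apply: (@le_trans _ _ (fexp a (fun phi => dfreq phi / eta ^+ 2 + dl1 phi / ka + 2 * c / eta ^+ 4))).
  apply: ler_fexp => // phi.
  rewrite (eq_bigr (fun E => (dfreq phi / eta ^+ 2 + dl1 phi / ka) * gprob w phi E +
     eta ^- 4 * (gprob w phi E * dC4 phi E))); last by move=> E _; rewrite /bad; ring.
  rewrite big_split /= -!mulr_sumr gprob_sum mulr1 lerD2l mulrC.
  by rewrite ler_wpM2r ?dC4_mean// invr_ge0 exprn_ge0// ltW.
apply: (@le_trans _ _ (eta ^- 2 * fexp a dfreq + ka^-1 * fexp a dl1 + 2 * c / eta ^+ 4)).
  rewrite -!fexpZ -[X in _ <= _ + X](fexp_cst 'I_n a_sum1) -!fexpD.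
  by rewrite le_eqVlt; apply/orP; left; apply/eqP; apply: eq_fexp => phi; ring.
rewrite lerD2r ![_ * fexp _ _]mulrC.
by apply: lerD; rewrite ler_wpM2r// invr_ge0 ?exprn_ge0// ltW.
Qed.

End Sampling.

(** * Multiplicative fully positive graph parameters *)

Section Pushforward.
Variables (R : realFieldType) (V D : finType) (a : V -> R) (pi : V -> D).

Lemma sum_push (g : D -> R) : \sum_v a v * g (pi v) = \sum_d push a pi d * g d.
Proof.
rewrite (partition_big pi xpredT) //=; apply: eq_bigr => d _.
by rewrite /push mulr_suml; apply: eq_bigr => v /eqP ->.
Qed.

Lemma fexp_push (I : finType) (K : {ffun I -> D} -> R) :
  fexp a (fun phi : {ffun I -> V} => K [ffun i => pi (phi i)]) = fexp (push a pi) K.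
Proof.
rewrite /fexp (partition_big (fun phi : {ffun I -> V} => [ffun i => pi (phi i)]) xpredT) //=.
apply: eq_bigr => psi _; rewrite /push.
rewrite (bigA_distr_big_dep (fun i v => pi v == psi i) (fun i v => a v)) mulr_suml.
apply: eq_big => [phi|phi /eqP -> //].
apply/eqP/familyP => [<- i|h]; first by rewrite ffunE -topredE /=.
by apply/ffunP => i; rewrite ffunE; apply/eqP; have := h i; rewrite -topredE.
Qed.

Lemma tfin_push (wb : D -> D -> R) n (E : {set {set 'I_n}}) :
  tfin a (fun u v => wb (pi u) (pi v)) E = tfin (push a pi) wb E.
Proof.
rewrite /tfin -fexp_push; apply: eq_fexp => phi; apply: eq_bigr => e _.
by apply: eq_bigr => p _; rewrite !ffunE.
Qed.

End Pushforward.

Definition dunion (n m : nat) (E : {set {set 'I_n}}) (F : {set {set 'I_m}}) : {set {set 'I_(n + m)}} :=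
  [set (@lshift n m) @: (e : {set 'I_n}) | e in E] :|: [set (@rshift n m) @: (e : {set 'I_m}) | e in F].

Lemma imset_pairs n m (f : 'I_n -> 'I_m) (E : {set {set 'I_n}}) : injective f -> E \subset pairs n ->
  [set f @: (e : {set 'I_n}) | e in E] \subset pairs m.
Proof.
move=> finj EA; apply/subsetP => _ /imsetP[e /(subsetP EA) + ->].
by rewrite !inE card_imset.
Qed.

Lemma dunion_pairs n m (E : {set {set 'I_n}}) (F : {set {set 'I_m}}) :
  E \subset pairs n -> F \subset pairs m -> dunion E F \subset pairs (n + m).
Proof.
move=> EA FA; rewrite subUset !imset_pairs//; [exact: rshift_inj|exact: lshift_inj].
Qed.

Definition covers (n : nat) (E : {set {set 'I_n}}) : Prop :=
  forall i : 'I_n, exists2 e, e \in E & i \in e.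

(** The axioms of a fully positive character on raw edge sets, free of the subtype [sgraph].
    Boundedness is imposed separately, as [c <= 1]. *)
Record gcharacter (R : realFieldType) (r : forall n, {set {set 'I_n}} -> R) : Prop := GCharacter {
  gch_iso : forall n m (f : 'I_n -> 'I_m) (E : {set {set 'I_n}}), bijective f -> E \subset pairs n ->
    r m [set f @: (e : {set 'I_n}) | e in E] = r n E;
  gch_dunion : forall n m (E : {set {set 'I_n}}) (F : {set {set 'I_m}}),
    E \subset pairs n -> F \subset pairs m -> r (n + m)%N (dunion E F) = r n E * r m F;
  gch_0 : r 0%N set0 = 1;
  gch_pos : forall n (E : {set {set 'I_n}}), E \subset pairs n ->
    0 <= \sum_(B : {set {set 'I_n}} | (E \subset B) && (B \subset pairs n)) (-1) ^+ #|B :\: E| * r n B }.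

Section Character.
Variables (R : archiRealFieldType) (r : forall n, {set {set 'I_n}} -> R).
Hypothesis rch : gcharacter r.

Let c := r (set0 : {set {set 'I_1}}).

Lemma gch_empty n : r (set0 : {set {set 'I_n}}) = c ^+ n.
Proof.
elim: n => [|n IH]; first by rewrite expr0 (gch_0 rch).
have := gch_dunion rch (sub0set (pairs 1)) (sub0set (pairs n)).
by rewrite /dunion !imset0 setU0 exprS IH.
Qed.

Lemma gch_inj m n (f : 'I_m -> 'I_n) (E : {set {set 'I_m}}) : injective f -> E \subset pairs m ->
  r [set f @: (e : {set 'I_m}) | e in E] = r E * c ^+ (n - m).
Proof.
move=> finj EA.
have mn : (m <= n)%N by have := leq_card f finj; rewrite !card_ord.
have cardC : #|~: [set f i | i : 'I_m]| = (n - m)%N.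
  by have := cardsC [set f i | i : 'I_m]; rewrite card_imset// !card_ord; lia.
(* Extend [f] to a bijection by sending the added isolated vertices onto the complement of its
   image. *)
pose g (x : 'I_(m + (n - m))) : 'I_n :=
  match split x with inl i => f i | inr j => enum_val (cast_ord (esym cardC) j) end.
have gl i : g (lshift _ i) = f i by rewrite /g -[lshift _ i]/(unsplit (inl i)) unsplitK.
have gr j : g (rshift _ j) = enum_val (cast_ord (esym cardC) j).
  by rewrite /g -[rshift _ j]/(unsplit (inr j)) unsplitK.
have grC j : g (rshift _ j) \notin [set f i | i : 'I_m].
  by rewrite gr; have := enum_valP (cast_ord (esym cardC) j); rewrite inE.
have ginj : injective g.
  move=> x y; rewrite -(splitK x) -(splitK y); case: (split x) => i; case: (split y) => j /=.
  - by rewrite !gl => /finj ->.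
  - by rewrite gl => e; have := grC j; rewrite -e imset_f.
  - by rewrite [in RHS]gl => e; have := grC i; rewrite e imset_f.
  - by rewrite !gr => /enum_val_inj/cast_ord_inj ->.
have gbij : bijective g by apply: inj_card_bij; rewrite // !card_ord subnKC.
have := gch_iso rch gbij (dunion_pairs EA (sub0set (pairs (n - m)))).
rewrite (gch_dunion rch)// ?sub0set// gch_empty => <-; congr (r _).
rewrite /dunion imset0 setU0 -imset_comp; apply: eq_imset => e /=.
by rewrite -imset_comp; apply: eq_imset => i /=; rewrite gl.
Qed.

(** Law of the random graph on [n] vertices, of total mass [c ^+ n] rather than 1. *)
Definition gmass n (E : {set {set 'I_n}}) : R :=
  \sum_(B : {set {set 'I_n}} | (E \subset B) && (B \subset pairs n)) (-1) ^+ #|B :\: E| * r B.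

Lemma gmass_sum n (F : {set {set 'I_n}}) : F \subset pairs n ->
  \sum_(E : {set {set 'I_n}} | (F \subset E) && (E \subset pairs n)) gmass E = r F.
Proof. exact: moebius_inversion. Qed.

Lemma gmass_tot n : \sum_(E : {set {set 'I_n}} | E \subset pairs n) gmass E = c ^+ n.
Proof.
by rewrite -gch_empty -(gmass_sum (sub0set _)); apply: eq_bigl => E; rewrite sub0set.
Qed.

Lemma gmass_ge0 n (E : {set {set 'I_n}}) : E \subset pairs n -> 0 <= gmass E.
Proof. exact: (gch_pos rch). Qed.

Lemma gch_bounds n (F : {set {set 'I_n}}) : F \subset pairs n -> 0 <= r F <= c ^+ n.
Proof.
move=> FA; rewrite -gmass_sum// -gmass_tot; apply/andP; split.
  by apply: sumr_ge0 => E /andP[_]; exact: gmass_ge0.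
rewrite big_mkcond [leRHS]big_mkcond; apply: ler_sum => E _ /=.
case: (boolP (E \subset pairs n)) => EA; last by rewrite andbF.
by rewrite andbT; case: ifP => // _; exact: gmass_ge0.
Qed.

Lemma gch_c_ge0 : 0 <= c.
Proof. by have /andP[] := gch_bounds (sub0set (pairs 1)). Qed.

Definition adj n (H : {set {set 'I_n}}) (i j : 'I_n) : R := ([set i; j] \in H)%:R.

Definition unif n (i : 'I_n) : R := n%:R^-1.

Hypothesis c_gt0 : 0 < c.

Let cn0 n : c ^+ n != 0. Proof. by rewrite expf_neq0// gt_eqF. Qed.

(** Probability that [F] is contained in the random graph after normalising [gmass]; adding isolated
    vertices to [F] does not change it. *)
Definition rnorm n (F : {set {set 'I_n}}) : R := r F / c ^+ n.

Lemma rnorm01 n (F : {set {set 'I_n}}) : F \subset pairs n -> 0 <= rnorm F <= 1.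
Proof.
move=> FA; have /andP[r0 r1] := gch_bounds FA.
rewrite /rnorm divr_ge0 ?exprn_ge0 ?(ltW c_gt0)//=.
by rewrite ler_pdivrMr ?exprn_gt0// mul1r.
Qed.

Definition gmean n (K : {set {set 'I_n}} -> R) : R :=
  c ^- n * \sum_(H : {set {set 'I_n}} | H \subset pairs n) gmass H * K H.

Lemma ler_gmean n (K K' : {set {set 'I_n}} -> R) :
  (forall H : {set {set 'I_n}}, H \subset pairs n -> K H <= K' H) -> gmean K <= gmean K'.
Proof.
move=> KK; rewrite /gmean ler_wpM2l ?invr_ge0 ?exprn_ge0 ?(ltW c_gt0)//.
by apply: ler_sum => H HA; rewrite ler_wpM2l ?gmass_ge0 ?KK.
Qed.

Lemma gmean_cst n (x : R) : @gmean n (fun=> x) = x.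
Proof. by rewrite /gmean -mulr_suml gmass_tot mulrA mulVf ?mul1r. Qed.

Lemma adj01 n (H : {set {set 'I_n}}) i j : 0 <= adj H i j <= 1.
Proof. by rewrite /adj; case: (_ \in H); rewrite ?lexx ?ler01. Qed.

Lemma adjC n (H : {set {set 'I_n}}) i j : adj H i j = adj H j i.
Proof. by rewrite /adj setUC. Qed.

Lemma unif_ge0 n (i : 'I_n) : 0 <= unif i. Proof. by rewrite invr_ge0. Qed.

Lemma unif_sum1 n : (0 < n)%N -> \sum_(i < n) unif i = 1.
Proof.
by move=> n0; rewrite sumr_const card_ord -[LHS]mulr_natr mulVf// pnatr_eq0 -lt0n.
Qed.

Lemma prod_adj_inj m n (F : {set {set 'I_m}}) (H : {set {set 'I_n}}) (phi : {ffun 'I_m -> 'I_n}) :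
  injective phi -> F \subset pairs m ->
  \prod_(e in F) eweight (fun i j => adj H (phi i) (phi j)) e =
  ([set phi @: (e : {set 'I_m}) | e in F] \subset H)%:R.
Proof.
move=> pinj FA.
have eE (e : {set 'I_m}) : e \in F -> eweight (fun i j => adj H (phi i) (phi j)) e = (phi @: e \in H)%:R.
  move=> /(subsetP FA); rewrite inE => /cards2P[i [j [ij ->]]].
  rewrite (eweight_set2 (fun i j => adjC _ _ _) ij) /adj.
  by rewrite imsetU !imset_set1.
case: (boolP (_ \subset H)) => [/subsetP sub|/subsetPn[_ /imsetP[e eF ->] eH]].
  by apply: big1 => e eF; rewrite eE// sub// imset_f.
by rewrite (bigD1 e eF) /= eE// (negbTE eH) mul0r.
Qed.

(** For an injective map the mean is exactly [rnorm F], by invariance. The error is at most the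
    expected number [col] of ordered colliding pairs, which is [m (m - 1) / n]. *)
Lemma gmean_tfin m n (F : {set {set 'I_m}}) : (0 < n)%N -> F \subset pairs m ->
  `|@gmean n (fun H => tfin (@unif n) (adj H) F) - rnorm F| <= m%:R ^+ 2 / n%:R.
Proof.
move=> n0 FA.
pose ev H (phi : {ffun 'I_m -> 'I_n}) := \prod_(e in F) eweight (fun i j => adj H (phi i) (phi j)) e.
have ev01 H phi : 0 <= ev H phi <= 1.
  rewrite /ev prodr_ge0 => [|e _].
    by apply: prodr_ile1 => e _; apply: eweight_ind => i j; exact: adj01.
  by case/andP: (@eweight_ind R m (fun i j => adj H (phi i) (phi j)) e (fun i j => adj01 _ _ _)).
have -> : @gmean n (fun H => tfin (@unif n) (adj H) F) = fexp (@unif n) (fun phi => gmean (fun H => ev H phi)).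
  rewrite /gmean fexpZ fexp_sum; congr (_ * _).
  by apply: eq_bigr => H _; rewrite fexpZ.
rewrite -[X in _ - X](fexp_cst 'I_m (unif_sum1 n0)) -fexpB.
rewrite (le_trans (ler_norm_fexp (@unif_ge0 n) _))//.
pose col (phi : {ffun 'I_m -> 'I_n}) : R := \sum_i \sum_(j | j != i) (phi i == phi j)%:R.
apply: (@le_trans _ _ (fexp (@unif n) col)).
  apply: ler_fexp => [|phi]; first exact: unif_ge0.
  have [/injectiveP pinj|] := boolP (injectiveb phi).
    rewrite (_ : gmean _ = rnorm F).
      by rewrite subrr normr0; apply: sumr_ge0 => i _; apply: sumr_ge0 => j _.
    have mn : (m <= n)%N by have := leq_card phi pinj; rewrite !card_ord.
    rewrite /gmean (eq_bigr (fun H : {set {set 'I_n}} => if [set phi @: (e : {set 'I_m}) | e in F] \subset H then gmass H else 0)).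
      rewrite -big_mkcondr /= (eq_bigl (fun H : {set {set 'I_n}} =>
        ([set phi @: (e : {set 'I_m}) | e in F] \subset H) && (H \subset pairs n))); last by move=> H; rewrite andbC.
      rewrite gmass_sum ?imset_pairs// gch_inj// /rnorm.
      by rewrite -{1}(subnKC mn) exprD invfM; field; rewrite !cn0.
    by move=> H _; rewrite /ev prod_adj_inj//; case: ifP; rewrite ?mulr1 ?mulr0.
  move=> /injectivePn[i [j ij pij]].
  apply: (@le_trans _ _ 1).
    have /andP[q0 q1] := rnorm01 FA.
    have g0 : 0 <= gmean (fun H => ev H phi).
      by rewrite -(gmean_cst n 0); apply: ler_gmean => H _; case/andP: (ev01 H phi).
    have g1 : gmean (fun H => ev H phi) <= 1.
      by rewrite -(gmean_cst n 1); apply: ler_gmean => H _; case/andP: (ev01 H phi).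
    by rewrite ler_norml; apply/andP; split; lra.
  rewrite /col (bigD1 i) //= (bigD1 j) 1?eq_sym //= pij eqxx.
  rewrite -addrA lerDl addr_ge0//; first by apply: sumr_ge0.
  by apply: sumr_ge0 => k _; apply: sumr_ge0.
rewrite /col fexp_sum (eq_bigr (fun=> (m.-1)%:R / n%:R)).
  rewrite sumr_const card_ord -[leLHS]mulr_natl expr2 -mulrA ler_wpM2l//.
  by rewrite ler_wpM2r ?invr_ge0// ler_nat leq_pred.
move=> i _; rewrite fexp_sum (eq_bigr (fun=> n%:R^-1)).
  rewrite sumr_const -[LHS]mulr_natl; congr (_%:R * _).
  by have := cardC1 i; rewrite card_ord => <-; apply: eq_card => j; rewrite !inE.
move=> j ji; rewrite (fexp2 (unif_sum1 n0) (fun x y => (x == y)%:R)) 1?eq_sym//.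
rewrite (eq_bigr (fun x => n%:R^-1 * n%:R^-1)).
  by rewrite sumr_const card_ord -[LHS]mulr_natl mulrA mulfV ?mul1r// pnatr_eq0 -lt0n.
move=> x _; rewrite (bigD1 x) //= eqxx mulr1 big1 ?addr0// => y yx.
by rewrite eq_sym (negbTE yx) mulr0.
Qed.

(** The square of a density is the density of two disjoint copies, so the second moment is again a
    first moment. The constant is 4 from the [2m] vertices of the double copy plus 2 from the cross
    term. *)
Lemma gmean_var m n (F : {set {set 'I_m}}) : (0 < n)%N -> F \subset pairs m ->
  @gmean n (fun H => (tfin (@unif n) (adj H) F - rnorm F) ^+ 2) <= 6 * m%:R ^+ 2 / n%:R.
Proof.
move=> n0 FA.
have rD : rnorm (dunion F F) = rnorm F ^+ 2.
  by rewrite /rnorm (gch_dunion rch)// exprD; field; rewrite !cn0.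
have -> : @gmean n (fun H => (tfin (@unif n) (adj H) F - rnorm F) ^+ 2) =
   @gmean n (fun H => tfin (@unif n) (adj H) (dunion F F)) -
   2 * rnorm F * @gmean n (fun H => tfin (@unif n) (adj H) F) + rnorm F ^+ 2.
  rewrite -[X in _ + X](gmean_cst n) /gmean.
  rewrite [2 * rnorm F * _]mulrCA -mulrBr -mulrDr; congr (_ * _).
  rewrite mulr_sumr -sumrB -big_split /=; apply: eq_bigr => H _.
  by rewrite /dunion tfin_dunion//; [ring|exact: adjC].
have /andP[q0 q1] := rnorm01 FA.
have := gmean_tfin n0 FA; have := gmean_tfin n0 (dunion_pairs FA FA).
rewrite rD natrD !ler_norml => /andP[_ h1] /andP[h2 _].
have e0 : 0 <= m%:R ^+ 2 / n%:R :> R by rewrite divr_ge0// sqr_ge0.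
have -> : 6 * m%:R ^+ 2 / n%:R = 6 * (m%:R ^+ 2 / n%:R) :> R by rewrite mulrA.
have h1' : gmean (fun H => tfin (@unif n) (adj H) (dunion F F)) - rnorm F ^+ 2 <= 4 * (m%:R ^+ 2 / n%:R).
  by apply: le_trans h1 _; rewrite le_eqVlt; apply/orP; left; apply/eqP; ring.
nra.
Qed.

(** Sum the squared deviations over all graphs on at most [M] vertices. Some [H] does no worse than
    the mean of this sum, and so serves all these graphs simultaneously. *)
Lemma exists_good_graph (M : nat) (de : R) : 0 < de ->
  exists n (H : {set {set 'I_n}}), [/\ (0 < n)%N, H \subset pairs n &
    forall m (F : {set {set 'I_m}}), (m <= M)%N -> F \subset pairs m ->
      `|tfin (@unif n) (adj H) F - rnorm F| <= de].
Proof.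
move=> de0.
pose S n (H : {set {set 'I_n}}) : R := \sum_(m < M.+1) \sum_(F : {set {set 'I_m}} | F \subset pairs m)
   (tfin (@unif n) (adj H) F - rnorm F) ^+ 2.
pose K : R := \sum_(m < M.+1) \sum_(F : {set {set 'I_m}} | F \subset pairs m) 6 * m%:R ^+ 2.
have K0 : 0 <= K by apply: sumr_ge0 => m _; apply: sumr_ge0 => F _; rewrite mulr_ge0// sqr_ge0.
have [n n0 nK] : exists2 n, (0 < n)%N & K / n%:R <= de ^+ 2.
  exists (Num.bound (K / de ^+ 2)).+1 => //.
  rewrite ler_pdivrMr// -ler_pdivrMl ?exprn_gt0// mulrC.
  apply: le_trans (ltW (archi_boundP _)) _; first by rewrite divr_ge0// sqr_ge0.
  by rewrite ler_nat.
have Smean : @gmean n (@S n) <= de ^+ 2.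
  apply: le_trans nK.
  have -> : @gmean n (@S n) = \sum_(m < M.+1) \sum_(F : {set {set 'I_m}} | F \subset pairs m)
     @gmean n (fun H => (tfin (@unif n) (adj H) F - rnorm F) ^+ 2).
    rewrite /gmean /S.
    under [RHS]eq_bigr do rewrite -mulr_sumr.
    rewrite -mulr_sumr; congr (_ * _).
    rewrite (eq_bigr (fun m : 'I_M.+1 => \sum_(H : {set {set 'I_n}} | H \subset pairs n)
       \sum_(F : {set {set 'I_m}} | F \subset pairs m) gmass H *
       (tfin (@unif n) (adj H) F - rnorm F) ^+ 2)); last first.
      by move=> m _; rewrite exchange_big.
    rewrite exchange_big /=; apply: eq_bigr => H _; rewrite mulr_sumr.
    by apply: eq_bigr => m _; rewrite mulr_sumr.
  rewrite /K mulr_suml; apply: ler_sum => m _; rewrite mulr_suml.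
  by apply: ler_sum => F FA; exact: gmean_var.
have [H HA HS] : exists2 H : {set {set 'I_n}}, H \subset pairs n & S n H <= de ^+ 2.
  (* Otherwise nonnegative terms with nonpositive sum would force every mass to vanish, against the
     total [c ^+ n]. *)
  apply/exists_inP; apply: contraT; rewrite negb_exists_in => /forall_inP hS; exfalso.
  have gS : @gmean n (fun H => S n H - de ^+ 2) <= 0.
    rewrite (_ : gmean _ = gmean (@S n) - de ^+ 2) ?subr_le0//.
    rewrite -[X in _ - X](gmean_cst n) /gmean -mulrBr -sumrB.
    by congr (_ * _); apply: eq_bigr => H _; ring.
  move: gS; rewrite /gmean pmulr_rle0 ?invr_gt0 ?exprn_gt0// => gS.
  have pos (H : {set {set 'I_n}}) : H \subset pairs n -> 0 <= gmass H * (S n H - de ^+ 2).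
    by move=> HA; rewrite mulr_ge0 ?gmass_ge0// subr_ge0 ltW// ltNge hS.
  have g0 : \sum_(H : {set {set 'I_n}} | H \subset pairs n) gmass H * (S n H - de ^+ 2) = 0.
    by apply/eqP; rewrite eq_le gS /=; apply: sumr_ge0.
  have := gmass_tot n; rewrite big1 => [/esym/eqP|H HA]; first by rewrite (negbTE (cn0 n)).
  have := psumr_eq0P pos g0 HA; move/eqP; rewrite mulf_eq0 => /orP[/eqP//|].
  by rewrite subr_eq0 => /eqP e; have := hS H HA; rewrite e lexx.
exists n, H; split => // m F mM FA.
apply: sqr_norm_le; first exact: ltW.
apply: le_trans HS.
have mM' : (m < M.+1)%N by [].
rewrite /S (bigD1 (Ordinal mM')) //= (bigD1 F) //= -addrA lerDl addr_ge0//.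
  by apply: sumr_ge0 => ? _; exact: sqr_ge0.
by apply: sumr_ge0 => ? _; apply: sumr_ge0 => ? _; exact: sqr_ge0.
Qed.

End Character.

Record fkernel (R : realFieldType) := FKernel {
  fkV : finType;
  fkm : fkV -> R;
  fkw : fkV -> fkV -> R;
  fkm_ge0 : forall v, 0 <= fkm v;
  fkm_sum1 : \sum_v fkm v = 1;
  fkw01 : forall u v, 0 <= fkw u v <= 1;
  fkwC : forall u v, fkw u v = fkw v u }.

(* Dilution by an isolated vertex of weight 1 - c multiplies the density of a
   graph without isolated vertices by c to the number of its vertices. *)
Section Dilution.
Variables (R : realFieldType) (V : finType) (a : V -> R) (w : V -> V -> R) (c : R).

Definition dil_mass (x : option V) : R := if x is Some v then c * a v else 1 - c.
Definition dil_kernel (x y : option V) : R :=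
  if x is Some u then if y is Some v then w u v else 0 else 0.

Lemma big_option_sum (F : option V -> R) : \sum_x F x = F None + \sum_v F (Some v).
Proof.
rewrite (bigD1 None) //=; congr (_ + _).
rewrite (reindex_omap (op := +%R) Some id) /=; last by case.
by apply: eq_bigl => v; rewrite eqxx.
Qed.

Lemma tfin_dilution n (E : {set {set 'I_n}}) (v0 : V) : E \subset pairs n -> covers E ->
  tfin dil_mass dil_kernel E = c ^+ n * tfin a w E.
Proof.
move=> EA cov; rewrite /tfin {1}/fexp.
(* Every vertex lies on an edge, so a sample using the added vertex [None] gives some edge the
   weight 0. In the remaining part [v0] is only a default for stripping [Some]. *)
rewrite (bigID (fun phi : {ffun 'I_n -> option V} => [forall i, phi i != None])) /=.
rewrite [X in _ + X]big1 ?addr0.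
  rewrite (reindex_onto (fun psi : {ffun 'I_n -> V} => [ffun i => Some (psi i)])
    (fun phi : {ffun 'I_n -> option V} => [ffun i => odflt v0 (phi i)])) /=; last first.
    move=> phi /forallP h; apply/ffunP => i; rewrite !ffunE.
    by have := h i; case: (phi i).
  rewrite /fexp mulr_sumr; apply: eq_big => [psi|psi _].
    apply/andP; split; first by apply/forallP => i; rewrite ffunE.
    by apply/eqP/ffunP => i; rewrite !ffunE.
  rewrite (eq_bigr (fun i => c * a (psi i))); last by move=> i _; rewrite ffunE.
  rewrite big_split /= prodr_const card_ord -mulrA; congr (_ * (_ * _)).
  apply: eq_bigr => e _; apply: eq_bigr => p _; by rewrite !ffunE.
move=> phi /forallPn[i]; rewrite negbK => /eqP phii.
have [e eE ie] := cov i; rewrite (bigD1 e eE) /=.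
have := subsetP EA _ eE; rewrite inE => /cards2P[u [v [uv eq_e]]].
have [k [l [kl eq_e']]] : exists k l : 'I_n, (k < l)%N /\ e = [set k; l].
  move: uv; rewrite neq_ltn => /orP[]; first by exists u, v.
  by exists v, u; rewrite setUC.
rewrite {1}eq_e' eweight_set2_lt//.
have -> : dil_kernel (phi k) (phi l) = 0.
  move: ie; rewrite eq_e' !inE => /orP[]/eqP <-; rewrite phii//.
  by rewrite /dil_kernel; case: (phi _).
by rewrite mul0r mulr0.
Qed.

End Dilution.

Lemma gcharacter_approx (R : archiRealFieldType) (r : forall n, {set {set 'I_n}} -> R) (M : nat) (de : R) :
  gcharacter r -> r 1%N set0 <= 1 -> 0 < de ->
  exists k : fkernel R, forall m (F : {set {set 'I_m}}), (m <= M)%N -> F \subset pairs m -> covers F ->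
     `|tfin (@fkm R k) (@fkw R k) F - r m F| <= de.
Proof.
move=> rch c1 de0.
have := gch_c_ge0 rch; rewrite le_eqVlt => /orP[/eqP c0|c0].
  (* If [c = 0], the bounds force [r] to vanish on every graph with a vertex, as does the zero
     kernel on one point whenever all vertices are covered. *)
  have k0 : \sum_(v : unit) 1 = 1 :> R by rewrite sumr_const card_unit.
  exists (@FKernel R unit (fun=> 1) (fun _ _ => 0) (fun=> ler01) k0
     (fun _ _ => introT andP (conj (lexx 0) ler01)) (fun _ _ => erefl)) => m F _ FA cov /=.
  suff -> : tfin (fun _ : unit => 1) (fun _ _ => 0) F = r m F by rewrite subrr normr0 ltW.
  case: m => [|m] in F FA cov *.
    have -> : F = set0.
      apply/setP => e; rewrite inE; apply/negP => /(subsetP FA); rewrite inE.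
      by move=> /cards2P[[]].
    rewrite (gch_0 rch) -[RHS](fexp_cst 'I_0 k0); apply: eq_fexp => phi.
    by rewrite big_set0.
  have := gch_bounds rch FA; rewrite -c0 expr0n /= -eq_le => /eqP <-.
  rewrite /tfin -[RHS](fexp_cst 'I_m.+1 k0); apply: eq_fexp => phi.
  have [e eE ie] := cov ord0; rewrite (bigD1 e eE) /=.
  have := subsetP FA _ eE; rewrite inE => /cards2P[u [v [uv eq_e]]].
  by rewrite eq_e eweight_set2// mul0r.
have [n [H [n0 HA good]]] := exists_good_graph rch c0 M de0.
set c := r 1%N set0 in c1 c0 good.
pose a := @unif R n.
have m0 x : 0 <= dil_mass a c x.
  by case: x => [v|] /=; rewrite ?subr_ge0// mulr_ge0 ?unif_ge0// ltW.
have m1 : \sum_x dil_mass a c x = 1.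
  by rewrite big_option_sum /= -mulr_sumr unif_sum1// mulr1 subrK.
have w01 x y : 0 <= dil_kernel (adj R H) x y <= 1.
  by case: x y => [x|] [y|] /=; rewrite ?adj01 ?lexx ?ler01.
have wC x y : dil_kernel (adj R H) x y = dil_kernel (adj R H) y x.
  by case: x y => [x|] [y|] //=; exact: adjC.
exists (FKernel m0 m1 w01 wC) => m F mM FA cov /=.
rewrite tfin_dilution//; last exact: (Ordinal n0).
have -> : r m F = c ^+ m * rnorm r F by rewrite /rnorm -/c; field; rewrite expf_neq0// gt_eqF.
rewrite -mulrBr normrM ger0_norm ?exprn_ge0 ?(ltW c0)//.
rewrite -[leRHS]mul1r ler_pM ?exprn_ge0 ?(ltW c0)//; last exact: good.
by rewrite exprn_ile1// ltW.
Qed.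

From mathcomp Require Import all_classical all_reals all_analysis measurable_realfun.
Import Order.TTheory GRing.Theory Num.Theory.
Import numFieldNormedType.Exports.
Local Open Scope classical_set_scope.
Local Open Scope ring_scope.

(** * Integrals over the unit interval *)

(** Measurability and boundedness are asked globally, so that the class is closed under algebra and
    composition and is integrable on the unit interval without further conditions. *)
Definition bmeas {R : realType} (d : measure_display) (T : measurableType d) (f : T -> R) : Prop :=
  measurable_fun setT f /\ exists C : R, forall x, `|f x| <= C.

Section BMeas.
Context {R : realType} (d : measure_display) (T : measurableType d).
Implicit Types f g : T -> R.

Lemma bmeas_cst (c : R) : bmeas (fun _ : T => c).
Proof. by split; [exact: measurable_cst|exists `|c|]. Qed.

Lemma bmeasD f g : bmeas f -> bmeas g -> bmeas (fun x => f x + g x).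
Proof.
move=> [mf [C hC]] [mg [D hD]]; split; first exact: measurable_funD.
by exists (C + D) => x; rewrite (le_trans (ler_normD _ _))// lerD.
Qed.

Lemma bmeasN f : bmeas f -> bmeas (fun x => - f x).
Proof.
move=> [mf [C hC]]; split; first exact: measurableT_comp.
by exists C => x; rewrite normrN.
Qed.

Lemma bmeasB f g : bmeas f -> bmeas g -> bmeas (fun x => f x - g x).
Proof. by move=> bf bg; apply: bmeasD => //; exact: bmeasN. Qed.

Lemma bmeasM f g : bmeas f -> bmeas g -> bmeas (fun x => f x * g x).
Proof.
move=> [mf [C hC]] [mg [D hD]]; split; first exact: measurable_funM.
exists (C * D) => x; rewrite normrM ler_pM//.
Qed.

Lemma bmeas_norm f : bmeas f -> bmeas (fun x => `|f x|).
Proof.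
move=> [mf [C hC]]; split; first by apply: measurableT_comp => //; exact: measurable_normr.
by exists C => x; rewrite normr_id.
Qed.

Lemma bmeas_sum (I : Type) (s : seq I) (P : pred I) (F : I -> T -> R) :
  (forall i, P i -> bmeas (F i)) -> bmeas (fun x => \sum_(i <- s | P i) F i x).
Proof.
move=> bF; elim: s => [|i s IH].
  by under eq_fun do rewrite big_nil; exact: bmeas_cst.
under eq_fun do rewrite big_cons.
by case: (boolP (P i)) => // Pi; apply: bmeasD => //; exact: bF.
Qed.

Lemma bmeas_prod (I : Type) (s : seq I) (P : pred I) (F : I -> T -> R) :
  (forall i, P i -> bmeas (F i)) -> bmeas (fun x => \prod_(i <- s | P i) F i x).
Proof.
move=> bF; elim: s => [|i s IH].
  by under eq_fun do rewrite big_nil; exact: bmeas_cst.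
under eq_fun do rewrite big_cons.
by case: (boolP (P i)) => // Pi; apply: bmeasM => //; exact: bF.
Qed.

Lemma bmeas_indic (A : set T) : measurable A -> bmeas (\1_A : T -> R).
Proof.
move=> mA; split; first exact: measurable_indic.
by exists 1 => x; rewrite indicE; case: (_ \in _); rewrite ?normr0 ?normr1.
Qed.

End BMeas.

Lemma bmeas_comp {R : realType} (d d' : measure_display) (T : measurableType d) (T' : measurableType d')
  (f : T' -> R) (h : T -> T') : bmeas f -> measurable_fun setT h -> bmeas (fun x => f (h x)).
Proof.
move=> [mf [C hC]] mh; split; last by exists C.
exact: measurableT_comp.
Qed.

Section Mean.
Context {R : realType}.
Notation leb := (@lebesgue_measure R).
Implicit Types f g : R -> R.

Definition mean f : R := Rintegral leb (I01 R) f.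

Lemma measurable_I01 : measurable (I01 R).
Proof. exact: measurable_itv. Qed.

Lemma leb_I01 : leb (I01 R) = 1%E.
Proof. by rewrite /I01 lebesgue_measure_itv /= lte01 sube0. Qed.

Lemma bmeas_integrable f : bmeas f -> leb.-integrable (I01 R) (EFin \o f).
Proof.
move=> [mf [C hC]].
apply: (@le_integrable _ _ _ leb _ measurable_I01 _ (EFin \o cst C)).
- by apply/measurable_EFinP; exact: measurable_funS mf.
- by move=> x _ /=; rewrite lee_fin (le_trans (hC x))// ler_norm.
- apply/integrableP; split; first by apply/measurable_EFinP; exact: measurable_cst.
  rewrite /= integral_cst; last exact: measurable_I01.
  by rewrite [X in (_ * X < _)%E]leb_I01 mule1 ltry.
Qed.

Lemma meanE f : bmeas f -> (mean f)%:E = (\int[leb]_(x in I01 R) (f x)%:E)%E.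
Proof.
move=> bf; rewrite /mean /Rintegral fineK//.
by apply: integrable_fin_num; [exact: measurable_I01|exact: bmeas_integrable].
Qed.

Lemma mean_cst (c : R) : mean (fun=> c) = c.
Proof.
rewrite /mean Rintegral_cst; last exact: measurable_I01.
by rewrite [X in _ * fine X]leb_I01 mulr1.
Qed.

Lemma meanD f g : bmeas f -> bmeas g -> mean (fun x => f x + g x) = mean f + mean g.
Proof.
by move=> bf bg; apply: RintegralD; [exact: measurable_I01|exact: bmeas_integrable..].
Qed.

Lemma meanB f g : bmeas f -> bmeas g -> mean (fun x => f x - g x) = mean f - mean g.
Proof.
by move=> bf bg; apply: RintegralB; [exact: measurable_I01|exact: bmeas_integrable..].
Qed.

Lemma meanZ (c : R) f : bmeas f -> mean (fun x => c * f x) = c * mean f.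
Proof.
by move=> bf; apply: RintegralZl; [exact: measurable_I01|exact: bmeas_integrable].
Qed.

Lemma eq_mean f g : {in I01 R, f =1 g} -> mean f = mean g.
Proof. by move=> h; apply: eq_Rintegral => x xI; exact: h. Qed.

Lemma ler_mean f g : bmeas f -> bmeas g -> (forall x, x \in I01 R -> f x <= g x) -> mean f <= mean g.
Proof.
move=> bf bg fg; apply: le_Rintegral; [exact: measurable_I01|exact: bmeas_integrable..|].
by move=> x xI; apply: fg; rewrite inE.
Qed.

Lemma mean_ge0 f : (forall x, x \in I01 R -> 0 <= f x) -> 0 <= mean f.
Proof. by move=> f0; apply: Rintegral_ge0 => x xI; apply: f0; rewrite inE. Qed.

Lemma ler_norm_mean f : bmeas f -> `|mean f| <= mean (fun x => `|f x|).
Proof.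
by move=> bf; apply: le_normr_Rintegral; [exact: measurable_I01|exact: bmeas_integrable].
Qed.

Lemma mean_sum (I : Type) (s : seq I) (P : pred I) (F : I -> R -> R) :
  (forall i, P i -> bmeas (F i)) ->
  mean (fun x => \sum_(i <- s | P i) F i x) = \sum_(i <- s | P i) mean (F i).
Proof.
move=> bF; elim: s => [|i s IH].
  under [X in mean X]eq_fun do rewrite big_nil.
  by rewrite mean_cst big_nil.
under [X in mean X]eq_fun do rewrite big_cons.
rewrite big_cons; case: (boolP (P i)) => // Pi; rewrite meanD// ?IH//; first exact: bF.
exact: bmeas_sum.
Qed.

Lemma mean_bound f (C : R) : bmeas f -> (forall x, `|f x| <= C) -> `|mean f| <= C.
Proof.
move=> bf hC; apply: le_trans (ler_norm_mean bf) _.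
rewrite -[leRHS]mean_cst; apply: ler_mean => //; first exact: bmeas_norm.
exact: bmeas_cst.
Qed.

Lemma bmeas_mean (d : measure_display) (T : measurableType d) (f : T * R -> R) :
  bmeas f -> bmeas (fun x : T => mean (fun y => f (x, y))).
Proof.
move=> bf; have [mf [C hC]] := bf.
have sec x : bmeas (fun y => f (x, y)).
  by apply: (bmeas_comp bf); exact: pair1_measurable.
have C0 : 0 <= C by apply: le_trans (hC (point, point)).
split; last by exists C => x; exact: mean_bound.
(* Adding [C] makes the integrand nonnegative, as the measurability part of Tonelli requires; it is
   subtracted again afterwards. *)
pose g (p : T * R) : \bar R := ((f p + C) * \1_(I01 R) p.2)%:E.
have mg : measurable_fun setT g.
  apply/measurable_EFinP; apply: measurable_funM; first exact: measurable_funD.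
  by apply: measurableT_comp => //; apply: measurable_indic; exact: measurable_I01.
have g0 p : (0 <= g p)%E.
  rewrite lee_fin mulr_ge0//.
  by have := hC p; rewrite ler_norml => /andP[+ _]; lra.
have := @measurable_fun_fubini_tonelli_F _ _ T _ R leb g mg g0.
rewrite (_ : fubini_F _ _ = fun x => (mean (fun y => f (x, y)) + C)%:E).
  move/measurable_EFinP => mh.
  rewrite (_ : (fun x => _) = (fun x => (mean (fun y => f (x, y)) + C) - C)).
    by apply: measurable_funB.
  by apply/funext => x; rewrite addrK.
apply/funext => x; rewrite /fubini_F.
rewrite -[X in _ = (_ + X)%:E](mean_cst C) -meanD//; last exact: bmeas_cst.
rewrite meanE; last by apply: bmeasD => //; exact: bmeas_cst.
rewrite [RHS]integral_mkcond; apply: eq_integral => y _.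
rewrite /g /= patchE indicE; case: (y \in I01 R); by rewrite ?mulr1 ?mulr0.
Qed.

Definition mean2 (g : R * R -> R) : R := mean (fun x => mean (fun y => g (x, y))).

Lemma mean2E (g : R * R -> R) : bmeas g -> (forall p, 0 <= g p) ->
  (mean2 g)%:E = (\int[leb \x leb]_(p in I01 R `*` I01 R) (g p)%:E)%E.
Proof.
move=> bg g0.
have sec x : bmeas (fun y => g (x, y)).
  by apply: (bmeas_comp bg); exact: pair1_measurable.
rewrite /mean2 meanE; last exact: bmeas_mean.
rewrite [RHS]integral_mkcond.
pose h (p : R * R) : \bar R := (g p * \1_(I01 R) p.1 * \1_(I01 R) p.2)%:E.
transitivity (\int[leb \x leb]_p h p)%E; last first.
  apply: eq_integral => -[x y] _; rewrite /h /= patchE !indicE in_setX /=.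
  by case: (x \in _); case: (y \in _); rewrite ?mulr1 ?mulr0.
rewrite fubini_tonelli1.
- rewrite integral_mkcond; apply: eq_integral => x _.
  rewrite /fubini_F /h /= patchE; case: ifPn => xI.
    rewrite meanE// integral_mkcond; apply: eq_integral => y _.
    by rewrite patchE !indicE xI; case: (y \in _); rewrite ?mulr1 ?mulr0.
  apply/esym; apply: integral0_eq => y _.
  by rewrite indicE (negbTE xI) mulr0 mul0r.
- apply/measurable_EFinP; case: bg => mg _.
  apply: measurable_funM; first apply: measurable_funM => //.
    by apply: measurableT_comp => //; apply: measurable_indic; exact: measurable_I01.
  by apply: measurableT_comp => //; apply: measurable_indic; exact: measurable_I01.
- by move=> p; rewrite lee_fin !mulr_ge0.
Qed.

Lemma bmeas_pair1 (g : R * R -> R) (x : R) : bmeas g -> bmeas (fun y => g (x, y)).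
Proof. by move=> bg; apply: (bmeas_comp bg); exact: pair1_measurable. Qed.

Lemma mean2D (g h : R * R -> R) : bmeas g -> bmeas h -> mean2 (fun p => g p + h p) = mean2 g + mean2 h.
Proof.
move=> bg bh; rewrite /mean2 -meanD; [|exact: bmeas_mean..].
by apply: eq_mean => x _; rewrite meanD//; exact: bmeas_pair1.
Qed.

Lemma mean2Z c (g : R * R -> R) : bmeas g -> mean2 (fun p => c * g p) = c * mean2 g.
Proof.
move=> bg; rewrite /mean2 -meanZ; last exact: bmeas_mean.
by apply: eq_mean => x _; rewrite meanZ//; exact: bmeas_pair1.
Qed.

Lemma ler_mean2 (g h : R * R -> R) : bmeas g -> bmeas h ->
  (forall x y, x \in I01 R -> y \in I01 R -> g (x, y) <= h (x, y)) -> mean2 g <= mean2 h.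
Proof.
move=> bg bh gh; apply: ler_mean; [exact: bmeas_mean..|] => x xI.
apply: ler_mean; [exact: bmeas_pair1..|] => y yI; exact: gh.
Qed.

Lemma mean2_ge0 (g : R * R -> R) : (forall x y, x \in I01 R -> y \in I01 R -> 0 <= g (x, y)) -> 0 <= mean2 g.
Proof. by move=> g0; apply: mean_ge0 => x xI; apply: mean_ge0 => y yI; exact: g0. Qed.

Lemma mean2_cst c : mean2 (fun=> c) = c.
Proof. by rewrite /mean2 !mean_cst. Qed.

Lemma mean2C (g : R * R -> R) : bmeas g -> (forall p, 0 <= g p) -> mean2 (fun p => g (p.2, p.1)) = mean2 g.
Proof.
move=> bg g0.
have bg' : bmeas (fun p : R * R => g (p.2, p.1)).
  by apply: (bmeas_comp bg); exact: measurable_swap.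
have bgx x : bmeas (fun y => g (x, y)) by exact: bmeas_pair1.
have bgx' x : bmeas (fun y => g (y, x)) by apply: (bmeas_comp bg); exact: pair2_measurable.
apply: EFin_inj; rewrite /mean2 !meanE; [|exact: bmeas_mean|exact: (bmeas_mean bg')].
pose h (p : R * R) : \bar R := (g p * \1_(I01 R) p.1 * \1_(I01 R) p.2)%:E.
have mh : measurable_fun setT h.
  apply/measurable_EFinP; case: bg => mg _.
  apply: measurable_funM; first apply: measurable_funM => //.
    by apply: measurableT_comp => //; apply: measurable_indic; exact: measurable_I01.
  by apply: measurableT_comp => //; apply: measurable_indic; exact: measurable_I01.
have h0 p : (0 <= h p)%E by rewrite lee_fin !mulr_ge0.
have := @fubini_tonelli _ _ _ _ R leb leb h mh h0.
rewrite -(_ : (\int[leb]_(x in I01 R) (mean (fun y => g (x, y)))%:E)%E =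
   (\int[leb]_x \int[leb]_y h (x, y))%E); last first.
  rewrite integral_mkcond; apply: eq_integral => x _.
  rewrite /h /= patchE; case: ifPn => xI.
    rewrite meanE// integral_mkcond; apply: eq_integral => y _.
    by rewrite patchE !indicE xI; case: (y \in _); rewrite ?mulr1 ?mulr0.
  by apply/esym; apply: integral0_eq => y _; rewrite indicE (negbTE xI) mulr0 mul0r.
move=> ->.
rewrite integral_mkcond; apply: eq_integral => x _.
rewrite /h /= patchE; case: ifPn => xI.
  rewrite meanE// integral_mkcond; apply: eq_integral => y _.
  by rewrite patchE !indicE xI; case: (y \in _); rewrite ?mulr1 ?mulr0.
by apply/esym; apply: integral0_eq => y _; rewrite [\1__ x]indicE (negbTE xI) mulr0.
Qed.

End Mean.

(** * Iterated integrals over sequences of coordinates *)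

Section Env.
Context {R : realType}.

Definition coord_cyl : set (set (nat -> R)) :=
  [set A | exists i (B : set R), measurable B /\ A = (fun u : nat -> R => u i) @^-1` B].

(** Sequences with the product sigma-algebra, so that the integrands of [iint], functions of a whole
    sequence, can be called measurable. *)
Definition env := g_sigma_algebraType coord_cyl.

Lemma measurable_coord i : measurable_fun setT (fun u : env => u i).
Proof.
move=> _ B mB; rewrite setTI; apply: sub_sigma_algebra.
by exists i, B.
Qed.

Lemma measurable_to_env (d : measure_display) (T : measurableType d) (h : T -> env) :
  (forall i, measurable_fun setT (fun x => h x i)) -> measurable_fun setT h.
Proof.
move=> mh.
apply: (@measurability _ _ T env setT h coord_cyl erefl) => _ [_ [i [B [mB ->]]] <-].
exact: mh.
Qed.

Definition setc (k : nat) (u : env) (x : R) : env := fun j => if j == k then x else u j.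

Lemma measurable_setc k : measurable_fun setT (fun p : env * R => setc k p.1 p.2).
Proof.
apply: measurable_to_env => i; rewrite /setc; case: (i == k); first exact: measurable_snd.
by apply: (measurableT_comp (measurable_coord i)); exact: measurable_fst.
Qed.

Lemma bmeas_setc k (u : env) (f : env -> R) : bmeas f -> bmeas (fun x => f (setc k u x)).
Proof.
move=> bf; apply: (bmeas_comp bf).
have := measurableT_comp (measurable_setc k) (pair1_measurable u).
by apply.
Qed.

Lemma iintS k (f : env -> R) (u : env) : iint k.+1 f u = mean (fun x => iint k f (setc k u x)).
Proof. by []. Qed.

Lemma bmeas_iint k (f : env -> R) : bmeas f -> bmeas (iint k f : env -> R).
Proof.
move=> bf; elim: k => [//|k IH].
have := @bmeas_mean R _ env (fun p : env * R => iint k f (setc k p.1 p.2)).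
by apply; apply: (bmeas_comp IH); exact: measurable_setc.
Qed.

Lemma bmeas_iint_setc k j (u : env) (f : env -> R) : bmeas f ->
  bmeas (fun x => iint k f (setc j u x)).
Proof. by move=> bf; apply: bmeas_setc; exact: bmeas_iint. Qed.

Lemma iintB k (f g : env -> R) u : bmeas f -> bmeas g ->
  iint k (fun u => f u - g u) u = iint k f u - iint k g u.
Proof.
move=> bf bg; elim: k u => [//|k IH] u; rewrite !iintS -meanB; [|exact: bmeas_iint_setc..].
by apply: eq_mean => x _; rewrite IH.
Qed.

Lemma iintD k (f g : env -> R) u : bmeas f -> bmeas g ->
  iint k (fun u => f u + g u) u = iint k f u + iint k g u.
Proof.
move=> bf bg; elim: k u => [//|k IH] u; rewrite !iintS -meanD; [|exact: bmeas_iint_setc..].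
by apply: eq_mean => x _; rewrite IH.
Qed.

Lemma iint_cst k (c : R) u : iint k (fun=> c) u = c.
Proof.
elim: k u => [//|k IH] u; rewrite iintS -[RHS]mean_cst.
by apply: eq_mean => x _; rewrite IH.
Qed.

Lemma iint_sum k (I : Type) (s : seq I) (P : pred I) (F : I -> env -> R) u :
  (forall i, P i -> bmeas (F i)) ->
  iint k (fun u => \sum_(i <- s | P i) F i u) u = \sum_(i <- s | P i) iint k (F i) u.
Proof.
move=> bF; elim: s => [|i s IH].
  under [X in iint k X]eq_fun do rewrite big_nil.
  by rewrite iint_cst big_nil.
under [X in iint k X]eq_fun do rewrite big_cons.
rewrite big_cons; case: (boolP (P i)) => // Pi; rewrite iintD// ?IH//; first exact: bF.
exact: bmeas_sum.
Qed.

Lemma iintZ k (c : R) (f : env -> R) u : bmeas f ->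
  iint k (fun u => c * f u) u = c * iint k f u.
Proof.
move=> bf; elim: k u => [//|k IH] u; rewrite !iintS -meanZ; last exact: bmeas_iint_setc.
by apply: eq_mean => x _; rewrite IH.
Qed.

Lemma eq_iint k (f g : env -> R) (u : env) :
  (forall v : env, (forall i, (i < k)%N -> v i \in I01 R) -> f v = g v) ->
  iint k f u = iint k g u.
Proof.
elim: k u f g => [|k IH] u f g fg; first by apply: fg.
rewrite !iintS; apply: eq_mean => x xI.
(* The inner integrals never touch coordinate [k], so it can be reset to [x] inside the integrand;
   this keeps the information that it lies in the unit interval. *)
have aux : forall h : env -> R, iint k h (setc k u x) =
    iint k (fun v => h (setc k v x)) (setc k u x).
  move=> h; set w := setc k u x; have : w k = x by rewrite /w /setc eqxx.
  suff: forall j (v : env), (j <= k)%N -> v k = x -> iint j h v = iint j (fun v => h (setc k v x)) v.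
    by move=> /(_ k w (leqnn k)).
  elim=> [|j IHj] v jk vk /=.
    by congr h; apply/funext => i; rewrite /setc; case: eqP => // ->.
  apply: eq_mean => y _; apply: IHj; first exact: ltnW.
  by rewrite gtn_eqF.
rewrite (aux f) (aux g); apply: IH => v vI; apply: fg => i; rewrite ltnS /setc.
by case: eqP => // /eqP ik; rewrite leq_eqVlt (negbTE ik) /= => /vI.
Qed.

Lemma ler_iint k (f g : env -> R) (u : env) : bmeas f -> bmeas g ->
  (forall v : env, f v <= g v) -> iint k f u <= iint k g u.
Proof.
move=> bf bg fg; elim: k u => [//|k IH] u; rewrite !iintS.
by apply: ler_mean; [exact: bmeas_iint_setc..|] => x _.
Qed.

Lemma ler_norm_iint k (f : env -> R) (u : env) : bmeas f ->
  `|iint k f u| <= iint k (fun v => `|f v|) u.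
Proof.
move=> bf; elim: k u => [//|k IH] u; rewrite !iintS.
apply: le_trans (ler_norm_mean _) _; first exact: bmeas_iint_setc.
apply: ler_mean; first by apply: bmeas_norm; exact: bmeas_iint_setc.
  by apply: bmeas_iint_setc; exact: bmeas_norm.
by move=> x _; exact: IH.
Qed.

Lemma iint_prod k m (h : nat -> R -> R) (u : env) : (forall i, bmeas (h i)) -> (k <= m)%N ->
  iint k (fun v => \prod_(0 <= i < m) h i (v i)) u =
  (\prod_(0 <= i < k) mean (h i)) * \prod_(k <= i < m) h i (u i).
Proof.
move=> bh; elim: k u => [|k IH] u km; first by rewrite big_geq// mul1r.
rewrite iintS big_nat_recr //=.
transitivity (mean (fun x => (\prod_(0 <= i < k) mean (h i) * \prod_(k.+1 <= i < m) h i (u i)) * h k x)).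
  apply: eq_mean => x _; rewrite IH 1?ltnW// [X in _ * X]big_ltn// {1}/setc eqxx.
  have -> : \prod_(k.+1 <= i < m) h i (setc k u x i) = \prod_(k.+1 <= i < m) h i (u i).
    by apply: eq_big_nat => i /andP[ki _]; rewrite /setc gtn_eqF.
  by ring.
by rewrite meanZ//; ring.
Qed.

Lemma iint1 k i (h : R -> R) (u : env) : bmeas h -> (i < k)%N ->
  iint k (fun v => h (v i)) u = mean h.
Proof.
move=> bh; elim: k u => [//|k IH] u; rewrite ltnS leq_eqVlt iintS => /orP[/eqP ->|ik].
  apply: eq_mean => x _.
  suff: forall j (v : env), (j <= k)%N -> v k = x -> iint j (fun v => h (v k)) v = h x.
    by apply => //; rewrite /setc eqxx.
  elim=> [|j IHj] v jk vk /=; first by rewrite vk.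
  rewrite -[RHS]mean_cst; apply: eq_mean => y _; apply: IHj; first exact: ltnW.
  by rewrite gtn_eqF.
by rewrite -[RHS]mean_cst; apply: eq_mean => x _; exact: IH.
Qed.

(** The larger coordinate is integrated outermost, whence the order [(v j, v i)]. *)
Lemma iint2 k i j (g : R * R -> R) (u : env) : bmeas g -> (i < j)%N -> (j < k)%N ->
  iint k (fun v => g (v j, v i)) u = mean2 g.
Proof.
move=> bg ij; elim: k u => [//|k IH] u; rewrite ltnS leq_eqVlt iintS => /orP[/eqP jk|jk].
  subst k; apply: eq_mean => x _.
  rewrite -(@iint1 j i (fun y => g (x, y)) (setc j u x) (bmeas_pair1 x bg) ij).
  suff: forall l (v : env), (l <= j)%N -> v j = x ->
     iint l (fun v => g (v j, v i)) v = iint l (fun v => g (x, v i)) v.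
    by apply => //; rewrite /setc eqxx.
  elim=> [|l IHl] v lj vj /=; first by rewrite vj.
  apply: eq_mean => y _; apply: IHl; first exact: ltnW.
  by rewrite gtn_eqF.
by rewrite -[RHS]mean_cst; apply: eq_mean => x _; exact: IH.
Qed.

End Env.

Lemma ler_norm_prodB (R : realFieldType) (I : Type) (s : seq I) (P : pred I) (a b : I -> R) :
  (forall i, 0 <= a i <= 1) -> (forall i, 0 <= b i <= 1) ->
  `|\prod_(i <- s | P i) a i - \prod_(i <- s | P i) b i| <= \sum_(i <- s | P i) `|a i - b i|.
Proof.
move=> a01 b01; elim: s => [|i s IH]; first by rewrite !big_nil subrr normr0.
rewrite !big_cons; case: (P i) => //.
set x := \prod_(i <- s | P i) a i in IH *; set y := \prod_(i <- s | P i) b i in IH *.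
have -> : a i * x - b i * y = (a i - b i) * x + b i * (x - y) by ring.
rewrite (le_trans (ler_normD _ _))// !normrM lerD//.
  rewrite ler_piMr// /x ger0_norm; first by apply: prodr_ile1 => j _; exact: a01.
  by apply: prodr_ge0 => j _; case/andP: (a01 j).
apply: le_trans IH; rewrite ler_piMl//; have /andP[b0 b1] := b01 i.
by rewrite ger0_norm.
Qed.

(** * Finite-valued maps on the unit interval *)

Section FiniteMaps.
Context {R : realType} (D : finType).

Definition fmeas (T : R -> D) : Prop := forall d, measurable [set x | T x = d].

Definition law (T : R -> D) (d : D) : R := mean (fun x => (T x == d)%:R).

Variable T : R -> D.
Hypothesis mT : fmeas T.

Lemma bmeas_cell d : bmeas (fun x : R => (T x == d)%:R : R).
Proof.
rewrite (_ : (fun x => _) = \1_[set x | T x = d]); first exact: bmeas_indic.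
apply/funext => x; rewrite indicE; congr (nat_of_bool _)%:R.
by apply/idP/idP => [/eqP e|]; [rewrite inE|rewrite inE => /= ->].
Qed.

Lemma bmeas_fin (h : D -> R) : bmeas (fun x : R => h (T x)).
Proof.
rewrite (_ : (fun x => _) = (fun x => \sum_d h d * (T x == d)%:R)).
  by apply: bmeas_sum => d _; apply: bmeasM; [exact: bmeas_cst|exact: bmeas_cell].
apply/funext => x; rewrite (bigD1 (T x)) //= eqxx mulr1 big1 ?addr0// => d /negbTE.
by rewrite eq_sym => ->; rewrite mulr0.
Qed.

Lemma bmeas_fin2 (h : D -> D -> R) : bmeas (fun p : R * R => h (T p.1) (T p.2)).
Proof.
rewrite (_ : (fun p => _) = (fun p => \sum_d h d (T p.2) * (T p.1 == d)%:R)).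
  apply: bmeas_sum => d _; apply: bmeasM.
    by apply: (bmeas_comp (bmeas_fin (h d))); exact: measurable_snd.
  by apply: (bmeas_comp (bmeas_cell d)); exact: measurable_fst.
apply/funext => p; rewrite (bigD1 (T p.1)) //= eqxx mulr1 big1 ?addr0// => d /negbTE.
by rewrite eq_sym => ->; rewrite mulr0.
Qed.

Lemma mean_fin (h : D -> R) : mean (fun x => h (T x)) = \sum_d law T d * h d.
Proof.
rewrite (_ : (fun x => _) = (fun x => \sum_d h d * (T x == d)%:R)).
  rewrite mean_sum => [|d _]; last by apply: bmeasM; [exact: bmeas_cst|exact: bmeas_cell].
  by apply: eq_bigr => d _; rewrite meanZ 1?mulrC//; exact: bmeas_cell.
apply/funext => x; rewrite (bigD1 (T x)) //= eqxx mulr1 big1 ?addr0// => d /negbTE.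
by rewrite eq_sym => ->; rewrite mulr0.
Qed.

Lemma mean2_fin (h : D -> D -> R) :
  mean2 (fun p => h (T p.1) (T p.2)) = \sum_x \sum_y law T x * law T y * h x y.
Proof.
rewrite /mean2 /=.
rewrite (_ : (fun x => _) = (fun x => \sum_d law T d * h (T x) d)); last first.
  by apply/funext => x; rewrite (mean_fin (h (T x))).
rewrite (mean_fin (fun x => \sum_d law T d * h x d)).
by apply: eq_bigr => x _; rewrite mulr_sumr; apply: eq_bigr => y _; rewrite mulrA.
Qed.

Lemma law_ge0 d : 0 <= law T d.
Proof. exact: mean_ge0. Qed.

Lemma law_sum1 : \sum_d law T d = 1.
Proof.
rewrite -[RHS](mean_cst 1) (mean_fin (fun=> 1)).
by apply: eq_bigr => d _; rewrite mulr1.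
Qed.

End FiniteMaps.

(** * Comparing a graphon with a step kernel *)

Section Wext.
Context {R : realType}.

(** A graphon is constrained only on the unit square; extension by 0 gives a globally bounded
    measurable function. *)
Definition wext (W : R -> R -> R) : R * R -> R := (fun p => W p.1 p.2) \_ (I01 R `*` I01 R).

Lemma wextE W x y : x \in I01 R -> y \in I01 R -> wext W (x, y) = W x y.
Proof. by move=> xI yI; rewrite /wext patchE in_setX /= xI yI. Qed.

Lemma bmeas_wext W : graphon W -> bmeas (wext W).
Proof.
move=> [mW _ W01]; split.
  apply: (measurable_restrictT _ _).1 => //; apply: measurableX; exact: measurable_I01.
exists 1 => -[x y]; rewrite /wext patchE in_setX /=.
case: ifP => [/andP[xI yI]|_]; last by rewrite normr0.
by have /andP[? ?] := W01 _ _ xI yI; rewrite ger0_norm.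
Qed.

Lemma wext01 W p : graphon W -> 0 <= wext W p <= 1.
Proof.
move=> [_ _ W01]; case: p => x y; rewrite /wext patchE in_setX /=.
by case: ifP => [/andP[xI yI]|_]; [exact: W01|rewrite lexx ler01].
Qed.

Lemma wextC W x y : graphon W -> wext W (x, y) = wext W (y, x).
Proof.
move=> [_ WC _]; rewrite /wext !patchE !in_setX /= andbC.
by case: ifP => // /andP[yI xI]; rewrite WC.
Qed.

Variables (D : finType) (T : R -> D) (wb : D -> D -> R) (W : R -> R -> R).
Hypothesis mT : fmeas T.
Hypothesis wb01 : forall x y, 0 <= wb x y <= 1.
Hypothesis wbC : forall x y, wb x y = wb y x.
Hypothesis gW : graphon W.

Definition l1dist : R := mean2 (fun p => `|wext W p - wb (T p.1) (T p.2)|).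

Lemma bmeas_l1 : bmeas (fun p : R * R => `|wext W p - wb (T p.1) (T p.2)|).
Proof. by apply: bmeas_norm; apply: bmeasB; [exact: (bmeas_wext gW)|exact: (bmeas_fin2 mT)]. Qed.

Lemma l1dist_ge0 : 0 <= l1dist.
Proof. exact: mean2_ge0. Qed.

Lemma measurable_coord2 i j : measurable_fun setT (fun u : @env R => (u i, u j)).
Proof. by apply: measurable_fun_pair; exact: measurable_coord. Qed.

(** Under Lebesgue measure the points [T (v i)] are independent of law [law T]. Expanding [K] over
    its arguments makes each term a product of functions of one coordinate. *)
Lemma iint_fin n (K : {ffun 'I_n -> D} -> R) (u : env) :
  iint n (fun v => K [ffun i : 'I_n => T (v i)]) u = fexp (law T) K.
Proof.
(* The product over [j] equal to [i] converts a natural number index into an ordinal, and is empty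
   from [n] on. *)
pose h (phi : {ffun 'I_n -> D}) (i : nat) (x : R) : R := \prod_(j : 'I_n | j == i :> nat) (T x == phi j)%:R.
have bh phi i : bmeas (h phi i) by apply: bmeas_prod => j _; exact: bmeas_cell.
have hE phi (i : 'I_n) x : h phi i x = (T x == phi i)%:R by rewrite /h (big_pred1 i).
rewrite (_ : (fun v => _) = (fun v : env => \sum_phi K phi * \prod_(0 <= i < n) h phi i (v i))); last first.
  apply/funext => v; rewrite (bigD1 [ffun i : 'I_n => T (v i)]) //=.
  rewrite big_mkord big1 ?mulr1; last by move=> i _; rewrite hE ffunE eqxx.
  rewrite big1 ?addr0// => phi /eqP nphi.
  have [i ni] : exists i : 'I_n, T (v i) != phi i.
    apply/existsP; apply: contra_notT nphi => /existsPn h'; apply/ffunP => i.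
    by rewrite ffunE; have := h' i; rewrite negbK => /eqP ->.
  by rewrite big_mkord (bigD1 i) //= hE (negbTE ni) mul0r mulr0.
have bp phi : bmeas (fun v : @env R => \prod_(0 <= i < n) h phi i (v i)).
  by apply: bmeas_prod => i _; apply: (bmeas_comp (bh phi i)); exact: measurable_coord.
rewrite iint_sum => [|phi _]; last by apply: bmeasM; [exact: bmeas_cst|exact: bp].
apply: eq_bigr => phi _; rewrite iintZ// iint_prod//.
rewrite [\prod_(n <= i < n) _]big_geq// mulr1 mulrC big_mkord; congr (_ * _); apply: eq_bigr => i _.
by rewrite /law; congr mean; apply/funext => x; rewrite hE.
Qed.

(** L1 version of the counting lemma: the difference of two products is at most the sum of the
    differences of the factors, and there are at most [n ^ 2] edges. *)
Lemma hom_dens_tfin n (F : sgraph n) :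
  `|hom_dens W F - tfin (law T) wb (val F)| <= n%:R ^+ 2 * l1dist.
Proof.
pose Q (p : 'I_n * 'I_n) := (p.1 < p.2)%N && ([set p.1; p.2]%SET \in val F).
have -> : hom_dens W F = iint n (fun v : env => \prod_(p | Q p) wext W (v p.1, v p.2)) (fun=> 0).
  apply: eq_iint => v vI; rewrite pair_big_dep /=; apply: eq_bigr => p _.
  by rewrite wextE// vI.
have -> : tfin (law T) wb (val F) =
    iint n (fun v : env => \prod_(p | Q p) wb (T (v p.1)) (T (v p.2))) (fun=> 0).
  rewrite /tfin -(iint_fin _ (fun=> 0)); apply: eq_iint => v _.
  rewrite -prod_eweight pair_big_dep /=; apply: eq_bigr => p _.
  by rewrite !ffunE.
have b1 (p : 'I_n * 'I_n) : bmeas (fun v : @env R => wext W (v p.1, v p.2)).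
  by apply: (bmeas_comp (bmeas_wext gW)); exact: measurable_coord2.
have b2 (p : 'I_n * 'I_n) : bmeas (fun v : @env R => wb (T (v p.1)) (T (v p.2))).
  exact: (bmeas_comp (bmeas_fin2 mT wb) (measurable_coord2 p.1 p.2)).
rewrite -iintB; [|by apply: bmeas_prod => p _|by apply: bmeas_prod => p _].
apply: le_trans (ler_norm_iint _ _ _) _.
  by apply: bmeasB; apply: bmeas_prod => p _.
apply: (@le_trans _ _ (iint n (fun v : env => \sum_(p | Q p)
   `|wext W (v p.1, v p.2) - wb (T (v p.1)) (T (v p.2))|) (fun=> 0))).
  apply: ler_iint => [||v].
  - by apply: bmeas_norm; apply: bmeasB; apply: bmeas_prod => p _.
  - by apply: bmeas_sum => p _; apply: bmeas_norm; apply: bmeasB.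
  - by apply: ler_norm_prodB => p; [exact: wext01|exact: wb01].
rewrite iint_sum => [|p _]; last by apply: bmeas_norm; apply: bmeasB.
apply: (@le_trans _ _ (\sum_(p : 'I_n * 'I_n) l1dist)).
  rewrite big_mkcond /=; apply: ler_sum => p _; case: ifPn => [/andP[pl _]|_]; last exact: l1dist_ge0.
  rewrite le_eqVlt; apply/orP; left; apply/eqP.
  rewrite /l1dist -(@iint2 R n p.1 p.2 _ (fun=> 0) bmeas_l1 pl (ltn_ord _)).
  by apply: eq_iint => v _; rewrite /= wextC// wbC.
by rewrite sumr_const card_prod !card_ord -[leLHS]mulr_natl natrM expr2.
Qed.

End Wext.

(** * Nested intervals coded by bit strings *)

Section MeanIndic.
Context {R : realType}.
Notation leb := (@lebesgue_measure R).

Lemma mean_indic (A : set R) : measurable A -> (mean (\1_A : R -> R))%:E = leb (A `&` I01 R).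
Proof.
move=> mA; rewrite meanE; last exact: bmeas_indic.
by rewrite integral_indic//; exact: measurable_I01.
Qed.

Lemma mean2_indic (A : set (R * R)) : measurable A ->
  (mean2 (\1_A : R * R -> R))%:E = ((leb \x leb) (A `&` (I01 R `*` I01 R)))%E.
Proof.
move=> mA; rewrite mean2E; [|exact: bmeas_indic|by move=> p; rewrite indicE].
by rewrite integral_indic//; apply: measurableX; exact: measurable_I01.
Qed.

Lemma mean_co (f : R -> R) : bmeas f -> mean f = Rintegral leb `[0, 1[%classic f.
Proof.
move=> bf; rewrite /mean /I01 -Rintegral_itv_bndo_bndc//.
apply: integrableS (bmeas_integrable bf); [exact: measurable_I01|exact: measurable_itv|].
by move=> x; rewrite /I01 /= !in_itv /= => /andP[h1 h2]; rewrite h1 ltW.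
Qed.

Lemma mean_itv_le (a b : R) : a <= b -> mean (\1_(`[a, b]%classic) : R -> R) <= b - a.
Proof.
move=> ab; rewrite -lee_fin mean_indic//.
apply: (@le_trans _ _ (leb `[a, b]%classic)).
  by apply: le_measure; rewrite ?inE//; apply: measurableI => //; exact: measurable_I01.
by rewrite lebesgue_measure_itv /= lte_fin; case: ltP => // _; rewrite lee_fin subr_ge0.
Qed.

End MeanIndic.

(* Bit strings are stored most recent bit first, so truncation is [behead]/[drop]. *)
Record bitmass (R : realFieldType) (p : seq bool -> R) : Prop := BitMass {
  bm_ge0 : forall X, 0 <= p X;
  bm_nil : p [::] = 1;
  bm_split : forall X, p X = p (false :: X) + p (true :: X) }.

Section Digits.
Context {R : realType} (p : seq bool -> R).

(** Left end of the interval coded by [X]: the two children split the parent interval, [false] on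
    the left. *)
Fixpoint ell (X : seq bool) : R :=
  if X is b :: X' then ell X' + (if b then p (false :: X') else 0) else 0.

(** Digits of [x] relative to the masses [p], for the half-open intervals starting at [ell X] of
    length [p X]. *)
Fixpoint pre (k : nat) (x : R) : seq bool :=
  if k is k'.+1 then (ell (pre k' x) + p (false :: pre k' x) <= x) :: pre k' x else [::].

Lemma size_pre k x : size (pre k x) = k.
Proof. by elim: k => //= k ->. Qed.

Definition pret k x : k.-tuple bool := Tuple (introT eqP (size_pre k x)).

Lemma drop_pre k j x : drop j (pre (j + k) x) = pre k x.
Proof. by elim: j => //=; rewrite drop0. Qed.

Hypothesis bp : bitmass p.

Lemma ell_ge0 X : 0 <= ell X.
Proof. by elim: X => //= b X IH; rewrite addr_ge0//; case: b => //; exact: bm_ge0. Qed.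

Lemma ell_le1 X : ell X + p X <= 1.
Proof.
elim: X => /= [|b X IH]; first by rewrite bm_nil// add0r.
apply: le_trans IH; rewrite (bm_split bp X).
by case: b; have := bm_ge0 bp (true :: X); lra.
Qed.

Lemma pre_eq k x X : 0 <= x < 1 -> size X = k -> (pre k x == X) = (ell X <= x < ell X + p X).
Proof.
move=> x01; elim: k X => [|k IH] [|b X] //=.
  by rewrite bm_nil// add0r x01.
move=> [sX]; rewrite eqseq_cons andbC.
have [e|ne] := eqVneq (pre k x) X.
  rewrite e /=; move: (IH _ sX); rewrite e eqxx => /esym/andP[h1 h2].
  move: h2; rewrite (bm_split bp X) => h2; case: b => /=.
    by rewrite eqb_id -addrA h2 andbT.
  by rewrite eqbF_neg -ltNge addr0 h1.
rewrite /=; move: (IH _ sX); rewrite (negbTE ne) => /esym h; apply/esym; apply: contraFF h.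
rewrite (bm_split bp X); have := bm_ge0 bp (false :: X); have := bm_ge0 bp (true :: X).
by case: b => /= ? ? /andP[? ?]; apply/andP; split; lra.
Qed.

Lemma pre_in k x : 0 <= x < 1 -> ell (pre k x) <= x < ell (pre k x) + p (pre k x).
Proof. by move=> x01; rewrite -(@pre_eq k)// size_pre. Qed.

(** The weak upper bound includes [x = 1], which belongs to no half-open interval. *)
Lemma pre_bounds k x : x \in I01 R -> ell (pre k x) <= x <= ell (pre k x) + p (pre k x).
Proof.
rewrite inE /I01 /= in_itv /= => /andP[x0]; rewrite le_eqVlt => /orP[/eqP -> {x x0}|x1]; last first.
  have /andP[? ?] := @pre_in k x (introT andP (conj x0 x1)).
  by apply/andP; split => //; exact: ltW.
elim: k => /= [|k /andP[IH1 IH2]]; first by rewrite bm_nil// add0r ler01 lexx.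
move: IH2; rewrite (bm_split bp (pre k 1)); move=> IH2.
by case: (leP (ell (pre k 1) + p (false :: pre k 1)) 1) => h /=; apply/andP; split; lra.
Qed.

Lemma measurable_pre k X : measurable [set x | pre k x = X].
Proof.
elim: k X => [|k IH] X /=.
  case: X => [|b X]; first by rewrite (_ : [set _ | _] = setT)//; apply/seteqP; split.
  by rewrite (_ : [set _ | _] = set0)//; apply/seteqP; split.
case: X => [|b X]; first by rewrite (_ : [set _ | _] = set0)//; apply/seteqP; split.
rewrite (_ : [set _ | _] = [set x | pre k x = X] `&`
   (if b then `[ell X + p (false :: X), +oo[%classic else `]-oo, ell X + p (false :: X)[%classic)).
  by apply: measurableI => //; case: b; exact: measurable_itv.
apply/seteqP; split => x /=.
  move=> [<- <-]; split=> //.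
  by case: (leP (ell (pre k x) + p (false :: pre k x)) x) => h /=; rewrite in_itv /= ?andbT.
move=> [<-]; case: b; rewrite /= in_itv /= ?andbT => h; first by rewrite h.
by rewrite leNgt h.
Qed.

Lemma fmeas_pret k : fmeas (pret k).
Proof.
move=> X; rewrite (_ : [set _ | _] = [set x | pre k x = tval X]); first exact: measurable_pre.
by apply/seteqP; split => x /= h; [rewrite -h|apply: val_inj].
Qed.

(** [pre_eq] describes the cell only for [x < 1], so the endpoint is first discarded by
    [mean_co]. *)
Lemma law_pret k (X : k.-tuple bool) : law (pret k) X = p X.
Proof.
have bX : bmeas (fun x : R => (pret k x == X)%:R : R) by exact: (bmeas_cell (@fmeas_pret k)).
rewrite /law mean_co//.
rewrite (_ : Rintegral _ _ _ = fine (lebesgue_measure `[ell X, ell X + p X[%classic)).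
  rewrite lebesgue_measure_itv /= lte_fin; case: ltP => /= h; first by rewrite addrC addKr.
  by have := bm_ge0 bp X; lra.
transitivity (Rintegral (@lebesgue_measure R) `[0, 1[%classic
   (\1_(`[ell X, ell X + p X[%classic) : R -> R)); last first.
  rewrite /Rintegral integral_indic//; congr fine; congr (_ _); apply/setIidPl => x /=.
  rewrite !in_itv /= => /andP[h1 h2]; have := ell_ge0 X; have := ell_le1 X.
  by move=> ? ?; apply/andP; split; lra.
apply: eq_Rintegral => x; rewrite inE /= in_itv /= => x01.
rewrite [RHS](_ : _ = (x \in `[ell X, ell X + p X[%classic)%:R) ?indicE//; congr (nat_of_bool _)%:R.
rewrite -val_eqE /= (pre_eq x01) ?size_tuple//.
by apply/idP/idP => [h|]; [rewrite inE /= in_itv|rewrite inE /= in_itv].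
Qed.

End Digits.

(** * Dyadic approximation of graphons *)

Lemma dist_orb (R : realFieldType) (a b s t : bool) :
  `|(a || b)%:R - (s || t)%:R| <= `|a%:R - s%:R| + `|b%:R - t%:R| :> R.
Proof.
by case: a; case: b; case: s; case: t; rewrite /= ?subrr ?subr0 ?sub0r ?normrN ?normr0 ?normr1; lra.
Qed.

Lemma cvg_from_below (R : realType) (u : nat -> R) (l e : R) :
  u @ \oo --> l -> 0 < e -> exists n, l - u n < e.
Proof.
move=> /cvgr_gt cu e0; have [|n _ hn] := cu (l - e); first by rewrite ltrBlDr ltrDl.
by exists n; have := hn n (leqnn n); rewrite /= ltrBlDr ltrBlDl.
Qed.

Section Dyadic.
Context {R : realType}.
Notation leb := (@lebesgue_measure R).

Definition dmass (X : seq bool) : R := 2^-1 ^+ size X.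

Lemma bitmass_dmass : bitmass dmass.
Proof.
split=> [X||X]; first by rewrite exprn_ge0// invr_ge0.
  by rewrite /dmass expr0.
by rewrite /dmass /= exprS; field.
Qed.

Notation dpre := (pre dmass).

Lemma half_expn_lt (e : R) : 0 < e -> exists k, 2^-1 ^+ k < e.
Proof.
move=> e0; have h : (fun n => (2^-1 : R) ^+ n) @ \oo --> (0 : R).
  by apply: cvg_expr; rewrite ger0_norm ?invr_ge0// invf_lt1 ?ltr1n.
move/cvgr_lt : h => /(_ _ e0)[k _ hk]; exists k; exact: hk (leqnn k).
Qed.

Lemma bmeas_dfin p k (h : seq bool -> seq bool -> R) :
  bmeas (fun q : R * R => h (pre p k q.1) (pre p k q.2)).
Proof. exact: (@bmeas_fin2 R _ (pret p k) (@fmeas_pret R p k) (fun X Y => h X Y)). Qed.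

Definition stepapprox (g : R * R -> R) (e : R) (k : nat) (w : seq bool -> seq bool -> R) : Prop :=
  mean2 (fun q => `|g q - w (dpre k q.1) (dpre k q.2)|) <= e.

(** Measurable sets approximable in L1 by unions of dyadic squares. These form a sigma-algebra that
    contains the rectangles, hence every measurable set belongs to it. *)
Definition aset (A : set (R * R)) : Prop :=
  measurable A /\ forall e : R, 0 < e -> exists k (S : seq bool -> seq bool -> bool),
     stepapprox (\1_A : R * R -> R) e k (fun X Y => (S X Y)%:R).

Lemma bmeas_err (A : set (R * R)) k (w : seq bool -> seq bool -> R) : measurable A ->
  bmeas (fun q : R * R => `|\1_A q - w (dpre k q.1) (dpre k q.2)|).
Proof.
move=> mA; apply: bmeas_norm; apply: bmeasB; [exact: bmeas_indic|exact: bmeas_dfin].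
Qed.

Lemma aset0 : aset set0.
Proof.
split=> // e e0; exists 0%N, (fun _ _ => false); rewrite /stepapprox.
rewrite (_ : (fun q => _) = (fun=> 0)) ?mean2_cst ?ltW//.
by apply/funext => q; rewrite indic0 subrr normr0.
Qed.

Lemma asetC A : aset A -> aset (~` A).
Proof.
move=> [mA hA]; split=> [|e e0]; first exact: measurableC.
have [k [S hS]] := hA e e0; exists k, (fun X Y => ~~ S X Y).
rewrite /stepapprox in hS *.
rewrite (_ : (fun q => _) = (fun q => `|\1_A q - (S (dpre k q.1) (dpre k q.2))%:R|))//.
apply/funext => q; rewrite !indicE in_setC; case: (q \in A); case: (S _ _) => /=;
  by rewrite ?subrr ?subr0 ?sub0r ?normrN ?normr0.
Qed.

Lemma asetU A B : aset A -> aset B -> aset (A `|` B).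
Proof.
move=> [mA hA] [mB hB]; split=> [|e e0]; first exact: measurableU.
have e20 : 0 < e / 2 by rewrite divr_gt0.
have [k [S hS]] := hA _ e20; have [l [S' hS']] := hB _ e20.
rewrite /stepapprox in hS hS'.
exists (k + l)%N, (fun X Y => S (drop l X) (drop l Y) || S' (drop k X) (drop k Y)).
have dk x : drop l (dpre (k + l) x) = dpre k x by rewrite addnC drop_pre.
rewrite /stepapprox.
apply: (@le_trans _ _ (mean2 (fun q : R * R => `|\1_A q - (S (dpre k q.1) (dpre k q.2))%:R| +
   `|\1_B q - (S' (dpre l q.1) (dpre l q.2))%:R|))); last first.
  rewrite mean2D; [|exact: (bmeas_err k (fun X Y => (S X Y)%:R) mA)
     |exact: (bmeas_err l (fun X Y => (S' X Y)%:R) mB)].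
  rewrite (splitr e); exact: (lerD hS hS').
apply: ler_mean2.
- exact: (bmeas_err (k + l) (fun X Y => (S (drop l X) (drop l Y) || S' (drop k X) (drop k Y))%:R) (measurableU _ _ mA mB)).
- by apply: bmeasD; [exact: (bmeas_err k (fun X Y => (S X Y)%:R) mA)
     |exact: (bmeas_err l (fun X Y => (S' X Y)%:R) mB)].
- by move=> x y _ _ /=; rewrite !dk !drop_pre !indicE in_setU; exact: dist_orb.
Qed.

(** By continuity from below a finite partial union already has almost the full measure; half of [e]
    pays for this truncation, half for approximating the finite union. *)
Lemma aset_bigcup (F : (set (R * R))^nat) : (forall n, aset (F n)) -> aset (\bigcup_n F n).
Proof.
move=> hF; have mF n : measurable (F n) by case: (hF n).
split=> [|e e0]; first exact: bigcupT_measurable.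
pose G n := \big[setU/set0]_(i < n) F i.
have aG n : aset (G n).
  rewrite /G; elim: n => [|n IH]; first by rewrite big_ord0; exact: aset0.
  rewrite big_ord_recr; exact: (asetU IH (hF n)).
have mG n : measurable (G n) by case: (aG n).
have mU : measurable (\bigcup_n F n) by exact: bigcupT_measurable.
have ndG : nondecreasing_seq (fun n => G n `&` (I01 R `*` I01 R)).
  move=> m n mn; apply/subsetPset; apply: setSI; apply: subset_bigsetU => //.
have bG : \bigcup_n (G n `&` (I01 R `*` I01 R)) = (\bigcup_n F n) `&` (I01 R `*` I01 R).
  rewrite -setI_bigcupl; congr (_ `&` _); apply/seteqP; split => q.
    by move=> [n _]; rewrite /G -bigcup_mkord => -[i _ Fi]; exists i.
  by move=> [i _ Fi]; exists i.+1 => //; rewrite /G -bigcup_mkord; exists i => /=.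
have mI2 : measurable (I01 R `*` I01 R) by apply: measurableX; exact: measurable_I01.
have cv : (fun n => (mean2 (\1_(G n) : R * R -> R))%:E) @ \oo --> (mean2 (\1_(\bigcup_n F n) : R * R -> R))%:E.
  rewrite (mean2_indic mU) -bG.
  rewrite (_ : (fun n => _) = (leb \x leb)%E \o (fun n => G n `&` (I01 R `*` I01 R))); last first.
    by apply/funext => n; exact: (mean2_indic (mG n)).
  apply: nondecreasing_cvg_mu; last exact: ndG.
    by move=> n; exact: (measurableI _ _ (mG n) mI2).
  rewrite bG; exact: (measurableI _ _ mU mI2).
have cv' : (fun n => mean2 (\1_(G n) : R * R -> R)) @ \oo --> mean2 (\1_(\bigcup_n F n) : R * R -> R).
  exact: (fine_cvg cv).
have e20 : 0 < e / 2 by rewrite divr_gt0.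
have [n hn] : exists n, mean2 (\1_(\bigcup_n F n) : R * R -> R) - mean2 (\1_(G n) : R * R -> R) < e / 2.
  exact: (cvg_from_below cv' e20).
have [_ hG] := aG n.
have [k [S hS]] := hG _ e20; exists k, S; rewrite /stepapprox.
apply: (@le_trans _ _ (mean2 (fun q : R * R => (\1_(\bigcup_n F n) q - \1_(G n) q) +
    `|\1_(G n) q - (S (dpre k q.1) (dpre k q.2))%:R|))).
  apply: ler_mean2.
  - exact: (bmeas_err k (fun X Y => (S X Y)%:R) mU).
  - apply: bmeasD; last exact: (bmeas_err k (fun X Y => (S X Y)%:R) (mG n)).
    by apply: bmeasB; exact: bmeas_indic.
  - move=> x y _ _ /=.
    have h : \1_(G n) (x, y) <= \1_(\bigcup_n F n) (x, y) :> R.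
      rewrite !indicE ler_nat; case: (boolP (_ \in G n)) => //; rewrite inE => Gxy.
      rewrite (_ : (x, y) \in \bigcup_n F n)// inE.
      by move: Gxy; rewrite /G -bigcup_mkord => -[i _ Fi]; exists i.
    rewrite -[leRHS](_ : `|\1_(\bigcup_n F n) (x, y) - \1_(G n) (x, y)| + `|\1_(G n) (x, y) -
      (S (dpre k x) (dpre k y))%:R| = _); first exact: ler_distD.
    by rewrite ger0_norm// subr_ge0.
rewrite mean2D; last 2 first.
  by apply: bmeasB; exact: bmeas_indic.
  exact: (bmeas_err k (fun X Y => (S X Y)%:R) (mG n)).
rewrite (splitr e); apply: lerD; last exact: hS.
have -> : mean2 (fun q : R * R => \1_(\bigcup_n F n) q - \1_(G n) q) =
   mean2 (\1_(\bigcup_n F n) : R * R -> R) - mean2 (\1_(G n) : R * R -> R); last exact: ltW.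
rewrite -mulN1r -mean2Z; last exact: bmeas_indic.
rewrite -mean2D; [|exact: bmeas_indic|by apply: bmeasM; [exact: bmeas_cst|exact: bmeas_indic]].
by congr mean2; apply/funext => q; rewrite mulN1r.
Qed.

End Dyadic.

Section GraphonApproximation.
Context {R : realType}.
Notation leb := (@lebesgue_measure R).
Notation dpre := (pre (@dmass R)).

(** Stated for any [f] commuting with the set operations, to serve both preimages under [fst] and
    the identity on subsets of the plane. *)
Lemma sigma_algebra_aset (T : pointedType) (f : set T -> set (R * R)) :
  f set0 = set0 -> (forall A, f (~` A) = ~` (f A)) ->
  (forall F : (set T)^nat, f (\bigcup_n F n) = \bigcup_n f (F n)) ->
  sigma_algebra setT [set A | aset (f A)].
Proof.
move=> f0 fC fU; split => /=; first by rewrite f0; exact: aset0.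
  by move=> A hA; rewrite setTD fC; exact: asetC.
by move=> F hF; rewrite fU; exact: aset_bigcup.
Qed.

(** Comparing [a] with the left end of the dyadic interval of [x] instead of with [x] errs only when
    [x] is within [2^-k] to the right of [a]. *)
Lemma aset_ray (a : R) : aset (fst @^-1` `[a, +oo[%classic).
Proof.
have mA : measurable (fst @^-1` `[a, +oo[%classic : set (R * R)).
  by rewrite -[X in measurable X]setTI; apply: measurable_fst.
split=> // e e0; have [k hk] := half_expn_lt e0.
exists k, (fun X _ => a <= ell (@dmass R) X); rewrite /stepapprox.
apply: le_trans (ltW hk).
have ak : a <= a + 2^-1 ^+ k by rewrite lerDl exprn_ge0// invr_ge0.
apply: le_trans (_ : a + 2^-1 ^+ k - a <= _); last by rewrite addrC addKr.
apply: le_trans (mean_itv_le ak).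
have bI : bmeas (\1_(`[a, (a + 2^-1 ^+ k)]%classic) : R -> R) by exact: bmeas_indic.
have -> : mean (\1_(`[a, (a + 2^-1 ^+ k)]%classic) : R -> R) =
   mean2 (fun q : R * R => \1_(`[a, (a + 2^-1 ^+ k)]%classic) q.1).
  by rewrite /mean2 /=; apply: eq_mean => x _; rewrite mean_cst.
apply: ler_mean2.
- exact: (bmeas_err k (fun X _ => (a <= ell (@dmass R) X)%R%:R) mA).
- by apply: (bmeas_comp bI); exact: measurable_fst.
- move=> x y xI yI /=; rewrite !indicE.
  have -> : ((x, y) \in fst @^-1` `[a, +oo[%classic) = (a <= x).
    by apply/idP/idP; rewrite inE /= in_itv /= andbT.
  have -> : (x \in `[a, a + 2^-1 ^+ k]%classic) = (a <= x <= a + 2^-1 ^+ k).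
    by apply/idP/idP; rewrite inE /= in_itv.
  have := pre_bounds bitmass_dmass k xI; rewrite [dmass (pre _ _ _)]/dmass size_pre => /andP[h1 h2].
  case: (leP a (ell (@dmass R) (dpre k x))) => h3.
    by rewrite (le_trans h3 h1) subrr normr0.
  case: (leP a x) => h4 /=; last by rewrite subrr normr0.
  rewrite subr0 normr1 (_ : x <= a + 2^-1 ^+ k)//.
  by apply: le_trans h2 _; rewrite lerD2r ltW.
Qed.

Lemma aset_fst (A : set R) : measurable A -> aset (fst @^-1` A).
Proof.
have sa : sigma_algebra setT [set A : set R | aset (fst @^-1` A)].
  apply: sigma_algebra_aset => [|B|F]; [exact: preimage_set0|exact: preimage_setC|].
  exact: preimage_bigcup.
have := @smallest_sub _ _ (@RGenCInfty.G R) _ sa; rewrite /= => h.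
move=> mA; apply: h; last by rewrite -[X in X A](@RGenCInfty.measurableE R).
by move=> _ [x ->] /=; exact: aset_ray.
Qed.

Lemma aset_swap (A : set (R * R)) : aset A -> aset (unstable.swap @^-1` A).
Proof.
move=> [mA hA]; have mA' : measurable (unstable.swap @^-1` A).
  by rewrite -[X in measurable X]setTI; apply: measurable_swap.
split=> // e e0; have [k [S hS]] := hA e e0.
exists k, (fun X Y => S Y X); rewrite /stepapprox in hS *.
have := mean2C (bmeas_err k (fun X Y => (S X Y)%:R) mA) (fun q => normr_ge0 _).
move=> h; rewrite -h in hS.
rewrite (_ : (fun q => _) = (fun q : R * R => `|\1_A (q.2, q.1) - (S (dpre k q.2) (dpre k q.1))%:R|))//.
Qed.

Lemma aset_measurable (A : set (R * R)) : measurable A -> aset A.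
Proof.
have sa : sigma_algebra setT [set A : set (R * R) | aset A].
  exact: (@sigma_algebra_aset (R * R)%type id).
rewrite measurable_prod_measurableType; apply: (smallest_sub sa).
move=> _ [C mC [B mB <-]] /=.
rewrite (_ : C `*` B = ~` (~` (fst @^-1` C) `|` ~` (unstable.swap @^-1` (fst @^-1` B)))).
  apply: asetC; apply: asetU; apply: asetC; first exact: aset_fst.
  by apply: aset_swap; exact: aset_fst.
by rewrite setCU !setCK; apply/seteqP; split => -[x y].
Qed.

Lemma floor_sum (N : nat) (y : R) : 0 <= y <= N%:R ->
  y - 1 <= \sum_(j < N) (j.+1%:R <= y)%R%:R <= y.
Proof.
elim: N => [|N IH] /andP[y0 yN].
  by rewrite big_ord0; apply/andP; split; lra.
rewrite big_ord_recr /=; have [yN'|yN'] := leP y N%:R.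
  rewrite (_ : (N.+1%:R <= y) = false) ?addr0; last first.
    by apply/negbTE; rewrite -ltNge (le_lt_trans yN')// ltr_nat.
  by apply: IH; rewrite y0.
rewrite (eq_bigr (fun=> 1)); last first.
  by move=> j _; rewrite (_ : j.+1%:R <= y)// (le_trans _ (ltW yN'))// ler_nat.
rewrite sumr_const card_ord; move: yN; rewrite -natr1 => yN.
case: (leP (N%:R + 1) y) => h /=; apply/andP; split; lra.
Qed.

(** Layer cake: [g] is within [1 / N] of the average of the indicators of its [N] superlevel sets
    ([floor_sum]), and each of these is approximable. *)
Lemma dyadic_approx_fun (g : R * R -> R) (e : R) : bmeas g -> (forall q, 0 <= g q <= 1) -> 0 < e ->
  exists k (w : seq bool -> seq bool -> R),
    (forall X Y, 0 <= w X Y <= 1) /\ stepapprox g e k w.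
Proof.
move=> bg g01 e0.
(* Makes the rounding error [1 / N] at most [e / 2]; the other half goes to the superlevel sets. *)
pose N := (Num.bound (2 / e)).+1.
have N0 : 0 < N%:R :> R by rewrite ltr0n.
have Ne : N%:R^-1 <= e / 2.
  rewrite -[e / 2]invrK lef_pV2 ?posrE ?invr_gt0 ?divr_gt0// invfM invrK mulrC.
  apply: le_trans (ltW (archi_boundP _)) _; first by rewrite divr_ge0// ltW.
  by rewrite ler_nat.
pose L (j : 'I_N) : set (R * R) := [set q | j.+1%:R <= N%:R * g q].
have mL j : measurable (L j).
  rewrite (_ : L j = (fun q => N%:R * g q) @^-1` `[j.+1%:R, +oo[%classic); last first.
    by apply/seteqP; split => q /=; rewrite in_itv /= andbT.
  rewrite -[X in measurable X]setTI; case: bg => mg _.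
  by apply: (measurable_funM (measurable_cst _) mg).
have aL j : exists kS : nat * (seq bool -> seq bool -> bool),
    stepapprox (\1_(L j) : R * R -> R) (e / 2) kS.1 (fun X Y => (kS.2 X Y)%:R).
  have [_ h] := aset_measurable (mL j).
  have [|k [S hS]] := h (e / 2); first by rewrite divr_gt0.
  by exists (k, S).
have [kS hkS] := choice aL.
pose K := \max_(j < N) (kS j).1.
have kK j : ((kS j).1 <= K)%N by exact: leq_bigmax.
pose w X Y : R := N%:R^-1 * \sum_(j < N) ((kS j).2 (drop (K - (kS j).1) X) (drop (K - (kS j).1) Y))%:R.
have wE x y : w (dpre K x) (dpre K y) =
   N%:R^-1 * \sum_(j < N) ((kS j).2 (dpre (kS j).1 x) (dpre (kS j).1 y))%:R.
  have dK j z : drop (K - (kS j).1) (dpre K z) = dpre (kS j).1 z.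
    by rewrite -[X in pre _ X _](subnK (kK j)) drop_pre.
  by congr (_ * _); apply: eq_bigr => j _; rewrite !dK.
exists K, w; split.
  move=> X Y; rewrite /w mulr_ge0 ?invr_ge0 ?(ltW N0) ?sumr_ge0//=.
  rewrite [leLHS]mulrC ler_pdivrMr// mul1r.
  apply: (@le_trans _ _ (\sum_(j < N) 1)); last by rewrite sumr_const card_ord.
  by apply: ler_sum => j _; case: ((kS j).2 _ _); rewrite ?ler01.
rewrite /stepapprox.
pose er (j : 'I_N) (q : R * R) : R := `|\1_(L j) q - ((kS j).2 (dpre (kS j).1 q.1) (dpre (kS j).1 q.2))%:R|.
have ber j : bmeas (er j) by exact: (bmeas_err _ (fun X Y => ((kS j).2 X Y)%:R) (mL j)).
apply: (@le_trans _ _ (mean2 (fun q => e / 2 + N%:R^-1 * \sum_(j < N) er j q))).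
  apply: ler_mean2.
  - by apply: bmeas_norm; apply: bmeasB => //; exact: bmeas_dfin.
  - apply: bmeasD; first exact: bmeas_cst.
    by apply: bmeasM; [exact: bmeas_cst|apply: bmeas_sum => j _; exact: ber].
  - move=> x y _ _ /=; rewrite wE; set q := (x, y).
    have /andP[s1 s2] : N%:R * g q - 1 <= \sum_(j < N) (\1_(L j) q : R) <= N%:R * g q.
      rewrite (eq_bigr (fun j : 'I_N => (j.+1%:R <= N%:R * g q)%R%:R)); last first.
        move=> j _; rewrite indicE; congr (nat_of_bool _)%:R.
        by apply/idP/idP; rewrite inE.
      apply: floor_sum; have /andP[g0 g1] := g01 q.
      by rewrite mulr_ge0 ?(ltW N0)//= ler_piMr// ltW.
    have -> : g q - N%:R^-1 * \sum_(j < N) ((kS j).2 (dpre (kS j).1 x) (dpre (kS j).1 y))%:R =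
       N%:R^-1 * (N%:R * g q - \sum_(j < N) (\1_(L j) q : R)) +
       N%:R^-1 * \sum_(j < N) (\1_(L j) q - ((kS j).2 (dpre (kS j).1 x) (dpre (kS j).1 y))%:R).
      by rewrite sumrB -mulrDr; field; rewrite gt_eqF.
    rewrite (le_trans (ler_normD _ _))// !normrM ger0_norm ?invr_ge0 ?(ltW N0)//.
    apply: lerD.
      apply: le_trans Ne; rewrite ler_piMr ?invr_ge0 ?(ltW N0)// ler_norml.
      by apply/andP; split; lra.
    by rewrite ler_wpM2l ?invr_ge0 ?(ltW N0)//; exact: ler_norm_sum.
rewrite mean2D; [|exact: bmeas_cst|by apply: bmeasM; [exact: bmeas_cst|apply: bmeas_sum => j _; exact: ber]].
rewrite mean2_cst mean2Z; last by apply: bmeas_sum => j _; exact: ber.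
rewrite {2}(splitr e) lerD2l mulrC ler_pdivrMr//.
have -> : mean2 (fun q => \sum_(j < N) er j q) = \sum_(j < N) mean2 (er j).
  rewrite /mean2 -mean_sum; last by move=> j _; exact: bmeas_mean.
  by apply: eq_mean => x _; rewrite mean_sum// => j _; exact: bmeas_pair1.
rewrite mulrC mulr_natl -[X in _ *+ X]card_ord -sumr_const.
by apply: ler_sum => j _; exact: hkS.
Qed.

(** A step function is averaged with its transpose; as the graphon is symmetric, this does not
    increase the L1 error. *)
Lemma graphon_dyadic_approx (W : R -> R -> R) (e : R) : graphon W -> 0 < e ->
  exists k (w : seq bool -> seq bool -> R), [/\ (forall X Y, 0 <= w X Y <= 1),
     (forall X Y, w X Y = w Y X) & stepapprox (wext W) e k w].
Proof.
move=> gW e0.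
have bW := bmeas_wext gW.
have [k [w [w01 hw]]] := dyadic_approx_fun bW (fun q => wext01 q gW) e0.
exists k, (fun X Y => (w X Y + w Y X) / 2); split.
- move=> X Y; have /andP[? ?] := w01 X Y; have /andP[? ?] := w01 Y X.
  by apply/andP; split; lra.
- by move=> X Y; rewrite addrC.
rewrite /stepapprox in hw *.
pose f (q : R * R) := `|wext W q - w (dpre k q.1) (dpre k q.2)|.
have bf : bmeas f by apply: bmeas_norm; apply: bmeasB => //; exact: bmeas_dfin.
have bf' : bmeas (fun q : R * R => f (q.2, q.1)) by apply: (bmeas_comp bf); exact: measurable_swap.
apply: (@le_trans _ _ (mean2 (fun q => 2^-1 * (f q + f (q.2, q.1))))).
  apply: ler_mean2.
  - apply: bmeas_norm; apply: bmeasB => //.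
    exact: (bmeas_dfin _ k (fun X Y => (w X Y + w Y X) / 2)).
  - by apply: bmeasM; [exact: bmeas_cst|exact: bmeasD].
  - move=> x y _ _; rewrite /f /= (wextC y x gW).
    set a := wext W (x, y); set b := w _ _; set c := w _ _.
    have -> : a - (b + c) / 2 = 2^-1 * ((a - b) + (a - c)) by field.
    by rewrite normrM ger0_norm ?invr_ge0// ler_wpM2l ?invr_ge0// ler_normD.
rewrite mean2Z; last exact: bmeasD.
rewrite mean2D// mean2C//; last by move=> q; exact: normr_ge0.
by rewrite -[leRHS]mulr1 -/f in hw *; lra.
Qed.

End GraphonApproximation.

(** * Densities of a graphon *)

Lemma is_sgraphE n (E : {set {set 'I_n}}) : is_sgraph E = (E \subset pairs n).
Proof.
apply/forall_inP/fintype.subsetP => h e eE; last by have := h e eE; rewrite inE.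
by rewrite inE; exact: h.
Qed.

Lemma sgraph_pairs n (G : sgraph n) : val G \subset pairs n.
Proof. by rewrite -is_sgraphE; exact: valP. Qed.

Lemma is_sgraph0 n : is_sgraph (finset.set0 : {set {set 'I_n}}).
Proof. by rewrite is_sgraphE finset.sub0set. Qed.

(** Edge sets that are not sets of pairs are sent to the edgeless graph. *)
Definition mksg n (E : {set {set 'I_n}}) : sgraph n := insubd (Sub finset.set0 (is_sgraph0 n) : sgraph n) E.

Lemma val_mksg n (E : {set {set 'I_n}}) : E \subset pairs n -> val (mksg E) = E.
Proof. by move=> EA; rewrite /mksg val_insubd is_sgraphE EA. Qed.

Lemma mksgK n (G : sgraph n) : mksg (val G) = G.
Proof. by apply: val_inj; rewrite val_mksg ?sgraph_pairs. Qed.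

Lemma sum_sgraph (R : nmodType) n (P : pred {set {set 'I_n}}) (F : sgraph n -> R) :
  \sum_(B : sgraph n | P (val B)) F B =
  \sum_(B : {set {set 'I_n}} | P B && (B \subset pairs n)) F (mksg B).
Proof.
rewrite [RHS](reindex_onto (fun B : sgraph n => val B) (@mksg n)) /=; last first.
  by move=> B /andP[_]; exact: val_mksg.
by apply: eq_big => [B|B _]; rewrite ?mksgK// sgraph_pairs eqxx !andbT.
Qed.

Definition gext (R : realType) (rho : graph_fun R) n (E : {set {set 'I_n}}) : R := rho n (mksg E).

Lemma bfp_gcharacter (R : realType) (rho : graph_fun R) : bfp_character rho -> gcharacter (gext rho).
Proof.
move=> [riso [r0 rdu] _ rpos]; split.
- move=> n m f E fbij EA; apply/esym; apply: (riso n m _ _ f) => //.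
  by rewrite !val_mksg ?imset_pairs//; exact: bij_inj.
- move=> n m E F EA FA; apply: rdu.
  by rewrite /dunion_edges !val_mksg ?dunion_pairs.
- exact: r0.
- move=> n E EA; have := rpos n (mksg E).
  rewrite (@sum_sgraph R n (fun B => val (mksg E) \subset B)) val_mksg//.
  by congr (0 <= _); apply: eq_bigr => B /andP[_ BA]; rewrite val_mksg.
Qed.

Lemma no_isolated_covers n (F : sgraph n) : no_isolated F <-> covers (val F).
Proof.
split; first by move=> /forallP h i; have /exists_inP[e eF ie] := h i; exists e.
by move=> h; apply/forallP => i; apply/exists_inP; have [e eF ie] := h i; exists e.
Qed.

Lemma graph_core n (E : {set {set 'I_n}}) : E \subset pairs n ->
  exists m (f : 'I_m -> 'I_n) (E' : {set {set 'I_m}}),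
    [/\ injective f, E' \subset pairs m, covers E' & E = [set f @: (e : {set 'I_m}) | e in E']%SET].
Proof.
move=> EA; pose N := finset.cover E.
pose f (i : 'I_#|N|) : 'I_n := enum_val i.
have finj : injective f by exact: enum_val_inj.
have fK (e : {set 'I_n}) : e \in E -> f @: (f @^-1: e)%SET = e.
  move=> eE; apply/finset.setP => x; apply/imsetP/idP => [[i + ->]|xe]; first by rewrite inE.
  have xN : x \in N by apply/finset.bigcupP; exists e.
  by exists (enum_rank_in xN x); rewrite ?inE /f enum_rankK_in.
exists #|N|, f, [set (f @^-1: e)%SET | e : {set 'I_n} in E]%SET; split => //.
- apply/fintype.subsetP => _ /imsetP[e eE ->]; rewrite inE -(card_imset _ finj) fK//.
  by have := fintype.subsetP EA _ eE; rewrite inE.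
- move=> i; have /finset.bigcupP[e eE ie] := enum_valP i.
  by exists (f @^-1: e)%SET; rewrite ?inE//; apply/imsetP; exists e.
- apply/finset.setP => e; apply/idP/imsetP => [eE|[_ /imsetP[e' e'E ->] ->]]; last by rewrite fK.
  by exists (f @^-1: e)%SET; rewrite ?fK//; apply/imsetP; exists e.
Qed.

Lemma le_eps (R : realType) (a b C : R) : 0 <= C -> (forall e, 0 < e -> a <= b + C * e) -> a <= b.
Proof.
move=> C0 h; apply/ler_addgt0Pr => e e0.
have C1 : 0 < C + 1 by rewrite ltr_wpDl.
apply: le_trans (h (e / (C + 1)) _) _; first by rewrite divr_gt0.
rewrite lerD2l mulrCA ler_piMr ?(ltW e0)// ler_pdivrMr// mul1r.
by rewrite lerDl.
Qed.

Lemma eq_eps (R : realType) (a b C : R) : 0 <= C -> (forall e, 0 < e -> `|a - b| <= C * e) -> a = b.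
Proof.
move=> C0 h; apply/eqP; rewrite eq_le; apply/andP; split; apply: (le_eps C0) => e e0;
  have := h e e0; rewrite ler_norml => /andP[? ?]; lra.
Qed.

Section HomDens.
Context {R : realType} (W : R -> R -> R).
Hypothesis gW : graphon W.

Notation tk k := (tfin (@fkm R k) (@fkw R k)).

(** One finite kernel approximates all densities at once, so any closed relation among finitely many
    of them passes from finite kernels to [W]. *)
Lemma hom_dens_fkernel (e : R) : 0 < e -> exists k : fkernel R,
  forall n (F : sgraph n), `|hom_dens W F - tk k (val F)| <= n%:R ^+ 2 * e.
Proof.
move=> e0; have [k [w [w01 wC hw]]] := graphon_dyadic_approx gW e0.
have mT := @fmeas_pret R (@dmass R) k.
exists (@FKernel R _ (law (pret (@dmass R) k)) (fun X Y => w X Y) (@law_ge0 _ _ _) (law_sum1 mT)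
   (fun X Y => w01 X Y) (fun X Y => wC X Y)) => n F /=.
apply: le_trans (hom_dens_tfin mT (fun X Y => w01 X Y) (fun X Y => wC X Y) gW F) _.
by rewrite ler_wpM2l ?exprn_ge0.
Qed.

Lemma hom_dens01 n (F : sgraph n) : 0 <= hom_dens W F <= 1.
Proof.
have sq0 : 0 <= n%:R ^+ 2 :> R by rewrite exprn_ge0.
apply/andP; split; apply: (le_eps sq0) => e e0; have [k hk] := hom_dens_fkernel e0;
  have := hk n F; rewrite ler_norml => /andP[h1 h2].
- by have := tfin_ge0 (@fkm_ge0 R k) (@fkw01 R k) (val F); lra.
- by have := tfin_le1 (@fkm_ge0 R k) (@fkm_sum1 R k) (@fkw01 R k) (val F); lra.
Qed.

Lemma hom_dens_iso : iso_invariant (@hom_dens R W).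
Proof.
move=> n m G H f fbij vH.
apply: (@eq_eps _ _ _ (n%:R ^+ 2 + m%:R ^+ 2)); first by rewrite addr_ge0 ?exprn_ge0.
move=> e e0; have [k hk] := hom_dens_fkernel e0.
have := hk n G; have := hk m H; rewrite vH tfin_iso ?sgraph_pairs//; last exact: fkwC.
by rewrite !ler_norml => /andP[? ?] /andP[? ?]; apply/andP; split; lra.
Qed.

Lemma hom_dens_char : character (@hom_dens R W).
Proof.
split=> [G|n m G H K vK]; first by rewrite /hom_dens /= big_ord0.
apply: (@eq_eps _ _ _ ((n + m)%:R ^+ 2 + n%:R ^+ 2 + m%:R ^+ 2)).
  by rewrite !addr_ge0 ?exprn_ge0.
move=> e e0; have [k hk] := hom_dens_fkernel e0.
have := hk _ K; have := hk n G; have := hk m H.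
rewrite vK /dunion_edges tfin_dunion ?sgraph_pairs//; last exact: fkwC.
have /andP[G0 G1] := hom_dens01 G; have /andP[H0 H1] := hom_dens01 H.
have tG0 := tfin_ge0 (@fkm_ge0 R k) (@fkw01 R k) (val G).
have tG1 := tfin_le1 (@fkm_ge0 R k) (@fkm_sum1 R k) (@fkw01 R k) (val G).
set a := hom_dens W G in G0 G1 *; set b := hom_dens W H in H0 H1 *; set a' := tk k (val G) in tG0 tG1 *.
set b' := tk k (val H) => hb ha hK.
have -> : hom_dens W K - a * b = (hom_dens W K - a' * b') + ((a' - a) * b + a' * (b' - b)) by ring.
rewrite (_ : _ * e = (n + m)%:R ^+ 2 * e + (n%:R ^+ 2 * e + m%:R ^+ 2 * e)); last by ring.
apply: le_trans (ler_normD _ _) _; apply: lerD => //.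
apply: le_trans (ler_normD _ _) _; rewrite !normrM; apply: lerD.
  by apply: le_trans ha; rewrite distrC [`|b|]ger0_norm// ler_piMr.
by apply: le_trans hb; rewrite distrC [`|a'|]ger0_norm// ler_piMl.
Qed.

Lemma hom_dens_pos : fully_positive (@hom_dens R W).
Proof.
move=> n G.
pose C : R := \sum_(B : sgraph n | val G \subset val B) n%:R ^+ 2.
have C0 : 0 <= C by apply: sumr_ge0 => B _; rewrite exprn_ge0.
apply: (le_eps C0) => e e0; have [k hk] := hom_dens_fkernel e0.
have pos : 0 <= \sum_(B : sgraph n | val G \subset val B) (-1) ^+ #|val B :\: val G|%SET * tk k (val B).
  rewrite (@sum_sgraph R n (fun B => val G \subset B)).
  rewrite (eq_bigr (fun B : {set {set 'I_n}} => (-1) ^+ #|(B :\: val G)%SET| * tk k B)); last first.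
    by move=> B /andP[_ BA]; rewrite val_mksg.
  rewrite tfin_moebius ?sgraph_pairs//; apply: fexp_ge0 => [|phi]; first exact: fkm_ge0.
  by apply: gprob_ge0; exact: fkw01.
apply: le_trans pos _; rewrite /C mulr_suml -big_split /=; apply: ler_sum => B _.
rewrite -lerBlDl -mulrBr; apply: le_trans (ler_norm _) _.
by rewrite normrM normrX normrN1 expr1n mul1r distrC.
Qed.

Lemma hom_dens_bfp : bfp_character (@hom_dens R W).
Proof.
split; [exact: hom_dens_iso|exact: hom_dens_char| |exact: hom_dens_pos].
exists 1 => n G; have /andP[? ?] := hom_dens01 G.
by rewrite ger0_norm.
Qed.

Lemma hom_dens_K1 (G : sgraph 1) : val G = finset.set0 -> hom_dens W G = 1.
Proof.
move=> vG; apply: (@eq_eps _ _ _ 1) => // e e0; have [k hk] := hom_dens_fkernel e0.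
have := hk _ G; rewrite vG (_ : tk k _ = 1) ?expr1n//.
rewrite -[RHS](fexp_cst 'I_1 (@fkm_sum1 R k)); apply: eq_fexp => phi.
by rewrite big_set0.
Qed.

End HomDens.

(* Isolated vertices do not contribute, so densities of graphs without isolated
   vertices determine all of them. *)
Lemma represents_all (R : realType) (rho : graph_fun R) (W1 W2 : R -> R -> R) :
  graphon W1 -> graphon W2 -> represents rho W1 -> represents rho W2 ->
  forall n (F : sgraph n), hom_dens W1 F = hom_dens W2 F.
Proof.
move=> g1 g2 r1 r2 n F.
have c1 := bfp_gcharacter (hom_dens_bfp g1); have c2 := bfp_gcharacter (hom_dens_bfp g2).
have [m [f [E' [finj E'A cov vF]]]] := graph_core (sgraph_pairs F).
have := gch_inj c1 finj E'A; have := gch_inj c2 finj E'A; rewrite -vF.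
rewrite /gext mksgK !(hom_dens_K1 g1, hom_dens_K1 g2) ?val_mksg ?finset.sub0set// !expr1n !mulr1 => -> ->.
rewrite -r1 -?r2//; apply/no_isolated_covers; by rewrite val_mksg.
Qed.

(** * Ultralimits and existence of the representing graphon *)

Definition bdd (R : realType) (u : nat -> R) : Prop := exists C : R, forall n, `|u n| <= C.

(** What is used of a limit along a free ultrafilter. Freeness is encoded in [ul_le], where the
    inequality is asked only eventually. *)
Record ulimit (R : realType) (L : (nat -> R) -> R) : Prop := ULimit {
  ul_cst : forall c, L (fun=> c) = c;
  ulD : forall u v, bdd u -> bdd v -> L (fun n => u n + v n) = L u + L v;
  ulM : forall u v, bdd u -> bdd v -> L (fun n => u n * v n) = L u * L v;
  ul_le : forall u v, bdd u -> bdd v -> (exists N, forall n, (N <= n)%N -> u n <= v n) -> L u <= L v }.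

Lemma exists_ulimit (R : realType) : exists L : (nat -> R) -> R, ulimit L.
Proof.
have [U [UU sU]] := @ultraFilterLemma nat \oo _.
have cv (u : nat -> R) : bdd u -> cvg (u @ U).
  move=> [C hC].
  have : compact `[- C, C]%classic by exact: segment_compact.
  move=> /(_ (u @ U) _) [|p [_ clp]].
    apply: sU; exists 0%N => // n _ /=; rewrite in_itv /=.
    by have := hC n; rewrite ler_norml.
  (* Compactness gives a cluster point [p], and an ultrafilter converges to its cluster points:
     otherwise the complement of a neighbourhood of [p] would belong to it. *)
  apply/cvg_ex; exists p => A nA.
  have [//|nUA] := in_ultra_setVsetC (u @^-1` A) UU.
  have [x [] ] := clp (~` A) A nUA nA.
  by [].
exists (fun u => lim (u @ U)); split.
- by move=> c; exact: lim_cst.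
- by move=> u v /cv cu /cv cv'; apply: cvg_lim => //; exact: cvgD.
- by move=> u v /cv cu /cv cv'; apply: cvg_lim => //; exact: cvgM.
- move=> u v /cv cu /cv cv' [N hN]; apply: ler_lim => //.
  by apply: sU; exists N.
Qed.

Section ULimit.
Context {R : realType} (L : (nat -> R) -> R).
Hypothesis uL : ulimit L.

Lemma bdd_cst c : bdd (fun=> c : R).
Proof. by exists `|c|. Qed.

Lemma bddD (u v : nat -> R) : bdd u -> bdd v -> bdd (fun n => u n + v n).
Proof.
by move=> [C hC] [D hD]; exists (C + D) => n; rewrite (le_trans (ler_normD _ _))// lerD.
Qed.

Lemma bddM (u v : nat -> R) : bdd u -> bdd v -> bdd (fun n => u n * v n).
Proof. by move=> [C hC] [D hD]; exists (C * D) => n; rewrite normrM ler_pM. Qed.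

Lemma bddN (u : nat -> R) : bdd u -> bdd (fun n => - u n).
Proof. by move=> [C hC]; exists C => n; rewrite normrN. Qed.

Lemma bddB (u v : nat -> R) : bdd u -> bdd v -> bdd (fun n => u n - v n).
Proof. by move=> bu bv; apply: bddD => //; exact: bddN. Qed.

Lemma bdd_norm (u : nat -> R) : bdd u -> bdd (fun n => `|u n|).
Proof. by move=> [C hC]; exists C => n; rewrite normr_id. Qed.

Lemma bdd01 (u : nat -> R) : (forall n, 0 <= u n <= 1) -> bdd u.
Proof. by move=> h; exists 1 => n; have /andP[? ?] := h n; rewrite ger0_norm. Qed.

Lemma bdd_sum (I : Type) (s : seq I) (P : pred I) (F : I -> nat -> R) :
  (forall i, bdd (F i)) -> bdd (fun n => \sum_(i <- s | P i) F i n).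
Proof.
move=> bF; elim: s => [|i s IH].
  by under eq_fun do rewrite big_nil; exact: bdd_cst.
by under eq_fun do rewrite big_cons; case: (P i) => //; exact: bddD.
Qed.

Lemma bdd_prod (I : Type) (s : seq I) (P : pred I) (F : I -> nat -> R) :
  (forall i, bdd (F i)) -> bdd (fun n => \prod_(i <- s | P i) F i n).
Proof.
move=> bF; elim: s => [|i s IH].
  by under eq_fun do rewrite big_nil; exact: bdd_cst.
by under eq_fun do rewrite big_cons; case: (P i) => //; exact: bddM.
Qed.

Lemma ul_sum (I : Type) (s : seq I) (P : pred I) (F : I -> nat -> R) :
  (forall i, bdd (F i)) -> L (fun n => \sum_(i <- s | P i) F i n) = \sum_(i <- s | P i) L (F i).
Proof.
move=> bF; elim: s => [|i s IH].
  under [X in L X]eq_fun do rewrite big_nil.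
  by rewrite ul_cst// big_nil.
under [X in L X]eq_fun do rewrite big_cons.
rewrite big_cons; case: (P i) => //; rewrite ulD// ?IH//; exact: bdd_sum.
Qed.

Lemma ul_prod (I : Type) (s : seq I) (P : pred I) (F : I -> nat -> R) :
  (forall i, bdd (F i)) -> L (fun n => \prod_(i <- s | P i) F i n) = \prod_(i <- s | P i) L (F i).
Proof.
move=> bF; elim: s => [|i s IH].
  under [X in L X]eq_fun do rewrite big_nil.
  by rewrite ul_cst// big_nil.
under [X in L X]eq_fun do rewrite big_cons.
rewrite big_cons; case: (P i) => //; rewrite ulM// ?IH//; exact: bdd_prod.
Qed.

Lemma ulB (u v : nat -> R) : bdd u -> bdd v -> L (fun n => u n - v n) = L u - L v.
Proof.
move=> bu bv.
have -> : (fun n => u n - v n) = (fun n => u n + (-1) * v n) by apply/funext => n; rewrite mulN1r.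
rewrite ulD//; last by apply: bddM => //; exact: bdd_cst.
by rewrite ulM// ?ul_cst// ?mulN1r//; exact: bdd_cst.
Qed.

Lemma ul_ge0 (u : nat -> R) : bdd u -> (forall n, 0 <= u n) -> 0 <= L u.
Proof.
move=> bu u0; rewrite -(ul_cst uL 0); apply: ul_le => //; first exact: bdd_cst.
by exists 0%N.
Qed.

Lemma ul_ev (u v : nat -> R) N : bdd u -> bdd v -> (forall n, (N <= n)%N -> u n = v n) -> L u = L v.
Proof.
move=> bu bv uv; apply/eqP; rewrite eq_le; apply/andP; split; apply: ul_le => //;
  by exists N => n /uv ->.
Qed.

Lemma ul_01 (u : nat -> R) : (forall n, 0 <= u n <= 1) -> 0 <= L u <= 1.
Proof.
move=> u01; have bu := bdd01 u01; rewrite ul_ge0 ?andTb//; last first.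
  by move=> n; case/andP: (u01 n).
rewrite -[leRHS](ul_cst uL 1); apply: ul_le => //; first exact: bdd_cst.
by exists 0%N => n _; case/andP: (u01 n).
Qed.

(** By multiplicativity both sides have the same square, and both are nonnegative. *)
Lemma ul_norm (u : nat -> R) : bdd u -> L (fun n => `|u n|) = `|L u|.
Proof.
move=> bu; have bn := bdd_norm bu.
have h : L (fun n => `|u n|) ^+ 2 = `|L u| ^+ 2.
  rewrite real_normK ?num_real// !expr2 -!ulM//; congr L; apply/funext => n.
  by rewrite -!expr2 real_normK ?num_real.
apply/eqP; rewrite -(@eqrXn2 _ 2)// ?h//; exact: ul_ge0.
Qed.

Lemma ul_cvg0 (u : nat -> R) : bdd u -> (forall e : R, 0 < e -> exists N, forall n, (N <= n)%N -> `|u n| <= e) ->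
  L u = 0.
Proof.
move=> bu hu; apply/eqP; rewrite -normr_eq0 -ul_norm// eq_le; apply/andP; split; last first.
  by apply: ul_ge0 => //; exact: bdd_norm.
apply/ler_addgt0Pr => e e0; rewrite add0r -[leRHS](ul_cst uL e).
exact: (ul_le uL (bdd_norm bu) (bdd_cst e) (hu e e0)).
Qed.

End ULimit.

(** * Limits of sequences converging fast in L1 *)

Section L1Limit.
Context {R : realType}.
Notation leb := (@lebesgue_measure R).

Lemma limn_sup_near (u : nat -> R) (J : nat) (c s : R) : (forall j, 0 <= u j <= 1) ->
  (forall j, (J <= j)%N -> `|u j - c| <= s) -> `|limn_sup u - c| <= s.
Proof.
move=> u01 hu.
have ub : has_ubound (range u) by exists 1 => _ [j _ <-]; case/andP: (u01 j).
have lb : has_lbound (range u) by exists 0 => _ [j _ <-]; case/andP: (u01 j).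
have cv : cvgn (sups u).
  by apply/cvg_ex; eexists; exact: cvg_sups_inf.
rewrite ler_distl; apply/andP; split.
  apply: limr_ge => //; exists J => // n /= Jn; rewrite /sups /=.
  apply: (@le_trans _ _ (u n)).
    by have := hu n Jn; rewrite ler_distl => /andP[].
  by apply: ub_le_sup; [exact: has_ubound_sdrop|exists n => /=].
apply: limr_le => //; exists J => // n /= Jn; rewrite /sups /=.
apply: ge_sup; first by exists (u n), n => /=.
move=> _ [m /= nm <-]; have := hu m (leq_trans Jn nm).
by rewrite ler_distl => /andP[].
Qed.

Lemma norm_le_nneseries (u : nat -> R) (J j : nat) : (J <= j)%N ->
  ((`|u j - u J|)%:E <= \sum_(k <oo) (`|u (J + k).+1 - u (J + k)%N|)%:E)%E.
Proof.
move=> Jj; apply: le_trans (@nneseries_lim_ge R _ xpredT 0%N (j - J) _); last by [].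
rewrite sumEFin lee_fin big_mkord; move: (j - J)%N (subnKC Jj) => m <-.
elim: m => [|m IH]; first by rewrite addn0 subrr normr0 big_ord0.
rewrite big_ord_recr /= addrC addnS.
apply: le_trans (lerD (lexx _) IH).
by rewrite -[X in `|X| <= _](subrKA (u (J + m)%N)) ler_normD.
Qed.

(** The upper limit exists and is measurable everywhere, with no exceptional set. Its distance to
    [u J] is at most the possibly infinite series of later increments, whose integral is a geometric
    tail. *)
Lemma L1_fast_limit (u : nat -> R * R -> R) : (forall j, bmeas (u j)) ->
  (forall j q, 0 <= u j q <= 1) ->
  (forall j, mean2 (fun q => `|u j.+1 q - u j q|) <= 2^-1 ^+ j) ->
  [/\ bmeas (fun q => limn_sup (u ^~ q)), (forall q, 0 <= limn_sup (u ^~ q) <= 1) &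
    forall J, mean2 (fun q => `|limn_sup (u ^~ q) - u J q|) <= 2 * 2^-1 ^+ J].
Proof.
move=> bu u01 hu; set U := fun q => limn_sup (u ^~ q).
have U01 q : 0 <= U q <= 1.
  have : `|U q - 2^-1| <= 2^-1.
    apply: (@limn_sup_near _ 0%N) => j; first exact: u01.
    by move=> _; rewrite ler_norml; have /andP[? ?] := u01 j q; apply/andP; split; lra.
  by rewrite ler_norml => /andP[? ?]; apply/andP; split; lra.
have bU : bmeas U.
  split; last by exists 1 => q; have /andP[? ?] := U01 q; rewrite ger0_norm.
  apply: measurable_fun_limn_sup => [q _|q _|j]; last by case: (bu j).
    by exists 1 => _ [j _ <-]; case/andP: (u01 j q).
  by exists 0 => _ [j _ <-]; case/andP: (u01 j q).
split=> // J.
have bd k : bmeas (fun q => `|u (J + k).+1 q - u (J + k)%N q|).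
  by apply: bmeas_norm; apply: bmeasB.
have mI2 : measurable (I01 R `*` I01 R) by apply: measurableX; exact: measurable_I01.
have bUJ : bmeas (fun q => `|U q - u J q|) by apply: bmeas_norm; apply: bmeasB.
rewrite -lee_fin mean2E//.
apply: (@le_trans _ _ (\int[leb \x leb]_(q in I01 R `*` I01 R)
    (\sum_(k <oo) (`|u (J + k).+1 q - u (J + k)%N q|)%:E))%E).
  apply: ge0_le_integral => //.
  - by apply/measurable_EFinP; case: bUJ => m _; exact: measurable_funS m.
  - apply: ge0_emeasurable_sum => [k q _ _|k _]; first by rewrite lee_fin.
    by apply/measurable_EFinP; case: (bd k) => m _; exact: measurable_funS m.
  - move=> q _; set s := (\sum_(k <oo) _)%E.
    have s0 : (0 <= s)%E by apply: nneseries_ge0 => k _ _; rewrite lee_fin.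
    have hs j : (J <= j)%N -> ((`|u j q - u J q|)%:E <= s)%E by exact: (norm_le_nneseries (u ^~ q)).
    move: s0 hs; case: s => [s| |] // _ hs; last by rewrite leey.
    rewrite lee_fin; apply: (@limn_sup_near _ J) => [j|j /hs]; first exact: u01.
    by rewrite lee_fin.
rewrite integral_nneseries//; last first.
  by move=> k; apply/measurable_EFinP; case: (bd k) => m _; exact: measurable_funS m.
apply: lime_le.
  apply: is_cvg_nneseries => k _ _; apply: integral_ge0 => q _; by rewrite lee_fin.
apply: nearW => n; rewrite big_mkord.
apply: (@le_trans _ _ (\sum_(k < n) (2^-1 ^+ (J + k))%:E)%E).
  by apply: lee_sum => k _; rewrite -mean2E// lee_fin.
rewrite sumEFin lee_fin (eq_bigr (fun k : 'I_n => 2^-1 ^+ J * 2^-1 ^+ k)); last first.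
  by move=> k _; rewrite exprD.
rewrite -mulr_sumr mulrC ler_wpM2r ?exprn_ge0 ?invr_ge0//.
have : \sum_(k < n) (2^-1 : R) ^+ k = 2 - 2 * 2^-1 ^+ n.
  elim: n => [|n IH]; first by rewrite big_ord0 expr0 mulr1 subrr.
  by rewrite big_ord_recr /= IH exprS; field.
by move=> ->; rewrite gerBl mulr_ge0// exprn_ge0// invr_ge0.
Qed.

End L1Limit.

(** * Limit graphon of a consistent family of block densities *)

Section BitKernel.
Context {R : realType} (p : seq bool -> R) (d : seq bool -> seq bool -> R).
Hypothesis bp : bitmass p.

Lemma mean2_pre k (h : seq bool -> seq bool -> R) :
  mean2 (fun q : R * R => h (pre p k q.1) (pre p k q.2)) =
  \sum_(X : k.-tuple bool) \sum_(Y : k.-tuple bool) p X * p Y * h X Y.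
Proof.
have := @mean2_fin R _ (pret p k) (@fmeas_pret R p k) (fun X Y => h X Y).
rewrite /= => ->; apply: eq_bigr => X _; apply: eq_bigr => Y _.
by rewrite !law_pret.
Qed.

Variable Q : nat -> R.
Hypothesis d01 : forall X Y, 0 <= d X Y <= 1.
Hypothesis dC : forall X Y, d X Y = d Y X.
Hypothesis Q_le1 : forall k, Q k <= 1.
(** Pythagoras for successive averages, in the form of finite identities between masses, densities
    and energies; such identities pass to ultralimits. *)
Hypothesis Q_inc : forall j k, \sum_(X : (j + k).-tuple bool) \sum_(Y : (j + k).-tuple bool)
  p X * p Y * (d X Y - d (drop j X) (drop j Y)) ^+ 2 = Q (j + k)%N - Q k.

Let u k (q : R * R) : R := d (pre p k q.1) (pre p k q.2).

Let bu k : bmeas (u k). Proof. exact: bmeas_dfin. Qed.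

Let u01 k q : 0 <= u k q <= 1. Proof. exact: d01. Qed.

Let Q_mono k l : (k <= l)%N -> Q k <= Q l.
Proof.
move=> kl; rewrite -subr_ge0 -(subnK kl) -Q_inc.
apply: sumr_ge0 => X _; apply: sumr_ge0 => Y _.
by apply: mulr_ge0; [apply: mulr_ge0; exact: (bm_ge0 bp)|exact: sqr_ge0].
Qed.

Let l1_le k l (de : R) : (k <= l)%N -> 0 <= de -> Q l - Q k <= de ^+ 2 ->
  mean2 (fun q => `|u l q - u k q|) <= de.
Proof.
move=> kl de0 hQ; pose j := (l - k)%N; have jk : (j + k = l)%N by rewrite subnK.
rewrite -jk in hQ *; rewrite -Q_inc in hQ.
have -> : mean2 (fun q => `|u (j + k) q - u k q|) =
   \sum_(X : (j + k).-tuple bool) \sum_(Y : (j + k).-tuple bool)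
     p X * p Y * `|d X Y - d (drop j X) (drop j Y)|.
  rewrite -(mean2_pre (j + k) (fun X Y => `|d X Y - d (drop j X) (drop j Y)|)).
  by congr mean2; apply/funext => q /=; rewrite /u !drop_pre.
set s := (X in X <= _).
have s0 : 0 <= s.
  apply: sumr_ge0 => X _; apply: sumr_ge0 => Y _.
  by apply: mulr_ge0 => //; apply: mulr_ge0; exact: (bm_ge0 bp).
rewrite -[s]ger0_norm//; apply: sqr_norm_le => //; apply: le_trans hQ.
pose a (X : (j + k).-tuple bool) := p X.
have a0 X : 0 <= a X by exact: (bm_ge0 bp).
have a1 : \sum_X a X = 1.
  rewrite -(law_sum1 (@fmeas_pret R p (j + k))); apply: eq_bigr => X _.
  by rewrite law_pret.
have := sqr_wsum_le (sqw_ge0 a0) (sqw_sum1 a1)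
   (fun q => `|d q.1 q.2 - d (drop j q.1) (drop j q.2)|).
rewrite /s !pair_bigA /=; congr (_ <= _).
by apply: eq_bigr => q _; rewrite real_normK ?num_real.
Qed.

(** [Q] is nondecreasing and bounded, and by Jensen the L1 distance of two levels is at most the
    square root of their energy gap; so a subsequence of levels converges fast and later levels stay
    close to it. *)
Lemma bit_kernel_limit : exists2 U : R -> R -> R, graphon U &
  forall e : R, 0 < e -> exists k0, forall k, (k0 <= k)%N ->
    mean2 (fun q => `|wext U q - d (pre p k q.1) (pre p k q.2)|) <= e.
Proof.
have exK j : exists K, forall l, (K <= l)%N -> Q l - Q K <= (2^-1 ^+ j) ^+ 2.
  have hs : has_sup (range Q).
    by split; [exists (Q 0%N), 0%N|exists 1 => _ [k _ <-]].
  have e0 : 0 < (2^-1 ^+ j : R) ^+ 2 by rewrite !exprn_gt0// invr_gt0.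
  have [_ [K _ <-] hK] := sup_adherent e0 hs.
  exists K => l _; have : Q l <= sup (range Q) by apply: ub_le_sup; [case: hs|exists l].
  by move: hK; lra.
have [K0 hK0] := choice exK.
(* Partial sums give a nondecreasing majorant of the chosen levels. *)
pose K j := (\sum_(i < j.+1) K0 i)%N.
have K0K j : (K0 j <= K j)%N by rewrite /K big_ord_recr /= leq_addl.
have KS j : (K j <= K j.+1)%N by rewrite /K [X in (_ <= X)%N]big_ord_recr /= leq_addr.
have hK j l : (K j <= l)%N -> Q l - Q (K j) <= (2^-1 ^+ j) ^+ 2.
  move=> Kl; apply: le_trans (hK0 j l (leq_trans (K0K j) Kl)).
  by rewrite lerD2l lerN2; exact: Q_mono.
have hf0 j : 0 <= (2^-1 : R) ^+ j by rewrite exprn_ge0// invr_ge0.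
have [bU U01 UL] := @L1_fast_limit R (fun j => u (K j)) (fun j => bu _) (fun j => u01 _)
  (fun j => l1_le (KS j) (hf0 j) (hK j _ (KS j))).
pose U x y := limn_sup (fun j => u (K j) (x, y)).
have gU : graphon U.
  split.
  - by case: bU => mU _; apply: measurable_funS (mU) => //.
  - by move=> x y _ _; rewrite /U; congr limn_sup; apply/funext => j; rewrite /u dC.
  - by move=> x y _ _; exact: U01.
exists U => // e e0.
have e4 : 0 < e / 4 by rewrite divr_gt0.
have [J hJ] := half_expn_lt e4.
exists (K J) => k Kk.
apply: (@le_trans _ _ (mean2 (fun q => `|limn_sup (fun j => u (K j) q) - u (K J) q| + `|u k q - u (K J) q|))).
  apply: ler_mean2.
  - by apply: bmeas_norm; apply: bmeasB; [exact: bmeas_wext|exact: bu].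
  - by apply: bmeasD; apply: bmeas_norm; apply: bmeasB.
  - move=> x y xI yI; rewrite wextE// -/(u k (x, y)) [`|u k _ - _|]distrC.
    exact: ler_distD.
rewrite mean2D; last 2 first.
- by apply: bmeas_norm; apply: bmeasB.
- by apply: bmeas_norm; apply: bmeasB.
have h1 := UL J; have h2 := l1_le Kk (hf0 J) (hK J _ Kk).
by apply: le_trans (lerD h1 h2) _; lra.
Qed.

End BitKernel.

(** Bernoulli's inequality. This is how boundedness of rho enters: [c ^+ n] is its value on the
    edgeless graph with [n] vertices. *)
Lemma bounded_powers_le1 (R : realType) (c C : R) : 0 <= c -> (forall n : nat, c ^+ n <= C) -> c <= 1.
Proof.
move=> c0 hC; rewrite leNgt; apply/negP => c1.
have bern n : 1 + n%:R * (c - 1) <= c ^+ n.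
  elim: n => [|n IH]; first by rewrite mul0r addr0.
  rewrite exprS -natr1; have n0 : 0 <= n%:R :> R by [].
  apply: le_trans (ler_wpM2l c0 IH).
  rewrite -subr_ge0.
  have -> : c * (1 + n%:R * (c - 1)) - (1 + (n%:R + 1) * (c - 1)) = n%:R * (c - 1) ^+ 2 by ring.
  by rewrite mulr_ge0// sqr_ge0.
have C0 : 0 <= C by apply: le_trans (hC 0%N); rewrite expr0.
have d0 : 0 < c - 1 by rewrite subr_gt0.
have := archi_boundP (divr_ge0 C0 (ltW d0)); set N := Num.bound _.
rewrite ltr_pdivrMr// => h; have := le_trans (bern N) (hC N); lra.
Qed.

(** * Masses and block densities of a coded finite kernel *)

Section FiniteCodes.
Variables (R : realFieldType) (V : finType) (a : V -> R) (w : V -> V -> R).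
Hypothesis a_ge0 : forall v, 0 <= a v.
Hypothesis a_sum1 : \sum_v a v = 1.
Hypothesis w01 : forall u v, 0 <= w u v <= 1.
Hypothesis wC : forall u v, w u v = w v u.

Notation code := (gcode a w).

Definition cmass (X : seq bool) : R := \sum_(v | code (size X) v == X) a v.
Definition cdens (X Y : seq bool) : R := bavg a w (code (size X)) X Y.

Lemma bitmass_cmass : bitmass cmass.
Proof.
split=> [X||X]; first exact: sumr_ge0.
  by rewrite /cmass -a_sum1; apply: eq_bigl => v; rewrite -size_eq0 size_gcode.
rewrite /cmass /= (bigID (fun v => head true (code (size X).+1 v))) /= addrC; congr (_ + _);
  apply: eq_bigl => v; rewrite -(behead_gcode _ _ (size X) v).
  have := size_gcode a w (size X).+1 v; case: (code _ v) => [//|b Z] _ /=.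
  by rewrite eqseq_cons andbC; case: b.
have := size_gcode a w (size X).+1 v; case: (code _ v) => [//|b Z] _ /=.
by rewrite eqseq_cons andbC; case: b.
Qed.

Lemma cdens01 X Y : 0 <= cdens X Y <= 1.
Proof. by apply: dens01 => [q|q]; [exact: sqw_ge0|exact: w01]. Qed.

Lemma cdensC X Y : size X = size Y -> cdens X Y = cdens Y X.
Proof.
move=> sXY; rewrite /cdens /bavg /dens -sXY.
have swap (P : pred (V * V)) (F : V * V -> R) :
    \sum_(q | P q) F q = \sum_(q | P (q.2, q.1)) F (q.2, q.1).
  rewrite (reindex (fun q : V * V => (q.2, q.1))) //=.
  by exists (fun q : V * V => (q.2, q.1)) => -[? ?] _.
congr (_ / _); rewrite swap; apply: eq_big => [q|q _].
- by rewrite /sqf /= !xpair_eqE andbC.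
- by rewrite /sqw /unc /= wC mulrC [a _ * a _]mulrC mulrC.
- by rewrite /sqf /= !xpair_eqE andbC.
- by rewrite /sqw /= mulrC.
Qed.

Definition tcode k (v : V) : k.-tuple bool := Tuple (introT eqP (size_gcode a w k v)).

Lemma push_tcode k (X : k.-tuple bool) : push a (tcode k) X = cmass X.
Proof.
by rewrite /push /cmass size_tuple; apply: eq_bigl => v; rewrite -val_eqE.
Qed.

Lemma sum2_push k (h : seq bool -> seq bool -> R) :
  \sum_(X : k.-tuple bool) \sum_(Y : k.-tuple bool) cmass X * cmass Y * h X Y =
  \sum_u \sum_v a u * a v * h (code k u) (code k v).
Proof.
transitivity (\sum_(X : k.-tuple bool) push a (tcode k) X * \sum_v a v * h X (code k v)).
  apply: eq_bigr => X _.
  rewrite (sum_push a (tcode k) (fun Y => h X Y)) mulr_sumr push_tcode.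
  by apply: eq_bigr => Y _; rewrite push_tcode mulrA.
rewrite -(sum_push a (tcode k) (fun X => \sum_v a v * h X (code k v))).
by apply: eq_bigr => u _; rewrite mulr_sumr; apply: eq_bigr => v _; rewrite mulrA.
Qed.

Lemma drop_gcode j k v : drop j (code (j + k) v) = code k v.
Proof.
elim: j => [|j IH]; first by rewrite drop0.
by rewrite addSn -IH -(behead_gcode a w (j + k)) -drop1 drop_drop addn1.
Qed.

Lemma cdens_energy j k : \sum_(X : (j + k).-tuple bool) \sum_(Y : (j + k).-tuple bool)
   cmass X * cmass Y * (cdens X Y - cdens (drop j X) (drop j Y)) ^+ 2 =
   genergy a w (j + k) - genergy a w k.
Proof.
rewrite (@sum2_push (j + k) (fun X Y => (cdens X Y - cdens (drop j X) (drop j Y)) ^+ 2)).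
have fg q : sqf (code k) q = (fun t : seq bool * seq bool => (drop j t.1, drop j t.2)) (sqf (code (j + k)) q).
  by rewrite /sqf /= !drop_gcode.
rewrite /genergy -(dens_pythagoras (unc w) (sqw_ge0 a_ge0) (f' := sqf (code (j + k)))
  (g := fun t : seq bool * seq bool => (drop j t.1, drop j t.2)) fg) pair_bigA /=.
apply: eq_bigr => q _; rewrite /cdens /bavg size_drop size_gcode addKn !drop_gcode.
by [].
Qed.

(** Counting lemma for a kernel against its block averages, the cut bound being supplied by
    [gcode_regular]. *)
Lemma tfin_cdens i n (E : {set {set 'I_n}}) (D : R) : E \subset pairs n -> 0 <= D ->
  genergy a w i.+1.*2 - genergy a w i.*2 <= D ^+ 2 ->
  `|tfin a w E - tfin (fun X : i.*2.-tuple bool => cmass X) (fun X Y => cdens X Y) E| <= #|E|%:R * D.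
Proof.
move=> EA D0 hD.
have -> : tfin (fun X : i.*2.-tuple bool => cmass X) (fun X Y => cdens X Y) E =
    tfin a (fun u v => bavg a w (code i.*2) (code i.*2 u) (code i.*2 v)) E.
  have -> : (fun X : i.*2.-tuple bool => cmass X) = push a (tcode i.*2).
    by apply/funext => X; rewrite push_tcode.
  rewrite -tfin_push; apply: eq_fexp => phi; apply: eq_bigr => e _; apply: eq_bigr => q _.
  by rewrite /cdens /= size_gcode.
apply: counting_lemma => //.
- by move=> u v; apply: dens01 => q; [exact: sqw_ge0|exact: w01].
- move=> S T; apply: sqr_norm_le => //; apply: le_trans hD.
  exact: gcode_regular.
Qed.

End FiniteCodes.

Section Existence.
Context {R : realType} (rho : graph_fun R).
Hypothesis rB : bfp_character rho.

Let r := gext rho.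
Let rch : gcharacter r. Proof. exact: bfp_gcharacter. Qed.

Let c_le1 : r (finset.set0 : {set {set 'I_1}}) <= 1.
Proof.
have [_ _ [C hC] _] := rB.
apply: (@bounded_powers_le1 _ _ C); first exact: (gch_c_ge0 rch).
by move=> n; rewrite -(gch_empty rch); apply: le_trans (ler_norm _) _; exact: hC.
Qed.

Lemma bfp_represented : exists W : R -> R -> R, graphon W /\ represents rho W.
Proof.
have exk M : exists k : fkernel R, forall m (F : {set {set 'I_m}}), (m <= M)%N ->
    F \subset pairs m -> covers F -> `|tfin (@fkm R k) (@fkw R k) F - r F| <= M.+1%:R^-1.
  by apply: gcharacter_approx => //; rewrite invr_gt0 ltr0n.
have [kk hkk] := choice exk.
have [L uL] := exists_ulimit R.
pose pn n X := cmass (@fkm R (kk n)) (@fkw R (kk n)) X.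
pose dn n X Y := cdens (@fkm R (kk n)) (@fkw R (kk n)) X Y.
pose en n k := genergy (@fkm R (kk n)) (@fkw R (kk n)) k.
have bpn n : bitmass (pn n) := bitmass_cmass (@fkw R (kk n)) (@fkm_ge0 R (kk n)) (@fkm_sum1 R (kk n)).
have pn01 n X : 0 <= pn n X <= 1.
  rewrite (bm_ge0 (bpn n)) /=; have := ell_le1 (bpn n) X; have := ell_ge0 (bpn n) X; lra.
have dn01 n X Y : 0 <= dn n X Y <= 1.
  exact: (cdens01 (@fkm_ge0 R (kk n)) (@fkw01 R (kk n))).
have en01 n k : 0 <= en n k <= 1.
  apply/andP; split; first exact: (energy_ge0 _ (sqw_ge0 (@fkm_ge0 R (kk n)))).
  apply: (energy_le1 (sqw_ge0 (@fkm_ge0 R (kk n))) (sqw_sum1 (@fkm_sum1 R (kk n)))) => q.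
  exact: fkw01.
have bsp X : bdd (fun n => pn n X) by exact: bdd01.
have bsd X Y : bdd (fun n => dn n X Y) by exact: bdd01.
have bse k : bdd (fun n => en n k) by exact: bdd01.
pose p X := L (fun n => pn n X).
(* [cdens] is known to be symmetric only for codes of equal length; the value 0 elsewhere makes [d]
   symmetric. *)
pose d X Y := if size X == size Y then L (fun n => dn n X Y) else 0.
pose Q k := L (fun n => en n k).
have bp : bitmass p.
  split=> [X||X].
  - by apply: (ul_ge0 uL) => // n; case/andP: (pn01 n X).
  - rewrite /p -[RHS](ul_cst uL 1); congr L; apply/funext => n; exact: (bm_nil (bpn n)).
  - rewrite /p -(ulD uL)//; congr L; apply/funext => n; exact: (bm_split (bpn n)).
have d01 X Y : 0 <= d X Y <= 1.
  by rewrite /d; case: ifP => _; [exact: (ul_01 uL)|rewrite lexx ler01].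
have dC X Y : d X Y = d Y X.
  rewrite /d eq_sym; case: eqP => // sXY; congr L; apply/funext => n.
  by apply: cdensC => //; exact: fkwC.
have Q_le1 k : Q k <= 1 by have /andP[] := ul_01 uL (fun n => en01 n k).
have dE k (X Y : k.-tuple bool) : d X Y = L (fun n => dn n X Y) by rewrite /d !size_tuple eqxx.
have Q_inc j k : \sum_(X : (j + k).-tuple bool) \sum_(Y : (j + k).-tuple bool)
    p X * p Y * (d X Y - d (drop j X) (drop j Y)) ^+ 2 = Q (j + k)%N - Q k.
  rewrite /Q -(ulB uL)//.
  have -> : (fun n => en n (j + k)%N - en n k) = (fun n => \sum_(X : (j + k).-tuple bool)
      \sum_(Y : (j + k).-tuple bool) pn n X * pn n Y * (dn n X Y - dn n (drop j X) (drop j Y)) ^+ 2).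
    apply/funext => n; rewrite (cdens_energy (@fkw R (kk n)) (@fkm_ge0 R (kk n))).
    by [].
  have bs1 (X Y : seq bool) : bdd (fun n => dn n X Y - dn n (drop j X) (drop j Y)).
    exact: bddB.
  have bs2 (X Y : seq bool) : bdd (fun n => (dn n X Y - dn n (drop j X) (drop j Y)) ^+ 2).
    by under eq_fun do rewrite expr2; apply: bddM.
  have bs3 (X Y : seq bool) : bdd (fun n => pn n X * pn n Y * (dn n X Y - dn n (drop j X) (drop j Y)) ^+ 2).
    by apply: bddM => //; apply: bddM.
  rewrite (ul_sum uL); last by move=> X; apply: bdd_sum => Y; exact: bs3.
  apply: eq_bigr => X _; rewrite (ul_sum uL); last by move=> Y; exact: bs3.
  apply: eq_bigr => Y _; rewrite (ulM uL)//; last by apply: bddM.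
  rewrite (ulM uL)//; congr (_ * _).
  have -> : (fun n => (dn n X Y - dn n (drop j X) (drop j Y)) ^+ 2) =
    (fun n => (dn n X Y - dn n (drop j X) (drop j Y)) * (dn n X Y - dn n (drop j X) (drop j Y))).
    by apply/funext => n; rewrite expr2.
  rewrite (ulM uL)// (ulB uL)// -expr2 dE; congr ((_ - _) ^+ 2).
  by rewrite /d !size_drop !size_tuple eqxx.
have [U gU hU] := bit_kernel_limit bp d01 dC Q_le1 Q_inc.
exists U; split=> // m F Fcov.
have FA := sgraph_pairs F; set E := val F in FA.
have rE : @rho m F = r E by rewrite /r /gext /E mksgK.
have cov : covers E by exact/no_isolated_covers.
pose C : R := m%:R ^+ 2 + #|E|%:R.
have C0 : 0 <= C by rewrite addr_ge0// exprn_ge0.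
apply: (eq_eps C0) => e e0.
have [k0 hk0] := hU e e0.
(* the energies Q (2 i) are nondecreasing and bounded, so some late gap is small *)
have [i ki hi] : exists2 i, (k0 <= i.*2)%N & Q i.+1.*2 - Q i.*2 <= e ^+ 2.
  apply: contrapT => nh.
  have gap i : (k0 <= i.*2)%N -> e ^+ 2 < Q i.+1.*2 - Q i.*2.
    by move=> ki; rewrite ltNge; apply/negP => h; apply: nh; exists i.
  have grow n : n%:R * e ^+ 2 <= Q (k0 + n).*2 - Q k0.*2.
    elim: n => [|n IH]; first by rewrite mul0r addn0 subrr.
    have := gap (k0 + n)%N; rewrite -addnn -addnS => /(_ _); rewrite -natr1 mulrDl mul1r.
    have -> : (k0 <= k0 + n + (k0 + n))%N by rewrite -addnA leq_addr.
    by rewrite addnn => /(_ isT) h; lra.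
  have e20 : 0 < e ^+ 2 by rewrite exprn_gt0.
  have ei : 0 <= (e ^+ 2)^-1 by rewrite invr_ge0 ltW.
  have := archi_boundP ei; set N := Num.bound _.
  rewrite -[X in X < _]mul1r ltr_pdivrMr// => hN.
  have Q0 : 0 <= Q k0.*2 by have /andP[] := ul_01 uL (fun n => en01 n k0.*2).
  by have := grow N; have := Q_le1 (k0 + N).*2; lra.
have mT := @fmeas_pret R p i.*2.
have h1 := hom_dens_tfin mT (fun X Y => d01 X Y) (fun X Y => dC X Y) gU F.
have lawE : law (pret p i.*2) = (fun X : i.*2.-tuple bool => p X).
  by apply/funext => X; rewrite law_pret.
rewrite lawE in h1.
have {}h1 : `|hom_dens U F - tfin (fun X : i.*2.-tuple bool => p X) (fun X Y => d X Y) E| <= m%:R ^+ 2 * e.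
  by apply: le_trans h1 _; rewrite ler_wpM2l ?exprn_ge0//; exact: hk0.
pose tn n := tfin (@fkm R (kk n)) (@fkw R (kk n)) E.
pose sn n := tfin (fun X : i.*2.-tuple bool => pn n X) (fun X Y => dn n X Y) E.
have tn01 n : 0 <= tn n <= 1.
  by rewrite tfin_ge0 ?tfin_le1//; [exact: fkm_ge0|exact: fkm_sum1|exact: fkw01|exact: fkm_ge0|exact: fkw01].
have bt : bdd tn by exact: bdd01.
have LtE : L tn = r E.
  apply/eqP; rewrite -subr_eq0; apply/eqP.
  rewrite -[X in _ - X](ul_cst uL) -(ulB uL)//; last exact: bdd_cst.
  apply: (ul_cvg0 uL); first by apply: bddB => //; exact: bdd_cst.
  move=> e' e'0; exists (maxn m (Num.bound e'^-1)) => n; rewrite geq_max => /andP[mn bn].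
  apply: le_trans (hkk n m E mn FA cov) _.
  rewrite -[e']invrK lef_pV2 ?posrE ?invr_gt0 ?ltr0n//.
  apply: le_trans (ltW (archi_boundP _)) _; first by rewrite invr_ge0 ltW.
  by rewrite ler_nat leqW.
have bev (phi : {ffun 'I_m -> i.*2.-tuple bool}) q :
   bdd (fun n => dn n (phi q.1) (phi q.2)) by [].
have LsE : L sn = tfin (fun X : i.*2.-tuple bool => p X) (fun X Y => d X Y) E.
  rewrite /sn /tfin /fexp.
  have b1 (phi : {ffun 'I_m -> i.*2.-tuple bool}) : bdd (fun n => \prod_l pn n (phi l)).
    by apply: bdd_prod => l.
  have b2 (phi : {ffun 'I_m -> i.*2.-tuple bool}) (e1 : {set 'I_m}) :
      bdd (fun n => eweight (fun l l' => dn n (phi l) (phi l')) e1).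
    by apply: bdd_prod => q.
  have b3 (phi : {ffun 'I_m -> i.*2.-tuple bool}) :
      bdd (fun n => \prod_(e1 in E) eweight (fun l l' => dn n (phi l) (phi l')) e1).
    by apply: bdd_prod => e1.
  rewrite (ul_sum uL); last by move=> phi; apply: bddM.
  apply: eq_bigr => phi _; rewrite (ulM uL)// (ul_prod uL)//; congr (_ * _).
  rewrite (ul_prod uL)//; apply: eq_bigr => e1 _.
  rewrite /eweight (ul_prod uL)//; apply: eq_bigr => q _.
  by rewrite dE.
have sn01 n : 0 <= sn n <= 1.
  have s1 : \sum_(X : i.*2.-tuple bool) pn n X = 1.
    rewrite -(law_sum1 (@fmeas_pret R (pn n) i.*2)); apply: eq_bigr => X _.
    by rewrite law_pret.
  have s0 (X : i.*2.-tuple bool) : 0 <= pn n X by exact: (bm_ge0 (bpn n)).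
  by rewrite tfin_ge0// tfin_le1.
have bs : bdd sn by exact: bdd01.
(* The cut bound for the kernel number [n]. A single [g n] may exceed [e]; only its ultralimit is
   controlled, so the counting estimate is taken through [L] before [e] appears. *)
pose g n := Num.sqrt (en n i.+1.*2 - en n i.*2).
have en_inc n : 0 <= en n i.+1.*2 - en n i.*2.
  apply: le_trans (gcode_regular (@fkw R (kk n)) (@fkm_ge0 R (kk n)) (@fkm_sum1 R (kk n)) i finset.set0 finset.set0).
  exact: sqr_ge0.
have bg : bdd g.
  apply: bdd01 => n; rewrite sqrtr_ge0 /= -(@sqrtr1 R) ler_wsqrtr//.
  by have /andP[? ?] := en01 n i.+1.*2; have /andP[? ?] := en01 n i.*2; lra.
have Lg : L g <= e.
  have Lg0 : 0 <= L g by apply: (ul_ge0 uL) => // n; exact: sqrtr_ge0.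
  rewrite -[L g]ger0_norm//; apply: sqr_norm_le; first exact: ltW.
  apply: le_trans hi; rewrite expr2 -(ulM uL)// /Q -(ulB uL)//.
  rewrite le_eqVlt; apply/orP; left; apply/eqP; congr L; apply/funext => n.
  by rewrite /g -expr2 sqr_sqrtr.
have h2 : `|L tn - L sn| <= #|E|%:R * e.
  rewrite -(ulB uL)// -(ul_norm uL); last exact: bddB.
  apply: le_trans (ler_wpM2l (ler0n R #|E|) Lg).
  rewrite -[X in X * L g](ul_cst uL) -(ulM uL)//; last exact: bdd_cst.
  apply: (ul_le uL); first by apply: bdd_norm; exact: bddB.
    by apply: bddM => //; exact: bdd_cst.
  exists 0%N => n _; apply: tfin_cdens => //.
  - exact: fkm_ge0.
  - exact: fkm_sum1.
  - exact: fkw01.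
  - exact: sqrtr_ge0.
  - by rewrite sqr_sqrtr.
rewrite LtE LsE in h2; rewrite rE /C mulrDl.
move: h1 h2; set x := hom_dens U F; set y := tfin _ _ E; set z := r E.
by rewrite !ler_norml => /andP[? ?] /andP[? ?]; apply/andP; split; lra.
Qed.

End Existence.

(** * Measure-preserving maps *)

Lemma dist_via (R : realFieldType) (t a b c : R) :
  `|a - t| <= c -> `|b - t| <= c -> `|a - b| <= 2 * c.
Proof. by rewrite !ler_norml => /andP[? ?] /andP[? ?]; apply/andP; split; lra. Qed.

Section MeasurePreserving.
Context {R : realType}.
Notation leb := (@lebesgue_measure R).

(** An [mp_map] is constrained only on the unit interval; the identity elsewhere makes it measurable
    on the line. *)
Definition mpx (phi : R -> R) (x : R) : R := if x \in I01 R then phi x else x.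

Lemma mpxE phi x : x \in I01 R -> mpx phi x = phi x.
Proof. by rewrite /mpx => ->. Qed.

Lemma measurable_mpx phi : mp_map phi -> measurable_fun setT (mpx phi).
Proof.
move=> [mphi _ _].
have mI := @measurable_I01 R.
have -> : mpx phi = (fun x => (phi \_ (I01 R)) x + (idfun \_ (~` I01 R)) x).
  apply/funext => x; rewrite /mpx !patchE in_setC.
  by case: (x \in I01 R); rewrite ?addr0 ?add0r.
apply: measurable_funD.
  by apply: (measurable_restrictT _ _).1.
apply: (measurable_restrictT _ _).1; first exact: measurableC.
exact: measurable_funS (@measurable_id _ _ setT).
Qed.

Lemma mean_mp_indic phi (A : set R) : mp_map phi -> measurable A ->
  mean (fun x => \1_A (mpx phi x) : R) = mean (\1_A : R -> R).
Proof.
move=> mp mA; have mx := measurable_mpx mp; have mI := @measurable_I01 R.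
have mB : measurable (mpx phi @^-1` A) by rewrite -[X in measurable X]setTI; exact: mx.
apply: EFin_inj.
rewrite (_ : (fun x => _) = (\1_(mpx phi @^-1` A) : R -> R)); last first.
  by apply/funext => x; rewrite !indicE; congr (nat_of_bool _)%:R; apply/idP/idP; rewrite !inE.
rewrite !mean_indic//.
have [_ h /(_ (A `&` I01 R)) <-] := mp.
- congr (_ _); apply/seteqP; split => x /=.
    move=> [Ax xI]; split => //; move: Ax; rewrite mpxE ?inE// => Ax; split => //.
    by have := h x; rewrite !inE; apply.
  by move=> [xI [Ax _]]; rewrite mpxE// inE.
- exact: measurableI.
- by move=> x [].
Qed.

(** Indicators are handled by the definition, and [f] is within [e] of an average of indicators of
    its superlevel sets. *)
Lemma mean_mp phi (f : R -> R) : mp_map phi -> bmeas f -> (forall x, 0 <= f x <= 1) ->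
  mean (fun x => f (mpx phi x)) = mean f.
Proof.
move=> mp bf f01; have mx := measurable_mpx mp.
apply: (@eq_eps _ _ _ 2) => // e e0.
pose N := (Num.bound e^-1).+1.
have N0 : 0 < N%:R :> R by rewrite ltr0n.
have Ne : N%:R^-1 <= e.
  rewrite -[e]invrK lef_pV2 ?posrE ?invr_gt0//.
  apply: le_trans (ltW (archi_boundP _)) _; first by rewrite invr_ge0 ltW.
  by rewrite ler_nat.
pose L (j : 'I_N) : set R := [set x | j.+1%:R <= N%:R * f x].
have mL j : measurable (L j).
  rewrite (_ : L j = (fun q => N%:R * f q) @^-1` `[j.+1%:R, +oo[%classic); last first.
    by apply/seteqP; split => q /=; rewrite in_itv /= andbT.
  rewrite -[X in measurable X]setTI; case: bf => mf _.
  by apply: (measurable_funM (measurable_cst _) mf).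
pose s x : R := N%:R^-1 * \sum_(j < N) \1_(L j) x.
have bs : bmeas s.
  by apply: bmeasM; [exact: bmeas_cst|apply: bmeas_sum => j _; exact: bmeas_indic].
have fs x : `|f x - s x| <= e.
  have /andP[s1 s2] : N%:R * f x - 1 <= \sum_(j < N) (\1_(L j) x : R) <= N%:R * f x.
    rewrite (eq_bigr (fun j : 'I_N => (j.+1%:R <= N%:R * f x)%R%:R)); last first.
      by move=> j _; rewrite indicE; congr (nat_of_bool _)%:R; apply/idP/idP; rewrite inE.
    apply: floor_sum; have /andP[f0 f1] := f01 x.
    by rewrite mulr_ge0 ?(ltW N0)//= ler_piMr// ltW.
  have -> : f x - s x = N%:R^-1 * (N%:R * f x - \sum_(j < N) (\1_(L j) x : R)).
    by rewrite /s; field; rewrite gt_eqF.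
  rewrite normrM ger0_norm ?invr_ge0 ?(ltW N0)//; apply: le_trans Ne.
  by rewrite ler_piMr ?invr_ge0 ?(ltW N0)// ler_norml; apply/andP; split; lra.
have sE : mean (fun x => s (mpx phi x)) = mean s.
  rewrite /s !meanZ; last 2 first.
  - by apply: bmeas_sum => j _; exact: bmeas_indic.
  - by apply: bmeas_sum => j _; exact: (bmeas_comp (bmeas_indic (mL j)) mx).
  congr (_ * _); rewrite !mean_sum.
  - by apply: eq_bigr => j _; exact: mean_mp_indic.
  - by move=> j _; exact: bmeas_indic.
  - by move=> j _; exact: (bmeas_comp (bmeas_indic (mL j)) mx).
have bfx : bmeas (fun x => f (mpx phi x)) by exact: (bmeas_comp bf).
have bsx : bmeas (fun x => s (mpx phi x)) by exact: (bmeas_comp bs).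
have h1 : `|mean (fun x => f (mpx phi x)) - mean (fun x => s (mpx phi x))| <= e.
  rewrite -meanB//; apply: mean_bound; first exact: bmeasB.
  by move=> x; exact: fs.
have h2 : `|mean f - mean s| <= e.
  by rewrite -meanB//; apply: mean_bound => //; exact: bmeasB.
move: h1 h2; rewrite sE !ler_norml => /andP[? ?] /andP[? ?]; apply/andP; split; lra.
Qed.

Lemma mean2_mp phi (g : R * R -> R) : mp_map phi -> bmeas g -> (forall q, 0 <= g q <= 1) ->
  mean2 (fun q => g (mpx phi q.1, mpx phi q.2)) = mean2 g.
Proof.
move=> mp bg g01; rewrite /mean2 /=.
transitivity (mean (fun x => mean (fun y => g (mpx phi x, y)))).
  by apply: eq_mean => x _; rewrite (mean_mp (f := fun y => g (mpx phi x, y)))//; exact: bmeas_pair1.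
apply: (mean_mp (f := fun x => mean (fun y => g (x, y)))) => //; first exact: bmeas_mean.
move=> x; apply/andP; split; first by apply: mean_ge0 => y _; case/andP: (g01 (x, y)).
rewrite -[leRHS]mean_cst; apply: ler_mean; [exact: bmeas_pair1|exact: bmeas_cst|].
by move=> y _; case/andP: (g01 (x, y)).
Qed.

Definition pullback (phi : R -> R) (W : R -> R -> R) (x y : R) : R :=
  wext W (mpx phi x, mpx phi y).

Lemma bmeas_pullback2 phi (g : R * R -> R) : mp_map phi -> bmeas g ->
  bmeas (fun q : R * R => g (mpx phi q.1, mpx phi q.2)).
Proof.
move=> mp bg; have mx := measurable_mpx mp.
have m2 : measurable_fun setT (fun q : R * R => (mpx phi q.1, mpx phi q.2)).
  apply: measurable_fun_pair; apply: measurableT_comp => //.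
exact: (bmeas_comp bg m2).
Qed.

Lemma graphon_pullback phi W : mp_map phi -> graphon W -> graphon (pullback phi W).
Proof.
move=> mp gW; split.
- have [m _] := bmeas_pullback2 mp (bmeas_wext gW).
  by apply: measurable_funS (m).
- by move=> x y _ _; rewrite /pullback wextC.
- by move=> x y _ _; exact: wext01.
Qed.

Lemma wext_pullback phi W q : mp_map phi -> q.1 \in I01 R -> q.2 \in I01 R ->
  wext (pullback phi W) q = wext W (mpx phi q.1, mpx phi q.2).
Proof. by case: q => x y mp xI yI; rewrite wextE. Qed.

Lemma l1_01 (W : R -> R -> R) (w : seq bool -> seq bool -> R) k q : graphon W ->
  (forall X Y, 0 <= w X Y <= 1) ->
  0 <= `|wext W q - w (pre (@dmass R) k q.1) (pre (@dmass R) k q.2)| <= 1.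
Proof.
move=> gW w01; rewrite normr_ge0 ler_norml.
have /andP[? ?] := wext01 q gW.
have /andP[? ?] := w01 (pre (@dmass R) k q.1) (pre (@dmass R) k q.2).
by apply/andP; split; lra.
Qed.

Lemma eq_mean2 (f g : R * R -> R) : (forall x y, x \in I01 R -> y \in I01 R -> f (x, y) = g (x, y)) ->
  mean2 f = mean2 g.
Proof. by move=> fg; apply: eq_mean => x xI; apply: eq_mean => y yI; exact: fg. Qed.

(** The dyadic digits of [phi x] have the same law as those of [x], so both densities are close to
    the density of one and the same finite kernel. *)
Lemma hom_dens_pullback phi W n (F : sgraph n) : mp_map phi -> graphon W ->
  hom_dens (pullback phi W) F = hom_dens W F.
Proof.
move=> mp gW; have gP := graphon_pullback mp gW.
apply: (@eq_eps _ _ _ (2 * n%:R ^+ 2)); first by rewrite mulr_ge0// exprn_ge0.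
move=> e e0; have [k [w [w01 wC hw]]] := graphon_dyadic_approx gW e0.
have mT := @fmeas_pret R (@dmass R) k; have mx := measurable_mpx mp.
pose T x := pret (@dmass R) k (mpx phi x).
have mT' : fmeas T.
  move=> X; rewrite -[X in measurable X]setTI; exact: (mx measurableT _ (mT X)).
have h1 := hom_dens_tfin mT (fun X Y => w01 X Y) (fun X Y => wC X Y) gW F.
have h2 := hom_dens_tfin mT' (fun X Y => w01 X Y) (fun X Y => wC X Y) gP F.
have lawE : law T = law (pret (@dmass R) k).
  apply/funext => X; rewrite /law.
  apply: (mean_mp (f := fun x => (pret (@dmass R) k x == X)%:R)) => //; first exact: bmeas_cell.
  by move=> x; case: (_ == X); rewrite ?lexx ?ler01.
rewrite lawE in h2.
have b1 : n%:R ^+ 2 * l1dist (pret (@dmass R) k) (fun X Y => w X Y) W <= n%:R ^+ 2 * e.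
  by rewrite ler_wpM2l ?exprn_ge0.
have b2 : n%:R ^+ 2 * l1dist T (fun X Y => w X Y) (pullback phi W) <= n%:R ^+ 2 * e.
  apply: ler_wpM2l; [by rewrite exprn_ge0|apply: le_trans hw].
  rewrite -(@mean2_mp phi (fun q => `|wext W q - w (pre (@dmass R) k q.1) (pre (@dmass R) k q.2)|) mp).
  - rewrite le_eqVlt; apply/orP; left; apply/eqP.
    by apply: eq_mean2 => x y xI yI; rewrite wext_pullback.
  - by apply: bmeas_norm; apply: bmeasB; [exact: bmeas_wext|exact: bmeas_dfin].
  - by move=> q; exact: l1_01.
rewrite -mulrA; exact: dist_via (le_trans h2 b2) (le_trans h1 b1).
Qed.

Lemma hom_dens_eq_L1 (W1 W2 : R -> R -> R) n (F : sgraph n) : graphon W1 -> graphon W2 ->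
  mean2 (fun q => `|wext W1 q - wext W2 q|) = 0 -> hom_dens W1 F = hom_dens W2 F.
Proof.
move=> g1 g2 h0.
apply: (@eq_eps _ _ _ (2 * n%:R ^+ 2)); first by rewrite mulr_ge0// exprn_ge0.
move=> e e0; have [k [w [w01 wC hw]]] := graphon_dyadic_approx g1 e0.
have mT := @fmeas_pret R (@dmass R) k.
have h1 := hom_dens_tfin mT (fun X Y => w01 X Y) (fun X Y => wC X Y) g1 F.
have h2 := hom_dens_tfin mT (fun X Y => w01 X Y) (fun X Y => wC X Y) g2 F.
have b1 : n%:R ^+ 2 * l1dist (pret (@dmass R) k) (fun X Y => w X Y) W1 <= n%:R ^+ 2 * e.
  by rewrite ler_wpM2l ?exprn_ge0.
have bw1 := bmeas_wext g1; have bw2 := bmeas_wext g2.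
have bd := bmeas_dfin (@dmass R) k w.
have b2 : n%:R ^+ 2 * l1dist (pret (@dmass R) k) (fun X Y => w X Y) W2 <= n%:R ^+ 2 * e.
  apply: ler_wpM2l; [by rewrite exprn_ge0|apply: le_trans hw].
  rewrite -[leRHS]add0r -h0 -mean2D; [|by apply: bmeas_norm; apply: bmeasB..].
  apply: ler_mean2; first by apply: bmeas_norm; apply: bmeasB.
    by apply: bmeasD; apply: bmeas_norm; apply: bmeasB.
  by move=> x y _ _ /=; rewrite [X in _ <= X + _]distrC; exact: ler_distD.
rewrite -mulrA; exact: dist_via (le_trans h1 b1) (le_trans h2 b2).
Qed.

Lemma weakly_iso_mean2 (phi psi : R -> R) (W1 W2 : R -> R -> R) :
  mp_map phi -> mp_map psi -> graphon W1 -> graphon W2 ->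
  (leb \x leb)%E.-negligible [set p : R * R | p \in I01 R `*` I01 R /\
         W1 (phi p.1) (phi p.2) <> W2 (psi p.1) (psi p.2)] <->
  mean2 (fun q => `|wext (pullback phi W1) q - wext (pullback psi W2) q|) = 0.
Proof.
move=> mp1 mp2 g1 g2.
have gp1 := graphon_pullback mp1 g1; have gp2 := graphon_pullback mp2 g2.
pose f q := wext (pullback phi W1) q - wext (pullback psi W2) q.
have bf : bmeas f by apply: bmeasB; exact: bmeas_wext.
have bnf := bmeas_norm bf.
have mI2 : measurable (I01 R `*` I01 R) by apply: measurableX; exact: measurable_I01.
have mf : measurable_fun (I01 R `*` I01 R) (EFin \o f).
  by apply/measurable_EFinP; case: bf => m _; exact: measurable_funS m.
have fE x y : x \in I01 R -> y \in I01 R -> (f (x, y) = 0 <-> W1 (phi x) (phi y) = W2 (psi x) (psi y)).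
  move=> xI yI; rewrite /f !wextE// /pullback !mpxE//.
  have [_ h1 _] := mp1; have [_ h2 _] := mp2.
  rewrite !wextE ?h1 ?h2//; split => [/eqP|->]; last by rewrite subrr.
  by rewrite subr_eq0 => /eqP.
have := @ae_eq_integral_abs _ _ _ (leb \x leb)%E _ mI2 (EFin \o f) mf.
have -> : (\int[leb \x leb]_(q in I01 R `*` I01 R) `|(EFin \o f) q|)%E =
   (mean2 (fun q => `|f q|))%:E by rewrite mean2E.
set S := [set p : R * R | _].
have setE : S = ~` [set q | (I01 R `*` I01 R) q -> (EFin \o f) q = cst 0%E q].
  apply/seteqP; split => -[x y] /=.
    move=> [pI nW] h; have [/= xI yI] := set_mem pI; apply: nW.
    by apply/fE; rewrite ?inE//; have [] := h (conj xI yI).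
  move=> /not_implyP[[/= xI yI] nf]; split; first by rewrite inE.
  by move=> h; apply: nf; congr EFin; apply/fE; rewrite ?inE.
move=> h; split.
  rewrite setE => hn; have := h.2 hn.
  by move=> [].
move=> h0; rewrite setE; apply: h.1.
by rewrite h0.
Qed.

Lemma weakly_iso_hom_dens (W1 W2 : R -> R -> R) n (F : sgraph n) :
  graphon W1 -> graphon W2 -> weakly_iso W1 W2 -> hom_dens W1 F = hom_dens W2 F.
Proof.
move=> g1 g2 [phi [psi [mp1 mp2 hn]]].
have h := (weakly_iso_mean2 mp1 mp2 g1 g2).1 hn.
rewrite -(hom_dens_pullback F mp1 g1) -(hom_dens_pullback F mp2 g2).
by apply: hom_dens_eq_L1; [exact: graphon_pullback|exact: graphon_pullback|exact: h].
Qed.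

End MeasurePreserving.

(** * Coupling graphons with equal densities *)

Section SampleGraphon.
Context {R : realType}.
Notation dpre := (pre (@dmass R)).

(** Probability that the [W]-random graph is [E], written through densities only, hence equal for
    graphons with equal densities. *)
Definition wmoebius (W : R -> R -> R) n (E : {set {set 'I_n}}) : R :=
  \sum_(B : {set {set 'I_n}} | (E \subset B) && (B \subset pairs n))
     (-1) ^+ #|(B :\: E)%SET| * hom_dens W (mksg B).

Definition trunc_tuple j k (X : (j + k).-tuple bool) : k.-tuple bool :=
  Tuple (introT eqP (etrans (size_drop j X) (etrans (congr1 (subn^~ j) (size_tuple X)) (addKn j k)))).

Lemma push_dmass j k (Y : k.-tuple bool) :
  push (law (pret (@dmass R) (j + k))) (@trunc_tuple j k) Y = dmass Y.
Proof.
have mT := @fmeas_pret R (@dmass R) (j + k).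
rewrite -(law_pret (@bitmass_dmass R)) /law.
have -> : (fun x => (pret (@dmass R) k x == Y)%:R : R) =
    (fun x => (trunc_tuple (pret (@dmass R) (j + k) x) == Y)%:R).
  by apply/funext => x; congr (nat_of_bool (_ == _))%:R; apply: val_inj; rewrite /= drop_pre.
rewrite (mean_fin mT (fun X => (trunc_tuple X == Y)%:R)) /push [LHS]big_mkcond.
by apply: eq_bigr => X _ /=; case: (_ == Y); rewrite ?mulr1 ?mulr0.
Qed.

(** Two resolutions: a step kernel at distance [de] generates the law [P], while the coarser [w] at
    distance [e] describes the blocks. The error of [P] grows with [n], so [de] has to be chosen
    after [n], whereas [w] stays fixed. *)
Lemma sample_graphon (W : R -> R -> R) (w : seq bool -> seq bool -> R) (K n : nat) (e eta de : R) :
  graphon W -> (forall X Y, 0 <= w X Y <= 1) -> (forall X Y, w X Y = w Y X) ->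
  stepapprox (wext W) e K w -> (0 < n)%N -> 0 < eta -> 0 < de -> de <= e ->
  exists (good : pred {set {set 'I_n}}) (P : {set {set 'I_n}} -> R),
  [/\ forall E, good E -> exists s : {ffun 'I_n -> K.-tuple bool},
        (forall X, `|freq R s X - dmass X| <= eta) /\
        (forall S T : {set 'I_n}, `|\sum_(i in S) \sum_(j in T) n%:R^-1 ^+ 2 *
           ((i != j)%:R * (([set i; j]%SET \in E)%:R - w (s i) (s j)))| <= 16 * e + eta),
      forall E, 0 <= P E,
      \sum_(E : {set {set 'I_n}} | E \subset pairs n) P E = 1,
      \sum_(E : {set {set 'I_n}} | (E \subset pairs n) && ~~ good E) P E <=
        #|{: K.-tuple bool}|%:R * n%:R^-1 / eta ^+ 2 + 8^-1 + 2 * n%:R^-1 / eta ^+ 4 &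
      forall E : {set {set 'I_n}}, E \subset pairs n -> `|P E - wmoebius W E| <= #|{: {set {set 'I_n}}}|%:R * (n%:R ^+ 2 * de)].
Proof.
move=> gW w01 wC hw n0 eta0 de0 dee.
have e0 : 0 < e by exact: lt_le_trans dee.
have [k [wf [wf01 wfC hwf]]] := graphon_dyadic_approx gW de0.
pose V := (k + K).-tuple bool.
have mT := @fmeas_pret R (@dmass R) (k + K).
pose a : V -> R := law (pret (@dmass R) (k + K)).
pose wv (X Y : V) := wf (drop K X) (drop K Y).
have a0 X : 0 <= a X by exact: law_ge0.
have a1 : \sum_X a X = 1 by exact: law_sum1.
have wv01 X Y : 0 <= wv X Y <= 1 by exact: wf01.
have wvC X Y : wv X Y = wv Y X by exact: wfC.
have dK x : drop K (dpre (k + K) x) = dpre k x by rewrite addnC drop_pre.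
have bW := bmeas_wext gW.
have bf := bmeas_dfin (@dmass R) k wf; have bw := bmeas_dfin (@dmass R) K w.
have l1 : \sum_x \sum_y a x * a y * `|wv x y - w (trunc_tuple x) (trunc_tuple y)| <= 2 * e.
  rewrite /a -(mean2_fin mT (fun X Y => `|wv X Y - w (trunc_tuple X) (trunc_tuple Y)|)).
  apply: (@le_trans _ _ (mean2 (fun q : R * R => `|wext W q - wf (dpre k q.1) (dpre k q.2)| +
     `|wext W q - w (dpre K q.1) (dpre K q.2)|))).
    apply: ler_mean2.
    - exact: (bmeas_fin2 mT (fun X Y => `|wv X Y - w (trunc_tuple X) (trunc_tuple Y)|)).
    - by apply: bmeasD; apply: bmeas_norm; apply: bmeasB.
    - move=> x y _ _; rewrite /wv /= !dK !drop_pre [X in _ <= X + _]distrC.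
      exact: ler_distD.
  rewrite mean2D; [|by apply: bmeas_norm; apply: bmeasB..].
  have h1 : mean2 (fun q : R * R => `|wext W q - wf (dpre k q.1) (dpre k q.2)|) <= e.
    exact: le_trans hwf dee.
  by apply: le_trans (lerD h1 hw) _; rewrite mulr_natl mulr2n.
(* The two step kernels are within [2 * e] in L1, so the threshold [16 * e] fails with probability
   at most 1/8. *)
have ka0 : 0 < 16 * e by rewrite mulr_gt0.
have [good [hgood hbad]] := sampling (@trunc_tuple k K) (fun X Y => w X Y) a0 a1 wv01 wvC n0 eta0 ka0.
exists good, (fun E => fexp a (fun phi => gprob wv phi E)); split.
- move=> E gE; have [s [h1 h2]] := hgood E gE; exists s; split => // X.
  by rewrite -(push_dmass k).
- by move=> E; apply: fexp_ge0 => // phi; exact: gprob_ge0.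
- rewrite -fexp_sum -[RHS](fexp_cst 'I_n a1); apply: eq_fexp => phi.
  exact: gprob_sum.
- apply: le_trans hbad _; rewrite lerD2r lerD2l ler_pdivrMr//.
  by apply: le_trans l1 _; rewrite mulrA ler_wpM2r ?(ltW e0)//; lra.
- move=> E EA; rewrite -tfin_moebius// /wmoebius -sumrB.
  apply: le_trans (ler_norm_sum _ _ _) _.
  rewrite -[X in X%:R * _]/(#|(predT : pred {set {set 'I_n}})|) mulr_natl -sumr_const.
  rewrite big_mkcond; apply: ler_sum => B _ /=; case: ifPn => [/andP[_ BA]|_]; last first.
    by rewrite mulr_ge0 ?exprn_ge0// ltW.
  rewrite -mulrBr normrM normrX normrN1 expr1n mul1r distrC.
  have h := hom_dens_tfin mT wv01 wvC gW (mksg B); rewrite val_mksg// in h.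
  apply: le_trans h _; apply: ler_wpM2l; first by rewrite exprn_ge0.
  apply: le_trans hwf; rewrite le_eqVlt; apply/orP; left; apply/eqP.
  by congr mean2; apply/funext => q; rewrite /wv /= !dK.
Qed.

(** One graph [E] typical for both graphons is compared with either step kernel; subtracting the two
    cut estimates eliminates [E] and matches the blocks of vertex [i] in the two graphons. *)
Lemma sample_coupling (W1 W2 : R -> R -> R) (w1 w2 : seq bool -> seq bool -> R) (K : nat) (e eta : R) :
  graphon W1 -> graphon W2 -> (forall n (F : sgraph n), hom_dens W1 F = hom_dens W2 F) ->
  (forall X Y, 0 <= w1 X Y <= 1) -> (forall X Y, w1 X Y = w1 Y X) ->
  (forall X Y, 0 <= w2 X Y <= 1) -> (forall X Y, w2 X Y = w2 Y X) ->
  stepapprox (wext W1) e K w1 -> stepapprox (wext W2) e K w2 -> 0 < e -> 0 < eta ->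
  exists n (s t : {ffun 'I_n -> K.-tuple bool}), [/\ (0 < n)%N,
    forall X, `|freq R s X - dmass X| <= eta, forall X, `|freq R t X - dmass X| <= eta,
    n%:R^-1 <= eta &
    forall S T : {set 'I_n}, `|\sum_(i in S) \sum_(j in T) n%:R^-1 ^+ 2 *
           ((i != j)%:R * (w1 (s i) (s j) - w2 (t i) (t j)))| <= 2 * (16 * e + eta)].
Proof.
move=> g1 g2 hom12 w101 w1C w201 w2C hw1 hw2 e0 eta0.
(* The coefficient of [1 / n] in the failure probability: with [A / n <= 1/8] and the fixed 1/8,
   failure has probability at most 1/4. *)
pose A : R := #|{: K.-tuple bool}|%:R / eta ^+ 2 + 2 / eta ^+ 4.
have A0 : 0 <= A by rewrite addr_ge0// divr_ge0// exprn_ge0// ltW.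
have [n [n0 nA neta]] : exists n, [/\ (0 < n)%N, A * n%:R^-1 <= 8^-1 & n%:R^-1 <= eta].
  pose B := 8 * A + eta^-1.
  have B0 : 0 <= B by rewrite addr_ge0 ?mulr_ge0 ?invr_ge0// ltW.
  have hB := ltW (archi_boundP B0); exists (Num.bound B).+1.
  have hB' : B <= (Num.bound B).+1%:R by apply: le_trans hB _; rewrite ler_nat.
  have N0 : 0 < (Num.bound B).+1%:R :> R by rewrite ltr0n.
  have i0 : 0 < eta^-1 by rewrite invr_gt0.
  split=> //.
    by rewrite ler_pdivrMr// ler_pdivlMl//; apply: le_trans hB'; rewrite lerDl ltW.
  rewrite -[eta]invrK lef_pV2 ?posrE//; apply: le_trans hB'.
  by rewrite lerDr mulr_ge0.
pose N2 : R := #|{: {set {set 'I_n}}}|%:R.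
have N20 : 0 <= N2 by [].
pose Z := N2 * (N2 * (n%:R ^+ 2)).
have Z0 : 0 <= Z by rewrite !mulr_ge0// exprn_ge0.
(* Gives [Z * de <= 1/8], so the two sampling laws differ by at most [2 * Z * de <= 1/4] in
   total. *)
pose de := Num.min e (8 * Z + 1)^-1.
have Z1 : 0 < 8 * Z + 1 by rewrite ltr_wpDl// mulr_ge0.
have de0 : 0 < de by rewrite lt_min e0 invr_gt0.
have dee : de <= e by rewrite ge_min lexx.
have Zde : Z * de <= 8^-1.
  apply: (@le_trans _ _ (Z * (8 * Z + 1)^-1)); first by rewrite ler_wpM2l// ge_min lexx orbT.
  by rewrite ler_pdivrMr// ler_pdivlMl// lerDl.
have [good1 [P1 [hg1 P10 P1s hb1 hm1]]] := sample_graphon g1 w101 w1C hw1 n0 eta0 de0 dee.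
have [good2 [P2 [hg2 P20 P2s hb2 hm2]]] := sample_graphon g2 w201 w2C hw2 n0 eta0 de0 dee.
have bE : #|{: K.-tuple bool}|%:R * n%:R^-1 / eta ^+ 2 + 8^-1 + 2 * n%:R^-1 / eta ^+ 4 <= 4^-1 :> R.
  have -> : #|{: K.-tuple bool}|%:R * n%:R^-1 / eta ^+ 2 + 8^-1 + 2 * n%:R^-1 / eta ^+ 4 =
    A * n%:R^-1 + 8^-1 :> R by rewrite /A; ring.
  by move: nA; lra.
have {}hb1 := le_trans hb1 bE; have {}hb2 := le_trans hb2 bE.
have dP (E : {set {set 'I_n}}) : E \subset pairs n -> P1 E <= P2 E + 2 * (N2 * (n%:R ^+ 2 * de)).
  move=> EA; have := hm1 E EA; have := hm2 E EA.
  have -> : wmoebius W2 E = wmoebius W1 E by apply: eq_bigr => B _; rewrite hom12.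
  rewrite -/N2; set m := wmoebius W1 E; set z := N2 * _.
  by rewrite !ler_norml => /andP[? ?] /andP[? ?]; lra.
(* Otherwise the whole mass of [P1] lies on graphs bad for one of the two, which carry at most 1/4
   for each failure and 1/4 for the change of law. *)
have [E EA /andP[G1 G2]] : exists2 E : {set {set 'I_n}}, E \subset pairs n & good1 E && good2 E.
  apply/exists_inP; apply: contraT; rewrite negb_exists_in => /forall_inP hN; exfalso.
  have h : \sum_(E : {set {set 'I_n}} | E \subset pairs n) P1 E <=
     \sum_(E : {set {set 'I_n}} | (E \subset pairs n) && ~~ good1 E) P1 E +
     (\sum_(E : {set {set 'I_n}} | (E \subset pairs n) && ~~ good2 E) P2 E +
      \sum_(E : {set {set 'I_n}}) 2 * (N2 * (n%:R ^+ 2 * de))).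
    rewrite [leLHS]big_mkcond [X in _ <= X + _]big_mkcond [X in _ + (X + _)]big_mkcond -!big_split /=.
    apply: ler_sum => E _.
    have c0 : 0 <= 2 * (N2 * (n%:R ^+ 2 * de)) by rewrite !mulr_ge0// ?exprn_ge0// ltW.
    case: (boolP (E \subset pairs n)) => EA /=; last by rewrite !add0r.
    have := hN E EA; rewrite negb_and; case: (good1 E) => /=.
      by move=> ->; rewrite add0r; exact: dP.
    move=> _; rewrite lerDl addr_ge0//; by case: ifP.
  have s3 : \sum_(E : {set {set 'I_n}}) 2 * (N2 * (n%:R ^+ 2 * de)) <= 4^-1.
    rewrite sumr_const -[leLHS]mulr_natl -/N2.
    have -> : N2 * (2 * (N2 * (n%:R ^+ 2 * de))) = 2 * (Z * de) by rewrite /Z; ring.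
    by move: Zde; lra.
  by move: h hb1 hb2 s3; rewrite P1s; lra.
have [s [s1 s2]] := hg1 E G1; have [t [t1 t2]] := hg2 E G2.
exists n, s, t; split => // S T.
have -> : \sum_(i in S) \sum_(j in T) n%:R^-1 ^+ 2 * ((i != j)%:R * (w1 (s i) (s j) - w2 (t i) (t j))) =
  \sum_(i in S) \sum_(j in T) n%:R^-1 ^+ 2 * ((i != j)%:R * (([set i; j]%SET \in E)%:R - w2 (t i) (t j))) -
  \sum_(i in S) \sum_(j in T) n%:R^-1 ^+ 2 * ((i != j)%:R * (([set i; j]%SET \in E)%:R - w1 (s i) (s j))).
  by rewrite -sumrB; apply: eq_bigr => i _; rewrite -sumrB; apply: eq_bigr => j _; ring.
rewrite (le_trans (ler_normB _ _))//; have := s2 S T; have := t2 S T; lra.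
Qed.

End SampleGraphon.

(* A coupling of two bit strings is coded by interleaving them. *)
Fixpoint mrg (X Y : seq bool) : seq bool :=
  if X is a :: X' then if Y is b :: Y' then a :: b :: mrg X' Y' else [::] else [::].

Fixpoint evs (Z : seq bool) : seq bool := if Z is a :: (_ :: Z') then a :: evs Z' else [::].
Fixpoint ods (Z : seq bool) : seq bool := if Z is _ :: (b :: Z') then b :: ods Z' else [::].

Lemma size_mrg X Y : size X = size Y -> size (mrg X Y) = (size X).*2.
Proof. by elim: X Y => [|a X IH] [|b Y] //= [] /IH ->. Qed.

Lemma drop_mrg j X Y : size X = size Y -> drop j.*2 (mrg X Y) = mrg (drop j X) (drop j Y).
Proof.
elim: j X Y => [|j IH] [|a X] [|b Y] //= [] /IH <-; by rewrite ?drop0.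
Qed.

Lemma evs_mrg X Y : size X = size Y -> evs (mrg X Y) = X.
Proof. by elim: X Y => [|a X IH] [|b Y] //= [] /IH ->. Qed.

Lemma ods_mrg X Y : size X = size Y -> ods (mrg X Y) = Y.
Proof. by elim: X Y => [|a X IH] [|b Y] //= [] /IH ->. Qed.

(** * Empirical joint law of two block assignments *)

Section Empirical.
Variables (R : realFieldType) (n K : nat) (s t : {ffun 'I_n -> K.-tuple bool}).
Hypothesis n_gt0 : (0 < n)%N.

Definition zpt (i : 'I_n) : seq bool := mrg (s i) (t i).

Lemma size_zpt i : size (zpt i) = K.*2.
Proof. by rewrite size_mrg !size_tuple. Qed.

(** For strings longer than the joint codes the subtraction truncates to 0 and the mass vanishes, so
    the splitting rule is available only below length [K.*2]. *)
Definition emass (X : seq bool) : R := \sum_i n%:R^-1 * (drop (K.*2 - size X) (zpt i) == X)%:R.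

Lemma inv_sum1 : \sum_(i < n) n%:R^-1 = 1 :> R.
Proof. by rewrite sumr_const card_ord -[LHS]mulr_natr mulVf// pnatr_eq0 -lt0n. Qed.

Lemma emass01 X : 0 <= emass X <= 1.
Proof.
apply/andP; split; first by apply: sumr_ge0 => i _; rewrite mulr_ge0 ?invr_ge0.
rewrite -inv_sum1; apply: ler_sum => i _; rewrite ler_piMr ?invr_ge0//.
by case: (_ == X); rewrite ?lexx ?ler01.
Qed.

Lemma emass_nil : emass [::] = 1.
Proof.
rewrite -inv_sum1; apply: eq_bigr => i _; rewrite subn0 drop_oversize ?size_zpt//.
by rewrite eqxx mulr1.
Qed.

Lemma emass_split X : (size X < K.*2)%N -> emass X = emass (false :: X) + emass (true :: X).
Proof.
move=> sX; rewrite /emass -big_split /=; apply: eq_bigr => i _.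
rewrite -mulrDr; congr (_ * _).
have sz := size_zpt i; set m := (K.*2 - (size X).+1)%N.
have -> : (K.*2 - size X)%N = m.+1 by rewrite /m; lia.
rewrite (drop_nth false (_ : m < size (zpt i))%N) ?sz ?/m; last by lia.
rewrite !eqseq_cons; case: (nth _ _ _); case: (_ == X); by rewrite /= ?addr0 ?add0r.
Qed.

Lemma emass_sum m (h : seq bool -> R) : (m <= K.*2)%N ->
  \sum_(X : m.-tuple bool) emass X * h X = \sum_i n%:R^-1 * h (drop (K.*2 - m) (zpt i)).
Proof.
move=> mK.
have sd i : size (drop (K.*2 - m) (zpt i)) == m by rewrite size_drop size_zpt subKn.
transitivity (\sum_(X : m.-tuple bool) \sum_i n%:R^-1 * ((drop (K.*2 - m) (zpt i) == X)%:R * h X)).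
  apply: eq_bigr => X _; rewrite /emass size_tuple mulr_suml.
  by apply: eq_bigr => i _; rewrite mulrA.
rewrite exchange_big /=; apply: eq_bigr => i _; rewrite -mulr_sumr; congr (_ * _).
rewrite (bigD1 (Tuple (sd i))) //= eqxx mul1r big1 ?addr0// => X /negbTE ne.
by rewrite (_ : (_ == _) = false) ?mul0r// -ne -val_eqE eq_sym.
Qed.

End Empirical.

Section FiniteEstimates.
Variable R : realFieldType.

(** The integrand is constant on each product of two cells, so nothing cancels there. This is what
    turns cut bounds into L1 bounds. *)
Lemma cells_norm_sum (I T : finType) (c : R) (Z : I -> T) (f : T -> T -> R) : 0 <= c ->
  \sum_i \sum_j c * `|f (Z i) (Z j)| =
  \sum_z \sum_z' `|\sum_(i | Z i == z) \sum_(j | Z j == z') c * f (Z i) (Z j)|.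
Proof.
move=> c0; rewrite (partition_big Z xpredT) //=; apply: eq_bigr => z _.
transitivity (\sum_(i | Z i == z) \sum_z' \sum_(j | Z j == z') c * `|f (Z i) (Z j)|).
  by apply: eq_bigr => i _; rewrite (partition_big Z xpredT).
rewrite exchange_big /=; apply: eq_bigr => z' _.
have sE (g : R) : \sum_(i | Z i == z) \sum_(j | Z j == z') c * g =
   (\sum_(i | Z i == z) \sum_(j | Z j == z') c) * g.
  by rewrite mulr_suml; apply: eq_bigr => i _; rewrite mulr_suml.
rewrite (eq_bigr (fun i => \sum_(j | Z j == z') c * `|f z z'|)); last first.
  by move=> i /eqP ->; apply: eq_bigr => j /eqP ->.
rewrite [X in _ = `|X|](eq_bigr (fun i => \sum_(j | Z j == z') c * f z z')); last first.
  by move=> i /eqP ->; apply: eq_bigr => j /eqP ->.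
rewrite !sE normrM ger0_norm//.
by apply: sumr_ge0 => i _; apply: sumr_ge0.
Qed.

Lemma tv_sum2 (T : finType) (f u : T -> R) (g : T -> T -> R) (e : R) :
  (forall x, 0 <= f x) -> \sum_x f x = 1 -> (forall x, 0 <= u x) -> \sum_x u x = 1 ->
  \sum_x `|f x - u x| <= e -> (forall x y, 0 <= g x y <= 1) ->
  \sum_x \sum_y f x * f y * g x y <= \sum_x \sum_y u x * u y * g x y + 2 * e.
Proof.
move=> f0 f1 u0 u1 fu g01.
apply: (@le_trans _ _ (\sum_x \sum_y (u x * u y * g x y + (f x * `|f y - u y| + `|f x - u x| * u y)))).
  apply: ler_sum => x _; apply: ler_sum => y _.
  have /andP[g0 g1] := g01 x y.
  have -> : f x * f y * g x y = u x * u y * g x y + (f x * (f y - u y) + (f x - u x) * u y) * g x y by ring.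
  rewrite lerD2l (le_trans (ler_norm _))// normrM [`|g x y|]ger0_norm//.
  apply: le_trans (ler_piMr (normr_ge0 _) g1) _.
  rewrite (le_trans (ler_normD _ _))// !normrM [`|f x|]ger0_norm// [`|u y|]ger0_norm//.
rewrite (eq_bigr (fun x => \sum_y u x * u y * g x y + (f x * (\sum_y `|f y - u y|) + `|f x - u x|))); last first.
  by move=> x _; rewrite big_split /= big_split /= -!mulr_sumr u1 mulr1.
rewrite big_split /= lerD2l big_split /= -mulr_suml f1 mul1r mulr_natl mulr2n.
exact: lerD.
Qed.

Lemma freq_ge0 (D : finType) n (s : 'I_n -> D) d : 0 <= freq R s d.
Proof. by apply: sumr_ge0 => i _; rewrite mulr_ge0 ?invr_ge0. Qed.

Lemma freq_sum (D : finType) n (s : 'I_n -> D) (h : D -> R) :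
  \sum_d freq R s d * h d = \sum_i n%:R^-1 * h (s i).
Proof.
transitivity (\sum_d \sum_i n%:R^-1 * ((s i == d)%:R * h d)).
  by apply: eq_bigr => d _; rewrite /freq mulr_suml; apply: eq_bigr => i _; rewrite mulrA.
rewrite exchange_big /=; apply: eq_bigr => i _; rewrite -mulr_sumr; congr (_ * _).
rewrite (bigD1 (s i)) //= eqxx mul1r big1 ?addr0// => d /negbTE ne.
by rewrite eq_sym ne mul0r.
Qed.

Lemma freq_sum1 (D : finType) n (s : 'I_n -> D) : (0 < n)%N -> \sum_d freq R s d = 1.
Proof.
move=> n0; rewrite -(inv_sum1 R n0).
transitivity (\sum_d freq R s d * 1); first by apply: eq_bigr => d _; rewrite mulr1.
by rewrite (freq_sum s (fun=> 1)); apply: eq_bigr => i _; rewrite mulr1.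
Qed.

Lemma freq_sum2 (D : finType) n (s : 'I_n -> D) (h : D -> D -> R) :
  \sum_x \sum_y freq R s x * freq R s y * h x y = \sum_i \sum_j n%:R^-1 ^+ 2 * h (s i) (s j).
Proof.
transitivity (\sum_x freq R s x * \sum_j n%:R^-1 * h x (s j)).
  apply: eq_bigr => x _; rewrite -freq_sum mulr_sumr; by apply: eq_bigr => y _; rewrite mulrA.
rewrite (freq_sum s (fun x => \sum_j n%:R^-1 * h x (s j))).
by apply: eq_bigr => i _; rewrite mulr_sumr; apply: eq_bigr => j _; rewrite mulrA expr2.
Qed.

End FiniteEstimates.

(** * From cut bounds to L1 bounds at fixed resolution *)

Section Stage.
Context {R : realType} (W1 W2 : R -> R -> R).
Hypothesis g1 : graphon W1.
Hypothesis g2 : graphon W2.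
Hypothesis hom12 : forall n (F : sgraph n), hom_dens W1 F = hom_dens W2 F.
Notation dpre := (pre (@dmass R)).

Record stage := Stage {
  stK : nat; stw1 : seq bool -> seq bool -> R; stw2 : seq bool -> seq bool -> R;
  stn : nat; sts : {ffun 'I_stn -> stK.-tuple bool}; stt : {ffun 'I_stn -> stK.-tuple bool} }.

(** The constant 34 bounds the [2 * (16 * e + eta)] of [sample_coupling] for [eta <= e]. *)
Record stage_ok (e : R) (S : stage) : Prop := StageOk {
  so_w1 : forall X Y, 0 <= stw1 S X Y <= 1;
  so_w2 : forall X Y, 0 <= stw2 S X Y <= 1;
  so_a1 : stepapprox (wext W1) e (stK S) (stw1 S);
  so_a2 : stepapprox (wext W2) e (stK S) (stw2 S);
  so_n : (0 < stn S)%N;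
  so_f1 : \sum_X `|freq R (sts S) X - dmass X| <= e;
  so_f2 : \sum_X `|freq R (stt S) X - dmass X| <= e;
  so_inv : (stn S)%:R^-1 <= e;
  so_cut : forall A B : {set 'I_(stn S)}, `|\sum_(i in A) \sum_(j in B) (stn S)%:R^-1 ^+ 2 *
     ((i != j)%:R * (stw1 S (sts S i) (sts S j) - stw2 S (stt S i) (stt S j)))| <= 34 * e }.

Lemma stepapprox_lift (g : R * R -> R) e k j w : stepapprox g e k w ->
  stepapprox g e (j + k) (fun X Y => w (drop j X) (drop j Y)).
Proof.
rewrite /stepapprox => h; rewrite (_ : (fun q => _) = (fun q => `|g q - w (dpre k q.1) (dpre k q.2)|))//.
by apply/funext => q; rewrite !drop_pre.
Qed.

Lemma exists_stage (r : nat) (e : R) : 0 < e -> exists S, (r <= stK S)%N /\ stage_ok e S.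
Proof.
move=> e0.
have [k1 [u1 [u101 u1C hu1]]] := graphon_dyadic_approx g1 e0.
have [k2 [u2 [u201 u2C hu2]]] := graphon_dyadic_approx g2 e0.
pose K := (r + k1 + k2)%N.
pose w1 X Y := u1 (drop (r + k2) X) (drop (r + k2) Y).
pose w2 X Y := u2 (drop (r + k1) X) (drop (r + k1) Y).
have hw1 : stepapprox (wext W1) e K w1.
  by have := stepapprox_lift (r + k2) hu1; rewrite (_ : (r + k2 + k1 = K)%N)// /K; lia.
have hw2 : stepapprox (wext W2) e K w2 by exact: (stepapprox_lift (r + k1) hu2).
have C0 : 0 < #|{: K.-tuple bool}|%:R + 1 :> R by rewrite ltr_wpDl.
(* Small enough that deviations of at most [eta] summed over all strings stay below [e] in total
   variation. *)
pose eta := e / (#|{: K.-tuple bool}|%:R + 1).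
have eta0 : 0 < eta by rewrite divr_gt0.
have etae : eta <= e by rewrite ler_pdivrMr// ler_peMr ?(ltW e0)// lerDr.
have [n [s [t [n0 hs ht nn hcut]]]] := sample_coupling g1 g2 hom12 (fun X Y => u101 _ _)
  (fun X Y => u1C _ _) (fun X Y => u201 _ _) (fun X Y => u2C _ _) hw1 hw2 e0 eta0.
have tv (f : {ffun 'I_n -> K.-tuple bool}) : (forall X, `|freq R f X - dmass X| <= eta) ->
    \sum_X `|freq R f X - dmass X| <= e.
  move=> hf; apply: (@le_trans _ _ (\sum_(X : K.-tuple bool) eta)); first by apply: ler_sum => X _.
  rewrite sumr_const -[leLHS]mulr_natl mulrA ler_pdivrMr// mulrC ler_wpM2l ?lerDl//.
  exact: ltW.
exists (@Stage K w1 w2 n s t); split; first by rewrite /= /K -addnA leq_addr.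
split=> //=.
- by move=> X Y; exact: u101.
- by move=> X Y; exact: u201.
- exact: tv.
- exact: tv.
- exact: le_trans etae.
- by move=> A B; apply: le_trans (hcut A B) _; lra.
Qed.

Variables (e eq : R) (S : stage) (Kq : nat) (v1 v2 : seq bool -> seq bool -> R).
Hypothesis okS : stage_ok e S.
Hypothesis e_ge0 : 0 <= e.
Hypothesis KqK : (Kq <= stK S)%N.
Hypothesis v101 : forall X Y, 0 <= v1 X Y <= 1.
Hypothesis v201 : forall X Y, 0 <= v2 X Y <= 1.
Hypothesis hv1 : stepapprox (wext W1) eq Kq v1.
Hypothesis hv2 : stepapprox (wext W2) eq Kq v2.

Let n := stn S.
Let c : R := n%:R^-1.
Let K := stK S.
Let c0 : 0 <= c. Proof. by rewrite invr_ge0. Qed.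

(** Both step kernels approximate [W], which costs [eq + e]; passing from the empirical to the
    uniform law in two variables costs another [2 * e]. *)
Let l1_gap (W : R -> R -> R) (s : {ffun 'I_n -> K.-tuple bool}) (w v : seq bool -> seq bool -> R) :
  graphon W -> (forall X Y, 0 <= w X Y <= 1) -> (forall X Y, 0 <= v X Y <= 1) ->
  stepapprox (wext W) e K w -> stepapprox (wext W) eq Kq v ->
  \sum_X `|freq R s X - dmass X| <= e ->
  \sum_i \sum_j c ^+ 2 * `|v (drop (K - Kq) (s i)) (drop (K - Kq) (s j)) - w (s i) (s j)| <= eq + 3 * e.
Proof.
move=> gW w01 v01 hw hv hf.
pose g (X Y : K.-tuple bool) := `|v (drop (K - Kq) X) (drop (K - Kq) Y) - w X Y|.
have g01 X Y : 0 <= g X Y <= 1.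
  rewrite /g normr_ge0 ler_norml; have /andP[? ?] := w01 X Y.
  have /andP[? ?] := v01 (drop (K - Kq) X) (drop (K - Kq) Y).
  by apply/andP; split; lra.
have d1 : \sum_(X : K.-tuple bool) dmass X = 1 :> R.
  rewrite -(law_sum1 (@fmeas_pret R (@dmass R) K)); apply: eq_bigr => X _.
  by rewrite (law_pret (@bitmass_dmass R)).
rewrite -[leLHS](freq_sum2 s g).
apply: le_trans (tv_sum2 (@freq_ge0 R _ n s) (freq_sum1 R s (so_n okS)) (fun X => bm_ge0 (@bitmass_dmass R) X) d1 hf g01) _.
rewrite -(mean2_pre (@bitmass_dmass R) K (fun X Y => `|v (drop (K - Kq) X) (drop (K - Kq) Y) - w X Y|)).
have bW := bmeas_wext gW.
have bv := bmeas_dfin (@dmass R) Kq v; have bw := bmeas_dfin (@dmass R) K w.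
have dq x : drop (K - Kq) (dpre K x) = dpre Kq x.
  by rewrite -[X in pre _ X _](subnK KqK) drop_pre.
suff h : mean2 (fun q => `|v (drop (K - Kq) (dpre K q.1)) (drop (K - Kq) (dpre K q.2)) - w (dpre K q.1) (dpre K q.2)|) <= eq + e.
  by move: h; set m := mean2 _; lra.
apply: (@le_trans _ _ (mean2 (fun q : R * R => `|wext W q - v (dpre Kq q.1) (dpre Kq q.2)| +
     `|wext W q - w (dpre K q.1) (dpre K q.2)|))).
  apply: ler_mean2.
  - exact: (bmeas_dfin (@dmass R) K (fun X Y => `|v (drop (K - Kq) X) (drop (K - Kq) Y) - w X Y|)).
  - by apply: bmeasD; apply: bmeas_norm; apply: bmeasB.
  - move=> x y _ _; rewrite !dq [X in _ <= X + _]distrC; exact: ler_distD.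
rewrite mean2D; [|by apply: bmeas_norm; apply: bmeasB..].
exact: lerD.
Qed.

Definition joint_gap (Z Z' : seq bool) : R := `|v1 (evs Z) (evs Z') - v2 (ods Z) (ods Z')|.

(** A sum over a pair of cells at level [Kq] is a cut sum of the fine kernels ([34 * e]), plus the
    diagonal missing there (at most [e]), plus the coarse-fine errors. The number of cells depends
    on [Kq] only, so the first term vanishes with [e]. *)
Lemma stage_bound :
  \sum_i \sum_j n%:R^-1 ^+ 2 * joint_gap (drop (K.*2 - Kq.*2) (zpt (sts S) (stt S) i))
     (drop (K.*2 - Kq.*2) (zpt (sts S) (stt S) j)) <=
  #|{: Kq.*2.-tuple bool}|%:R ^+ 2 * (35 * e) + 2 * (eq + 3 * e).
Proof.
set z := zpt (sts S) (stt S).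
have sz (i : 'I_n) : size (sts S i) = size (stt S i) by rewrite !size_tuple.
have dz i : drop (K.*2 - Kq.*2) (z i) = mrg (drop (K - Kq) (sts S i)) (drop (K - Kq) (stt S i)).
  by rewrite -doubleB drop_mrg.
have sd i : size (drop (K.*2 - Kq.*2) (z i)) == Kq.*2.
  by rewrite size_drop size_zpt subKn// leq_double.
pose Z i : Kq.*2.-tuple bool := Tuple (sd i).
pose f (X Y : Kq.*2.-tuple bool) := v1 (evs X) (evs Y) - v2 (ods X) (ods Y).
pose D i j := stw1 S (sts S i) (sts S j) - stw2 S (stt S i) (stt S j).
have D1 i j : `|D i j| <= 1.
  have /andP[? ?] := so_w1 okS (sts S i) (sts S j); have /andP[? ?] := so_w2 okS (stt S i) (stt S j).
  by rewrite /D ler_norml; apply/andP; split; lra.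
have fE i j : f (Z i) (Z j) = v1 (drop (K - Kq) (sts S i)) (drop (K - Kq) (sts S j)) -
    v2 (drop (K - Kq) (stt S i)) (drop (K - Kq) (stt S j)).
  by rewrite /f /= !dz !evs_mrg ?ods_mrg// !size_drop !size_tuple.
have -> : \sum_i \sum_j n%:R^-1 ^+ 2 * joint_gap (drop (K.*2 - Kq.*2) (z i)) (drop (K.*2 - Kq.*2) (z j)) =
   \sum_i \sum_j c ^+ 2 * `|f (Z i) (Z j)| by [].
rewrite (cells_norm_sum Z f) ?exprn_ge0//.
apply: (@le_trans _ _ (\sum_x \sum_y (35 * e + \sum_(i | Z i == x) \sum_(j | Z j == y) c ^+ 2 * `|f (Z i) (Z j) - D i j|))).
  apply: ler_sum => x _; apply: ler_sum => y _.
  have -> : \sum_(i | Z i == x) \sum_(j | Z j == y) c ^+ 2 * f (Z i) (Z j) =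
     \sum_(i | Z i == x) \sum_(j | Z j == y) c ^+ 2 * ((i != j)%:R * D i j) +
     (\sum_(i | Z i == x) \sum_(j | Z j == y) c ^+ 2 * ((i == j)%:R * D i j) +
      \sum_(i | Z i == x) \sum_(j | Z j == y) c ^+ 2 * (f (Z i) (Z j) - D i j)).
    rewrite -!big_split /=; apply: eq_bigr => i _; rewrite -!big_split /=; apply: eq_bigr => j _.
    by case: (i == j) => /=; rewrite ?mul1r ?mul0r; ring.
  have -> : 35 * e = 34 * e + e by ring.
  rewrite -addrA; apply: le_trans (ler_normD _ _) _; apply: lerD.
    have := so_cut okS [set i | Z i == x]%SET [set j | Z j == y]%SET.
    congr (`|_| <= _); apply: eq_big => [i|i _]; first by rewrite inE.
    by apply: eq_bigl => j; rewrite inE.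
  apply: le_trans (ler_normD _ _) _; apply: lerD; last first.
    apply: le_trans (ler_norm_sum _ _ _) _; apply: ler_sum => i _.
    apply: le_trans (ler_norm_sum _ _ _) _; apply: ler_sum => j _.
    by rewrite normrM [`|c ^+ 2|]ger0_norm ?exprn_ge0.
  apply: le_trans (so_inv okS); rewrite -/n -/c.
  apply: le_trans (ler_norm_sum _ _ _) _.
  apply: (@le_trans _ _ (\sum_(i < n) c ^+ 2)).
    rewrite big_mkcond; apply: ler_sum => i _ /=; case: ifP => _; last by rewrite exprn_ge0.
    apply: le_trans (ler_norm_sum _ _ _) _; rewrite big_mkcond (bigD1 i) //=.
    rewrite big1 ?addr0; last first.
      by move=> j ji; case: ifP => // _; rewrite eq_sym (negbTE ji) mul0r mulr0 normr0.
    case: ifP => _; last by rewrite exprn_ge0.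
    by rewrite eqxx mul1r normrM [`|c ^+ 2|]ger0_norm ?exprn_ge0// ler_piMr ?exprn_ge0.
  rewrite (eq_bigr (fun=> c * c)); last by move=> i _; rewrite expr2.
  by rewrite -mulr_sumr (inv_sum1 R (so_n okS)) mulr1.
rewrite (eq_bigr (fun x => \sum_(y : Kq.*2.-tuple bool) 35 * e +
   \sum_y \sum_(i | Z i == x) \sum_(j | Z j == y) c ^+ 2 * `|f (Z i) (Z j) - D i j|)); last first.
  by move=> x _; rewrite big_split.
rewrite big_split /=; apply: lerD.
  by rewrite !sumr_const -[leLHS]mulr_natl -[X in _ * X]mulr_natl mulrA -expr2.
have -> : \sum_x \sum_y \sum_(i | Z i == x) \sum_(j | Z j == y) c ^+ 2 * `|f (Z i) (Z j) - D i j| =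
   \sum_i \sum_j c ^+ 2 * `|f (Z i) (Z j) - D i j|.
  rewrite [RHS](partition_big Z xpredT) //=; apply: eq_bigr => x _.
  rewrite exchange_big /=; apply: eq_bigr => i _.
  by rewrite [RHS](partition_big Z xpredT).
rewrite mulr_natl mulr2n.
apply: le_trans (lerD (l1_gap g1 (so_w1 okS) v101 (so_a1 okS) hv1 (so_f1 okS))
   (l1_gap g2 (so_w2 okS) v201 (so_a2 okS) hv2 (so_f2 okS))).
rewrite -big_split /=; apply: ler_sum => i _; rewrite -big_split /=; apply: ler_sum => j _.
rewrite -mulrDr ler_wpM2l ?exprn_ge0// fE /D.
set a1 := v1 _ _; set a2 := v2 _ _; set b1 := stw1 S _ _; set b2 := stw2 S _ _.
have -> : a1 - a2 - (b1 - b2) = (a1 - b1) - (a2 - b2) by ring.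
exact: ler_normB.
Qed.

End Stage.

Lemma emass_sum2 (R : realFieldType) n K (s t : {ffun 'I_n -> K.-tuple bool}) m
    (h : seq bool -> seq bool -> R) : (m <= K.*2)%N ->
  \sum_(X : m.-tuple bool) \sum_(Y : m.-tuple bool) emass R s t X * emass R s t Y * h X Y =
  \sum_i \sum_j n%:R^-1 ^+ 2 * h (drop (K.*2 - m) (zpt s t i)) (drop (K.*2 - m) (zpt s t j)).
Proof.
move=> mK.
transitivity (\sum_(X : m.-tuple bool) emass R s t X *
    \sum_j n%:R^-1 * h X (drop (K.*2 - m) (zpt s t j))).
  apply: eq_bigr => X _; rewrite -(emass_sum s t (h X) mK) mulr_sumr.
  by apply: eq_bigr => Y _; rewrite mulrA.
rewrite (emass_sum s t (fun X => \sum_j n%:R^-1 * h X (drop (K.*2 - m) (zpt s t j))) mK).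
by apply: eq_bigr => i _; rewrite mulr_sumr; apply: eq_bigr => j _; rewrite mulrA expr2.
Qed.

Section Coupling.
Context {R : realType} (W1 W2 : R -> R -> R).
Hypothesis g1 : graphon W1.
Hypothesis g2 : graphon W2.
Hypothesis hom12 : forall n (F : sgraph n), hom_dens W1 F = hom_dens W2 F.

Definition has_marginal (p : seq bool -> R) (pi : seq bool -> seq bool) : Prop :=
  forall k (A : k.-tuple bool), \sum_(X : k.*2.-tuple bool) p X * (pi X == A)%:R = dmass A.

Lemma dmass_drop_sum j k (A : k.-tuple bool) :
  \sum_(X : (j + k).-tuple bool) dmass X * (drop j X == A)%:R = dmass A :> R.
Proof.
rewrite -[RHS](law_pret (@bitmass_dmass R)) /law.
have -> : (fun x => (pret (@dmass R) k x == A)%:R : R) =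
    (fun x => (drop j (pret (@dmass R) (j + k) x) == A)%:R).
  by apply/funext => x; rewrite /= drop_pre.
rewrite (mean_fin (@fmeas_pret R (@dmass R) (j + k)) (fun X => (drop j X == A)%:R)).
by apply: eq_bigr => X _; rewrite (law_pret (@bitmass_dmass R)).
Qed.

(** The ultralimit of the empirical joint laws of stages with error [1 / (r + 1)]. For the last
    property the kernels of one stage [q] are frozen and tested against all later stages by
    [stage_bound]. *)
Lemma exists_coupling : exists p : seq bool -> R,
  [/\ bitmass p, has_marginal p evs, has_marginal p ods &
   forall e : R, 0 < e -> exists K (v1 v2 : seq bool -> seq bool -> R),
    [/\ forall X Y, 0 <= v1 X Y <= 1, forall X Y, 0 <= v2 X Y <= 1,
      stepapprox (wext W1) e K v1, stepapprox (wext W2) e K v2 &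
      \sum_(Z : K.*2.-tuple bool) \sum_(Z' : K.*2.-tuple bool) p Z * p Z' * joint_gap v1 v2 Z Z' <= 2 * e]].
Proof.
pose eps (r : nat) : R := r.+1%:R^-1.
have eps0 r : 0 < eps r by rewrite invr_gt0 ltr0n.
have eps_lt (e : R) : 0 < e -> exists N, forall r, (N <= r)%N -> eps r <= e.
  move=> e0; exists (Num.bound e^-1) => r Nr.
  rewrite /eps -[e]invrK lef_pV2 ?posrE ?invr_gt0 ?ltr0n//.
  apply: le_trans (ltW (archi_boundP _)) _; first by rewrite invr_ge0 ltW.
  by rewrite ler_nat (leq_trans Nr).
have [S hS] := choice (fun r => exists_stage g1 g2 hom12 r (eps0 r)).
have KS r : (r <= stK (S r))%N by case: (hS r).
have oS r : stage_ok W1 W2 (eps r) (S r) by case: (hS r).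
have [L uL] := exists_ulimit R.
have epsb : bdd eps.
  apply: bdd01 => r; rewrite (ltW (eps0 r)) /= /eps invf_le1 ?ltr0n//.
  by rewrite ler1n.
have Leps : L eps = 0.
  apply: (ul_cvg0 uL) => // e /eps_lt[N hN]; exists N => r /hN.
  by rewrite ger0_norm// ltW.
pose m r X := emass R (sts (S r)) (stt (S r)) X.
have m01 r X : 0 <= m r X <= 1 by exact: emass01 (so_n (oS r)) X.
have bm X : bdd (m^~ X) by exact: bdd01.
pose p X := L (m^~ X).
have bmZ X (c : R) : bdd (fun r => m r X * c) by apply: bddM => //; exact: bdd_cst.
have Lsum k (h : seq bool -> R) :
    \sum_(X : k.-tuple bool) p X * h X = L (fun r => \sum_(X : k.-tuple bool) m r X * h X).
  rewrite (ul_sum uL); last by move=> X; exact: bmZ.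
  apply: eq_bigr => X _; rewrite (ulM uL (bm X) (bdd_cst (h X))).
  by rewrite (ul_cst uL).
have marg (pi : seq bool -> seq bool) (f : forall r, {ffun 'I_(stn (S r)) -> (stK (S r)).-tuple bool}) :
    (forall r, \sum_X `|freq R (f r) X - dmass X| <= eps r) ->
    (forall r i k, (k <= stK (S r))%N ->
       pi (drop ((stK (S r)).*2 - k.*2) (zpt (sts (S r)) (stt (S r)) i)) = drop (stK (S r) - k) (f r i)) ->
    has_marginal p pi.
  move=> hf hpi k A; rewrite (Lsum _ (fun X => (pi X == A)%:R)).
  have bu : bdd (fun r => \sum_(X : k.*2.-tuple bool) m r X * (pi X == A)%:R) by exact: bdd_sum.
  apply/eqP; rewrite -subr_eq0; apply/eqP.
  rewrite -[X in _ - X](ul_cst uL) -(ulB uL bu (bdd_cst _)).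
  apply: (ul_cvg0 uL); first by apply: bddB => //; exact: bdd_cst.
  move=> e /eps_lt[N hN]; exists (maxn N k) => r; rewrite geq_max => /andP[/hN Nr kr].
  have kS := leq_trans kr (KS r); apply: le_trans Nr; apply: le_trans (hf r).
  rewrite /m (emass_sum _ _ (fun X => (pi X == A)%:R)) ?leq_double//.
  rewrite (eq_bigr (fun i => (stn (S r))%:R^-1 * (drop (stK (S r) - k) (f r i) == A)%:R)); last first.
    by move=> i _; rewrite hpi.
  rewrite -(freq_sum (f r) (fun X => (drop (stK (S r) - k) X == A)%:R)).
  have dm := dmass_drop_sum (stK (S r) - k) A; rewrite (subnK kS) in dm.
  rewrite -dm -sumrB; apply: le_trans (ler_norm_sum _ _ _) _; apply: ler_sum => X _.
  by rewrite -mulrBl normrM ler_piMr// normr_nat; case: (_ == _); rewrite ?ler01.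
exists p; split.
- split=> [X||X].
  + by have /andP[] := ul_01 uL (fun r => m01 r X).
  + rewrite /p -[RHS](ul_cst uL 1); congr L; apply/funext => r.
    exact: emass_nil (so_n (oS r)).
  (* The splitting rule for [X] holds once the resolution of the stage exceeds the length of [X],
     that is, eventually. *)
  + rewrite /p -(ulD uL)//; apply: (ul_ev uL (N := (size X).+1)) => //; first exact: bddD.
    move=> r rX; apply: emass_split; first exact: so_n (oS r).
    by have := KS r; lia.
- apply: (marg evs (fun r => sts (S r))) => [r|r i k kK]; first exact: so_f1.
  by rewrite -doubleB drop_mrg ?evs_mrg ?size_drop ?size_tuple.
- apply: (marg ods (fun r => stt (S r))) => [r|r i k kK]; first exact: so_f2.
  by rewrite -doubleB drop_mrg ?ods_mrg ?size_drop ?size_tuple.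
- move=> e /eps_lt[q /(_ q (leqnn q)) qe].
  have hq1 : stepapprox (wext W1) e (stK (S q)) (stw1 (S q)) by exact: le_trans (so_a1 (oS q)) qe.
  have hq2 : stepapprox (wext W2) e (stK (S q)) (stw2 (S q)) by exact: le_trans (so_a2 (oS q)) qe.
  exists (stK (S q)), (stw1 (S q)), (stw2 (S q)); split=> //.
  + exact: so_w1 (oS q).
  + exact: so_w2 (oS q).
  set k := stK (S q); set g := joint_gap _ _.
  pose C : R := #|{: k.*2.-tuple bool}|%:R ^+ 2.
  have bmm Z Z' : bdd (fun r => m r Z * m r Z') by exact: bddM.
  have bs Z : bdd (fun r => \sum_(Z' : k.*2.-tuple bool) m r Z * m r Z' * g Z Z').
    by apply: bdd_sum => Z'; apply: bddM => //; exact: bdd_cst.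
  have -> : \sum_(Z : k.*2.-tuple bool) \sum_(Z' : k.*2.-tuple bool) p Z * p Z' * g Z Z' =
     L (fun r => \sum_(Z : k.*2.-tuple bool) \sum_(Z' : k.*2.-tuple bool) m r Z * m r Z' * g Z Z').
    rewrite (ul_sum uL)//; apply: eq_bigr => Z _; rewrite (ul_sum uL); last first.
      by move=> Z'; apply: bddM => //; exact: bdd_cst.
    apply: eq_bigr => Z' _; rewrite (ulM uL (bmm Z Z') (bdd_cst _)) (ul_cst uL).
    by rewrite (ulM uL (bm Z) (bm Z')).
  (* The right side of [stage_bound] at stage [r]; its [eps r] part has ultralimit 0. *)
  have -> : 2 * e = L (fun r => 2 * e + (35 * C + 6) * eps r).
    have bC : bdd (fun r => (35 * C + 6) * eps r) by apply: bddM => //; exact: bdd_cst.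
    rewrite (ulD uL (bdd_cst _) bC) (ulM uL (bdd_cst _) epsb) !(ul_cst uL) Leps.
    by rewrite mulr0 addr0.
  apply: (ul_le uL).
  + exact: bdd_sum.
  + by apply: bddD; [exact: bdd_cst|apply: bddM => //; exact: bdd_cst].
  exists k => r kr; have kS := leq_trans kr (KS r).
  rewrite /m emass_sum2 ?leq_double//.
  apply: le_trans (stage_bound g1 g2 (oS r) kS (so_w1 (oS q)) (so_w2 (oS q)) hq1 hq2) _.
  rewrite -/k -/C le_eqVlt; apply/orP; left; apply/eqP; ring.
Qed.

End Coupling.

(** * The measure-preserving maps defined by a coupling *)

Section DigitMap.
Context {R : realType} (p : seq bool -> R) (pi : seq bool -> seq bool).
Hypothesis bp : bitmass p.
Hypothesis pi_nil : pi [::] = [::].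
(** Satisfied by [evs] and [ods]: each pair of joint bits contributes one bit to the selected
    string. *)
Hypothesis pi_cons : forall a b Z, exists c, pi [:: a, b & Z] = c :: pi Z.
Hypothesis marg : has_marginal p pi.
Notation dpre := (pre (@dmass R)).
Notation leb := (@lebesgue_measure R).

Definition digits k (x : R) : seq bool := pi (pre p k.*2 x).

Definition dlow k (x : R) : R := ell (@dmass R) (digits k x).

(* The real number with binary digits [digits k x]; being a supremum of step
   functions it is measurable. *)
Definition digit_map (x : R) : R := sups (fun k => dlow k x) 0.

Lemma digitsS k x : exists c, digits k.+1 x = c :: digits k x.
Proof. exact: pi_cons. Qed.

Lemma size_digits k x : size (digits k x) = k.
Proof.
elim: k => [|k IH]; first by rewrite /digits /= pi_nil.
by have [c ->] := digitsS k x; rewrite /= IH.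
Qed.

Lemma dlowS k x : dlow k x <= dlow k.+1 x /\
  dlow k.+1 x + 2^-1 ^+ k.+1 <= dlow k x + 2^-1 ^+ k.
Proof.
rewrite /dlow; have [c ->] := digitsS k x; rewrite /= /dmass /= size_digits exprS.
have h : 0 <= 2^-1 ^+ k :> R by rewrite exprn_ge0 ?invr_ge0.
by case: c; split; lra.
Qed.

Lemma dlow_le j k x : dlow j x <= dlow k x + 2^-1 ^+ k.
Proof.
have mono i l : dlow i x <= dlow (l + i) x.
  by elim: l => [|l IH]//; apply: le_trans IH _; exact: (dlowS _ _).1.
have anti i l : dlow (l + i) x + 2^-1 ^+ (l + i) <= dlow i x + 2^-1 ^+ i.
  by elim: l => [|l IH]//; apply: le_trans IH; exact: (dlowS _ _).2.
have pos l : 0 <= 2^-1 ^+ l :> R by rewrite exprn_ge0 ?invr_ge0.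
case: (leqP j k) => jk.
  have := mono j (k - j)%N; rewrite subnK// => h.
  by apply: le_trans h _; rewrite lerDl.
have := anti k (j - k)%N; rewrite subnK ?(ltnW jk)//; apply: le_trans.
by rewrite lerDl.
Qed.

Lemma digit_map_bounds k x : dlow k x <= digit_map x <= dlow k x + 2^-1 ^+ k.
Proof.
rewrite /digit_map /sups /=.
have ub : ubound (sdrop (fun k => dlow k x) 0) (dlow k x + 2^-1 ^+ k).
  by move=> _ [j _ <-]; exact: dlow_le.
have mem j : sdrop (fun k => dlow k x) 0 (dlow j x) by exists j.
apply/andP; split; last by apply: ge_sup => //; exists (dlow 0 x).
by apply: ub_le_sup => //; exists (dlow k x + 2^-1 ^+ k).
Qed.

Lemma digit_map_I01 x : digit_map x \in I01 R.
Proof.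
rewrite inE /I01 /= in_itv /=; have := digit_map_bounds 0 x.
by rewrite /dlow /digits /= pi_nil /= add0r expr0.
Qed.

Lemma bmeas_digits k (h : seq bool -> R) : bmeas (fun x => h (digits k x)).
Proof. exact: (bmeas_fin (@fmeas_pret R p k.*2) (fun X => h (pi X))). Qed.

Lemma measurable_digit_map : measurable_fun setT digit_map.
Proof.
apply: measurable_fun_sups => [x _|k].
  by exists (dlow 0 x + 2^-1 ^+ 0) => _ [j _ <-]; exact: dlow_le.
by case: (bmeas_digits k (ell (@dmass R))).
Qed.

Lemma mean_digits k (h : seq bool -> R) :
  mean (fun x => h (digits k x)) = mean (fun x => h (dpre k x)).
Proof.
rewrite (mean_fin (@fmeas_pret R p k.*2) (fun X => h (pi X))).
rewrite (mean_fin (@fmeas_pret R (@dmass R) k) (fun X => h X)).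
under eq_bigr do rewrite (law_pret bp).
under [RHS]eq_bigr do rewrite (law_pret (@bitmass_dmass R)) -marg mulr_suml.
rewrite exchange_big /=; apply: eq_big_seq => X _.
have spi : size (pi X) == k.
  case: X => X /= /eqP; elim: k X => [|k IH] X; first by move/size0nil => ->; rewrite pi_nil.
  case: X => [|a [|b X]]// [] /IH/eqP sX.
  by have [c ->] := pi_cons a b X; rewrite /= sX.
rewrite (bigD1 (Tuple spi)) //= eqxx mulr1 big1 ?addr0// => B /negbTE nB.
by rewrite (_ : (_ == _) = false) ?mulr0 ?mul0r// -nB -val_eqE eq_sym.
Qed.

(** Both events lie between [lo] and [hi] of the first [k] digits, which have the same law on the
    two sides. The means of [lo] and [hi] differ by at most [2 * 2^-k], as they disagree only for
    [x] within [2^-k] of [a]. *)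
Lemma mean_digit_map_ray (a : R) :
  mean (fun x => (a <= digit_map x)%R%:R : R) = mean (fun x => (a <= x)%R%:R : R).
Proof.
have bray (f : R -> R) : measurable_fun setT f -> bmeas (fun x => (a <= f x)%R%:R : R).
  move=> mf; rewrite (_ : (fun x => _) = (\1_(f @^-1` `[a, +oo[%classic) : R -> R)).
    by apply: bmeas_indic; rewrite -[X in measurable X]setTI; apply: mf.
  apply/funext => x; rewrite indicE; congr (nat_of_bool _)%:R.
  by apply/idP/idP; rewrite inE /= in_itv /= andbT.
have b1 := bray _ measurable_digit_map; have b2 := bray _ (@measurable_id _ _ setT).
apply: (@eq_eps _ _ _ 2) => // e e0; have [k hk] := half_expn_lt e0.
pose lo X : R := (a <= ell (@dmass R) X)%R%:R.
pose hi X : R := (a <= ell (@dmass R) X + 2^-1 ^+ k)%R%:R.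
have bdig h : bmeas (fun x => h (dpre k x) : R).
  exact: (bmeas_fin (@fmeas_pret R (@dmass R) k) (fun X => h X)).
have sandwich (u c v : R) : u <= v -> v <= u + c -> (a <= u)%R%:R <= (a <= v)%R%:R :> R /\
   (a <= v)%R%:R <= (a <= u + c)%R%:R :> R.
  move=> uv vc; split; rewrite ler_nat.
    by case: (leP a u) => // au; rewrite (le_trans au uv).
  by case: (leP a v) => // av; rewrite (le_trans av vc).
have hd x : lo (digits k x) <= (a <= digit_map x)%R%:R <= hi (digits k x).
  have /andP[d1 d2] := digit_map_bounds k x.
  by have [s1 s2] := sandwich _ _ _ d1 d2; rewrite s1 s2.
have hx x : x \in I01 R -> lo (dpre k x) <= (a <= x)%R%:R <= hi (dpre k x).
  move=> xI; have := pre_bounds (@bitmass_dmass R) k xI.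
  rewrite [dmass (pre _ _ _)]/dmass size_pre => /andP[d1 d2].
  by have [s1 s2] := sandwich _ _ _ d1 d2; rewrite s1 s2.
have l1 : mean (fun x => lo (dpre k x)) <= mean (fun x => (a <= digit_map x)%R%:R : R).
  rewrite -mean_digits; apply: ler_mean => //; first exact: bmeas_digits.
  by move=> x _; case/andP: (hd x).
have l2 : mean (fun x => (a <= digit_map x)%R%:R : R) <= mean (fun x => hi (dpre k x)).
  rewrite -mean_digits; apply: ler_mean => //; first exact: bmeas_digits.
  by move=> x _; case/andP: (hd x).
have l3 : mean (fun x => lo (dpre k x)) <= mean (fun x => (a <= x)%R%:R : R).
  by apply: ler_mean => // x /hx/andP[].
have l4 : mean (fun x => (a <= x)%R%:R : R) <= mean (fun x => hi (dpre k x)).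
  by apply: ler_mean => // x /hx/andP[].
have c0 : 0 <= 2^-1 ^+ k :> R by rewrite exprn_ge0 ?invr_ge0.
have gap : mean (fun x => hi (dpre k x)) - mean (fun x => lo (dpre k x)) <= 2 * 2^-1 ^+ k.
  have ac : a - 2^-1 ^+ k <= a + 2^-1 ^+ k by lra.
  rewrite -meanB//; apply: le_trans (_ : (a + 2^-1 ^+ k) - (a - 2^-1 ^+ k) <= _); last by lra.
  apply: le_trans (mean_itv_le ac); apply: ler_mean.
  - exact: bmeasB.
  - by apply: bmeas_indic; exact: measurable_itv.
  - move=> x xI; have := pre_bounds (@bitmass_dmass R) k xI.
    rewrite [dmass (pre _ _ _)]/dmass size_pre => /andP[d1 d2]; rewrite indicE.
    have -> : (x \in `[a - 2^-1 ^+ k, a + 2^-1 ^+ k]%classic) = (a - 2^-1 ^+ k <= x <= a + 2^-1 ^+ k).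
      by apply/idP/idP; rewrite inE /= in_itv.
    rewrite /hi /lo; set l := ell _ _ in d1 d2 *; set c := 2^-1 ^+ k in d2 *.
    case: (leP a l) => h1; case: (leP a (l + c)) => h2; rewrite ?subrr ?sub0r ?subr0//=;
      [by lra|].
    by rewrite (_ : _ <= x <= _)//; apply/andP; split; lra.
move: l1 l2 l3 l4 gap; set m1 := mean _; set m2 := mean _; set m3 := mean _; set m4 := mean _.
by move=> *; rewrite ler_norml; apply/andP; split; lra.
Qed.

(** The rays are stable under intersection and generate the Borel sets, and on them the two finite
    measures agree by [mean_digit_map_ray]. *)
Lemma mp_digit_map : mp_map digit_map.
Proof.
have mphi := measurable_digit_map; have mI := @measurable_I01 R.
split; [exact: measurable_funS mphi|by move=> x _; exact: digit_map_I01|move=> A mA AI].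
pose m1 : {measure set (measurableTypeR R) -> \bar R} := mrestr leb mI.
suff h : m1 A = pushforward m1 (digit_map : measurableTypeR R -> measurableTypeR R) A.
  rewrite setIC; transitivity (leb (A `&` I01 R)); first exact: esym h.
  by congr (_ _); apply/setIidPl.
have rayE a : (fun x => (a <= x)%R%:R : R) = \1_(`[a, +oo[%classic).
  by apply/funext => x; rewrite indicE; congr (nat_of_bool _)%:R; apply/idP/idP;
    rewrite inE /= in_itv /= andbT.
apply: (@measure_unique _ R (measurableTypeR R) (@RGenCInfty.G R) (fun i : nat => `[- i%:R, +oo[%classic)) => //.
- exact: RGenCInfty.measurableE.
- move=> _ _ [x ->] [y ->]; exists (Num.max x y); apply/seteqP; split => z /=.
    by rewrite !in_itv /= !andbT ge_max => -[-> ->].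
  by rewrite !in_itv /= !andbT ge_max => /andP[-> ->].
- by move=> i; exists (- i%:R).
- apply/seteqP; split => // x _; exists (Num.bound `|x|) => //=.
  rewrite in_itv /= andbT lerNl; apply: le_trans (ltW (archi_boundP (normr_ge0 x))).
  by rewrite -normrN ler_norm.
- move=> _ [a ->]; rewrite /pushforward /m1 /= /mrestr.
  have mB : measurable (digit_map @^-1` `[a, +oo[%classic).
    by rewrite -[X in measurable X]setTI; apply: mphi.
  have mA' : measurable (`[a, +oo[%classic : set R) by exact: measurable_itv.
  transitivity (mean (\1_(`[a, +oo[%classic) : R -> R))%:E; first by rewrite mean_indic.
  transitivity (mean (\1_(digit_map @^-1` `[a, +oo[%classic) : R -> R))%:E; last by rewrite mean_indic.
  congr EFin; rewrite -rayE -mean_digit_map_ray; congr mean; apply/funext => x.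
  by rewrite indicE; congr (nat_of_bool _)%:R; apply/idP/idP; rewrite inE /= in_itv /= andbT.
- move=> i; apply: (@le_lt_trans _ _ (leb (I01 R))); last by rewrite leb_I01 ltry.
  by rewrite /m1 /= /mrestr; apply: le_measure; rewrite ?inE//; apply: measurableI.
Qed.

(** The ambiguity of binary expansions: the digits are recovered unless the supremum reaches the
    right end of its half-open interval, as for a tail of ones. *)
Lemma dpre_digit_map k x : dpre k (digit_map x) != digits k x ->
  digit_map x = dlow k x + 2^-1 ^+ k.
Proof.
have /andP[h1 h2] := digit_map_bounds k x; apply: contraNeq => ne.
have lt : digit_map x < dlow k x + 2^-1 ^+ k by rewrite lt_neqAle ne.
have := ell_le1 (@bitmass_dmass R) (digits k x).
rewrite [dmass (digits k x)]/dmass size_digits -/(dlow k x) => le1.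
have /andP[m0 _] : 0 <= digit_map x <= 1.
  by have := digit_map_I01 x; rewrite inE /I01 /= in_itv.
rewrite (pre_eq (@bitmass_dmass R)) ?size_digits//; last by rewrite m0 (lt_le_trans lt).
by rewrite /dmass size_digits -/(dlow k x) h1.
Qed.

Lemma bmeas_digit_mismatch k : bmeas (fun x => (dpre k (digit_map x) != digits k x)%:R : R).
Proof.
pose D1 x := pret (@dmass R) k (digit_map x).
have f1 : fmeas D1.
  move=> X; rewrite -[X in measurable X]setTI.
  exact: (measurable_digit_map measurableT (@fmeas_pret R (@dmass R) k X)).
have -> : (fun x => (dpre k (digit_map x) != digits k x)%:R : R) =
   (fun x => 1 - \sum_(X : k.-tuple bool) (D1 x == X)%:R * (digits k x == X)%:R).
  apply/funext => x; rewrite (bigD1 (D1 x)) //= eqxx mul1r big1 ?addr0; last first.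
    by move=> X /negbTE; rewrite eq_sym => ->; rewrite mul0r.
  by rewrite [in RHS]eq_sym; case: (_ == _); rewrite ?subrr ?subr0.
apply: bmeasB; first exact: bmeas_cst.
apply: bmeas_sum => X _; apply: bmeasM; first exact: (bmeas_cell f1).
exact: (bmeas_digits k (fun Y => (Y == X)%:R)).
Qed.

(** The exceptional points are mapped into the finitely many right endpoints of level [k], whose
    preimage is null because the map preserves measure. *)
Lemma digit_map_digits_ae k : mean (fun x => (dpre k (digit_map x) != digits k x)%:R : R) = 0.
Proof.
have mp := mp_digit_map.
pose P (X : k.-tuple bool) : set R := `[ell (@dmass R) X + 2^-1 ^+ k, ell (@dmass R) X + 2^-1 ^+ k]%classic.
have mP X : measurable (P X) by exact: measurable_itv.
have bP X : bmeas (fun x => \1_(P X) (mpx digit_map x) : R).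
  exact: (bmeas_comp (bmeas_indic (mP X)) (measurable_mpx mp)).
apply/eqP; rewrite eq_le; apply/andP; split; last by apply: mean_ge0.
apply: (@le_trans _ _ (mean (fun x => \sum_X \1_(P X) (mpx digit_map x) : R))).
  apply: ler_mean.
  - exact: bmeas_digit_mismatch.
  - by apply: bmeas_sum => X _.
  - move=> x xI; case: eqVneq => [_|/dpre_digit_map hx] /=; first by apply: sumr_ge0.
    have sx : size (digits k x) == k by rewrite size_digits.
    rewrite (bigD1 (Tuple sx)) //= indicE (_ : _ \in _) ?lerDl; first by apply: sumr_ge0.
    by rewrite inE /P /= in_itv /= mpxE// hx /dlow lexx.
rewrite mean_sum; last by move=> X _.
apply: sumr_le0 => X _; rewrite mean_mp_indic//.
by apply: le_trans (mean_itv_le (lexx _)) _; rewrite subrr.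
Qed.

(** Off the null set of mismatches, [v] of the dyadic digits of the image is [v] of [digits], and
    measure preservation transports the L1 error unchanged. *)
Lemma digit_map_pullback (W : R -> R -> R) (e : R) k (v : seq bool -> seq bool -> R) :
  graphon W -> (forall X Y, 0 <= v X Y <= 1) -> stepapprox (wext W) e k v ->
  mean2 (fun q => `|wext (pullback digit_map W) q - v (digits k q.1) (digits k q.2)|) <= e.
Proof.
move=> gW v01 hv; have mp := mp_digit_map; have mx := measurable_mpx mp.
have bW := bmeas_wext gW; have bd := bmeas_dfin (@dmass R) k v.
have bdig := bmeas_dfin p k.*2 (fun X Y => v (pi X) (pi Y)).
pose g (q : R * R) := `|wext W q - v (dpre k q.1) (dpre k q.2)|.
have bg : bmeas g by apply: bmeas_norm; apply: bmeasB.
have g01 q : 0 <= g q <= 1 by exact: l1_01.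
pose bad x : R := (dpre k (digit_map x) != digits k x)%:R.
have bb : bmeas bad by exact: bmeas_digit_mismatch.
have bb1 : bmeas (fun q : R * R => bad q.1) by exact: (bmeas_comp bb measurable_fst).
have bb2 : bmeas (fun q : R * R => bad q.2) by exact: (bmeas_comp bb measurable_snd).
have bgx := bmeas_pullback2 mp bg.
have bbb : bmeas (fun q : R * R => bad q.1 + bad q.2) by exact: bmeasD.
apply: (@le_trans _ _ (mean2 (fun q => g (mpx digit_map q.1, mpx digit_map q.2) + (bad q.1 + bad q.2)))).
  apply: ler_mean2.
  - by apply: bmeas_norm; apply: bmeasB => //; apply: bmeas_wext; exact: graphon_pullback.
  - exact: bmeasD.
  - move=> x y xI yI; rewrite wext_pullback//= /g /= !mpxE//.
    set z := wext W _; have z01 : 0 <= z <= 1 by exact: wext01.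
    have le1 (a : R) : 0 <= a <= 1 -> `|z - a| <= 1.
      by move: z01 => /andP[? ?] /andP[? ?]; rewrite ler_norml; apply/andP; split; lra.
    rewrite /bad; case: eqVneq => [->|_] /=; last first.
      by apply: le_trans (le1 _ (v01 _ _)) _; rewrite addrCA lerDl addr_ge0.
    case: eqVneq => [->|_] /=; first by rewrite !addr0.
    by apply: le_trans (le1 _ (v01 _ _)) _; rewrite add0r lerDr.
rewrite mean2D// mean2_mp// mean2D//.
have -> : mean2 (fun q => bad q.1) = 0.
  rewrite /mean2 /= -[RHS](digit_map_digits_ae k).
  by apply: eq_mean => x _; rewrite mean_cst.
have -> : mean2 (fun q => bad q.2) = 0.
  by rewrite /mean2 /= (digit_map_digits_ae k) mean_cst.
by rewrite !addr0.
Qed.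

End DigitMap.

Lemma hom_dens_weakly_iso (R : realType) (W1 W2 : R -> R -> R) : graphon W1 -> graphon W2 ->
  (forall n (F : sgraph n), hom_dens W1 F = hom_dens W2 F) -> weakly_iso W1 W2.
Proof.
move=> g1 g2 hom12; have [p [bp m1 m2 happ]] := exists_coupling g1 g2 hom12.
have c1 a b Z : exists c, evs [:: a, b & Z] = c :: evs Z by exists a.
have c2 a b Z : exists c, ods [:: a, b & Z] = c :: ods Z by exists b.
pose phi := digit_map p evs; pose psi := digit_map p ods.
have mp1 : mp_map phi by exact: mp_digit_map.
have mp2 : mp_map psi by exact: mp_digit_map.
exists phi, psi; split=> //; apply/weakly_iso_mean2 => //.
apply/eqP; rewrite eq_le; apply/andP; split; last by apply: mean2_ge0.
apply: (@le_eps _ _ _ 4) => // e e0; rewrite add0r.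
have [K [v1 [v2 [v101 v201 a1 a2 hgap]]]] := happ e e0.
have h1 := digit_map_pullback bp erefl c1 m1 g1 v101 a1.
have h2 := digit_map_pullback bp erefl c2 m2 g2 v201 a2.
rewrite -(mean2_pre bp) in hgap.
have b1 := bmeas_wext (graphon_pullback mp1 g1); have b2 := bmeas_wext (graphon_pullback mp2 g2).
have d1 := bmeas_dfin p K.*2 (fun X Y => v1 (evs X) (evs Y)).
have d2 := bmeas_dfin p K.*2 (fun X Y => v2 (ods X) (ods Y)).
have dg := bmeas_dfin p K.*2 (joint_gap v1 v2).
have n1 := bmeas_norm (bmeasB b1 d1); have n2 := bmeas_norm (bmeasB b2 d2).
(* Each pullback is within [e] of its step function in the coupled digits, and the two step
   functions are within [2 * e] of each other under the coupling. *)
have -> : 4 * e = e + (2 * e + e) by ring.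
apply: le_trans (lerD h1 (lerD hgap h2)).
rewrite -mean2D// -mean2D//; last exact: bmeasD.
apply: ler_mean2.
- by apply: bmeas_norm; apply: bmeasB.
- by apply: bmeasD => //; apply: bmeasD.
- move=> x y _ _; rewrite /joint_gap /digits /=.
  set a := wext _ _; set b := wext _ _; set c := v1 _ _; set d := v2 _ _.
  apply: le_trans (ler_distD c _ _) _; rewrite lerD2l.
  by apply: le_trans (ler_distD d _ _) _; rewrite lerD2l distrC.
Qed.

Theorem theorem3 (R : realType) :
  (forall rho : graph_fun R, bfp_character rho ->
     exists W : R -> R -> R, graphon W /\ represents rho W) /\
  (forall W : R -> R -> R, graphon W ->
     exists rho : graph_fun R, bfp_character rho /\ represents rho W) /\
  (forall (rho : graph_fun R) (W1 W2 : R -> R -> R),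
     graphon W1 -> graphon W2 -> represents rho W1 ->
     (represents rho W2 <-> weakly_iso W1 W2)).
Proof.
split; [|split].
- by move=> rho; exact: bfp_represented.
- by move=> W gW; exists (@hom_dens R W); split; [exact: hom_dens_bfp|].
- move=> rho W1 W2 g1 g2 r1; split=> [r2|iso12].
    by apply: hom_dens_weakly_iso => //; exact: represents_all r1 r2.
  by move=> n F nF; rewrite r1//; exact: weakly_iso_hom_dens.
Qed.
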